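(* Assume that $F$ is $\sigma$-strongly convex, $f$ is $L$-smooth, each component $f_{i,j}$ is $(\ell_1,\ell_2)$-smooth, and the gossip matrix $W$ is doubly stochastic with the properties listed in the context. Then, under an appropriate choice of the hyperparameters (step size $\eta$, minibatch size $b$, number of mixing steps $M$, number of epochs), in order to obtain $\mathbb{E}[F(\bar y^{k+1})]-F(x^* )\le\epsilon$ the algorithm PMGT-SVRG requires (in expectation) at most $$\mathcal{O}\left(\left(n+\frac{L+(\ell_1\ell_2)^{1/2}}{\sigma}\,n^{1/2}\right)\log\frac{F(\bar y^0)-F(x^* )}{\epsilon}\right)$$ stochastic first-order oracle (SFO) calls and $$\tilde{\mathcal{O}}\left(\frac{\sqrt n+(L+\sqrt{\ell_1\ell_2})/\sigma}{(1-\lambda_2(W))^{1/2}}\,\log\frac{F(\bar y^0)-F(x^* )}{\epsilon}\right)$$ rounds of communication.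
   Context: Problem. Let $m,n,d\ge 1$. For $i\in[m]$, $j\in[n]$ let $f_{i,j}:\mathbb{R}^d\to\mathbb{R}$ be differentiable (possibly nonconvex), $f_i=\frac1n\sum_{j=1}^n f_{i,j}$, $f=\frac1m\sum_{i=1}^m f_i$, $F=f+\psi$ with $\psi$ proper convex (possibly non-smooth), $x^*=\arg\min F$. Standing assumptions: $f$ is convex and $L$-smooth ($\|\nabla f(x)-\nabla f(y)\|\le L\|x-y\|$); $f$ is $\sigma_f$-strongly convex and $\psi$ is $\sigma_\psi$-strongly convex with $\sigma_f,\sigma_\psi\ge0$ and $\sigma=\sigma_f+\sigma_\psi>0$; each $f_{i,j}$ is $(\ell_1,\ell_2)$-smooth, i.e. $-\frac{\ell_2}{2}\|x-y\|^2\le f_{i,j}(x)-f_{i,j}(y)-\langle\nabla f_{i,j}(y),x-y\rangle\le\frac{\ell_1}{2}\|x-y\|^2$ for all $x,y$, with $\ell_2\ge\ell_1>0$. Notation. Bold letters denote matrices in $\mathbb{R}^{m\times d}$ whose $i$-th row (subscript $i$) is held by agent $i$; $\bar x=\frac1m\mathbf 1^\top\mathbf x$. $\Psi(\mathbf x)=\frac1m\sum_i\psi(x_i)$ and $\mathrm{prox}_{m\eta,\Psi}(\mathbf x)=\arg\min_{\mathbf z}\{\Psi(\mathbf z)+\frac{1}{2m\eta}\|\mathbf z-\mathbf x\|^2\}$ (row-wise $\mathrm{prox}_{\eta,\psi}$). Network. $W\in\mathbb{R}^{m\times m}$ has $W_{i,j}\ge 0$ if agents $i,j$ are neighbours and $W_{i,j}=0$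 if they are not connected; $W$ is symmetric, $0\preccurlyeq W\preccurlyeq I$, $W\mathbf 1=\mathbf 1$, $\mathrm{null}(I-W)=\mathrm{span}(\mathbf 1)$. $\lambda_2(W)$ is its second largest eigenvalue. $\mathrm{FastMix}(\mathbf x^0,M)$ returns $\mathbf x^M$ where $\mathbf x^{-1}=\mathbf x^0$, $\mathbf x^{k+1}=(1+\eta_w)W\mathbf x^k-\eta_w\mathbf x^{k-1}$, $\eta_w=\frac{1-\sqrt{1-\lambda_2^2(W)}}{1+\sqrt{1-\lambda_2^2(W)}}$; one call costs $M$ rounds of communication. PMGT-SVRG. Initialize $y_i^0=y_i^{-1}=x_0$, $\hat s_i^0=\nabla f(x_0)$ for all $i$. For $k=0,1,\dots$: set $\nu_i^{k+1}=\hat s_i^k+\nabla f_i(y_i^k)-\nabla f_i(y_i^{k-1})$, $\hat{\mathbf s}^{k+1}=\mathrm{FastMix}(\nu^{k+1},M)$, $\mathbf w^0=\mathbf y^k$, $\mathbf s^{-1}=\mathbf v^{-1}=\mu=\hat{\mathbf s}^{k+1}$; let $t_0=\lceil n/b\rceil$ and sample $T\sim\mathrm{Geom}(1/t_0)$ (i.e. $\Pr[T=t]=(1-p)^tp$, $t\ge0$, $p=1/t_0$); for $t=0,\dots,T$: each agent samples a batch $B_i^t$ of $b$ indices uniformly from $[n]$ with replacement, $v_i^t=\mu_i+\frac1b\sum_{j\in B_i^t}(\nabla f_{i,j}(w_i^t)-\nabla f_{i,j}(w_i^0))$, $\mathbf s^t=\mathrm{FastMix}(\mathbf s^{t-1}+\mathbf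 v^t-\mathbf v^{t-1},M)$, $\mathbf w^{t+1}=\mathrm{FastMix}(\mathrm{prox}_{m\eta,\Psi}(\mathbf w^t-\eta\mathbf s^t),M)$; finally $\mathbf y^{k+1}=\mathbf w^{T+1}$. An SFO call is one evaluation of some $\nabla f_{i,j}$ (counted per agent). $\tilde{\mathcal O}$ hides logarithmic factors in the problem parameters. *)

(* Defs.v *)
From HB Require Import structures.
From mathcomp Require Export all_boot all_order all_algebra.
From mathcomp Require Export all_classical all_reals all_analysis.
Export Order.TTheory GRing.Theory Num.Theory.
Export numFieldNormedType.Exports.

Set Implicit Arguments.
Unset Strict Implicit.
Unset Printing Implicit Defensive.

Local Open Scope classical_set_scope.
Local Open Scope ring_scope.

Section Euclidean.
Variable R : realType.

(* The norm that MathComp-Analysis puts on matrices is the sup norm; the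
   Euclidean (for row vectors) / Frobenius (for matrices) structure is
   therefore defined separately. *)
Definition inner p d (x y : 'M[R]_(p, d)) : R := \sum_i \sum_j x i j * y i j.

Definition normsq p d (x : 'M[R]_(p, d)) : R := inner x x.

Definition enorm p d (x : 'M[R]_(p, d)) : R := Num.sqrt (normsq x).

Definition grad d (g : 'rV[R]_d -> R) (x : 'rV[R]_d) : 'rV[R]_d :=
  \row_j 'D_(delta_mx 0 j) g x.

Definition lipschitz_smooth d (L : R) (g : 'rV[R]_d -> R) : Prop :=
  forall x y, enorm (grad g x - grad g y) <= L * enorm (x - y).

Definition two_sided_smooth d (l1 l2 : R) (g : 'rV[R]_d -> R) : Prop :=
  forall x y,
    - (l2 / 2) * normsq (x - y) <= g x - g y - inner (grad g y) (x - y)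
                                <= l1 / 2 * normsq (x - y).

(* Functions may take the value +oo.  With sigma = 0 this is convexity.  In
   \bar R one has 0 * +oo = 0, so t = 0 and t = 1 are harmless. *)
Definition strongly_convex d (sigma : R) (g : 'rV[R]_d -> \bar R) : Prop :=
  forall (x y : 'rV[R]_d) (t : R), 0 <= t <= 1 ->
    (g (t *: x + (1 - t) *: y)%R <=
     t%:E * g x + (1 - t)%:E * g y
       - (sigma / 2 * t * (1 - t) * normsq (x - y))%:E)%E.

Definition proper_fun d (g : 'rV[R]_d -> \bar R) : Prop :=
  (forall x, g x != -oo%E) /\ (exists x, g x != +oo%E).

Definition is_prox p d (c : R) (g : 'M[R]_(p, d) -> \bar R)
    (x z : 'M[R]_(p, d)) : Prop :=
  forall u, (g z + ((2 * c)^-1 * normsq (z - x)%R)%:E <=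
             g u + ((2 * c)^-1 * normsq (u - x)%R)%:E)%E.

(* Total function: its value is x when the argmin does not exist. *)
Definition prox p d (c : R) (g : 'M[R]_(p, d) -> \bar R)
    (x : 'M[R]_(p, d)) : 'M[R]_(p, d) :=
  xget x [set z | is_prox c g x z].

End Euclidean.

Section Gossip.
Variables (R : realType) (m : nat).

Definition psd (A : 'M[R]_m) : Prop := forall x : 'rV_m, 0 <= (x *m A *m x^T) 0 0.

(* nbr is the adjacency relation of the communication graph.  Every agent may
   use its own value, so the diagonal of W is not constrained by nbr. *)
Definition gossip_matrix (nbr : rel 'I_m) (W : 'M[R]_m) : Prop :=
  [/\ symmetric nbr /\
      (forall i j, i != j ->
         (nbr i j -> 0 <= W i j) /\ (~~ nbr i j -> W i j = 0)),
      W^T = W,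
      psd W /\ psd (1%:M - W),
      W *m const_mx 1 = const_mx 1 :> 'cV[R]_m &
      forall x : 'cV[R]_m,
        (1%:M - W) *m x = 0 <-> exists c : R, x = const_mx c].

(* The real eigenvalues with multiplicity, in decreasing order. *)
Definition eigenvalues (W : 'M[R]_m) : seq R :=
  xget [::] [set s : seq R | sorted (fun a b : R => b <= a) s /\
                             char_poly W = \prod_(a <- s) ('X - a%:P)].

(* For m = 1 there is no second eigenvalue and lambda2 W = 0. *)
Definition lambda2 (W : 'M[R]_m) : R := (eigenvalues W)`_1.

Definition eta_w (W : 'M[R]_m) : R :=
  let r := Num.sqrt (1 - lambda2 W ^+ 2) in (1 - r) / (1 + r).

Fixpoint fastmix_rec d (W : 'M[R]_m) (M : nat) (xprev x : 'M[R]_(m, d)) :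
    'M[R]_(m, d) :=
  if M is M'.+1 then
    fastmix_rec W M' x ((1 + eta_w W) *: (W *m x) - eta_w W *: xprev)
  else x.

Definition fastmix d (W : 'M[R]_m) (M : nat) (x : 'M[R]_(m, d)) : 'M[R]_(m, d) :=
  fastmix_rec W M x x.

End Gossip.

Section Problem.
Variables (R : realType) (m n d : nat).
Variables (fc : 'I_m -> 'I_n -> 'rV[R]_d -> R) (psi : 'rV[R]_d -> \bar R).

Definition f_local (i : 'I_m) (x : 'rV[R]_d) : R :=
  n%:R^-1 * \sum_(j < n) fc i j x.

Definition f_global (x : 'rV[R]_d) : R := m%:R^-1 * \sum_(i < m) f_local i x.

Definition objective (x : 'rV[R]_d) : \bar R := ((f_global x)%:E + psi x)%E.

Definition Psi (x : 'M[R]_(m, d)) : \bar R :=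
  ((m%:R^-1)%:E * \sum_(i < m) psi (row i x))%E.

Definition row_mean (x : 'M[R]_(m, d)) : 'rV[R]_d :=
  m%:R^-1 *: (const_mx 1 *m x).

Definition local_grads (x : 'M[R]_(m, d)) : 'M[R]_(m, d) :=
  \matrix_(i < m) grad (f_local i) (row i x).

End Problem.

Section Algorithm.
Variables (R : realType) (m n d b : nat).
Variables (fc : 'I_m -> 'I_n -> 'rV[R]_d -> R) (psi : 'rV[R]_d -> \bar R).
Variables (x0 : 'rV[R]_d) (W : 'M[R]_m) (eta : R) (M : nat).

(* Before inner iteration t: (w^t, s^(t-1), v^(t-1)). *)
Record inner_state := InnerState {
  in_w : 'M[R]_(m, d);
  in_s : 'M[R]_(m, d);
  in_v : 'M[R]_(m, d) }.

Definition inner_step (mu w0 : 'M[R]_(m, d)) (batch : 'I_m -> 'I_b -> 'I_n)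
    (st : inner_state) : inner_state :=
  let w := in_w st in
  let v := \matrix_(i < m)
    (row i mu + b%:R^-1 *: \sum_(l < b)
       (grad (fc i (batch i l)) (row i w) - grad (fc i (batch i l)) (row i w0))) in
  let s := fastmix W M (in_s st + v - in_v st) in
  InnerState (fastmix W M (prox (m%:R * eta) (@Psi R m d psi) (w - eta *: s))) s v.

Fixpoint inner_iter (mu w0 : 'M[R]_(m, d)) (batch : nat -> 'I_m -> 'I_b -> 'I_n)
    (t : nat) : inner_state :=
  if t is t'.+1 then inner_step mu w0 (batch t') (inner_iter mu w0 batch t')
  else InnerState w0 mu mu.

(* At the start of epoch k: (y^(k-1), y^k, shat^k). *)
Record outer_state := OuterState {
  out_yprev : 'M[R]_(m, d);
  out_y : 'M[R]_(m, d);
  out_s : 'M[R]_(m, d) }.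

Definition epoch (T : nat) (batch : nat -> 'I_m -> 'I_b -> 'I_n)
    (st : outer_state) : outer_state :=
  let nu := out_s st + local_grads fc (out_y st) - local_grads fc (out_yprev st) in
  let s := fastmix W M nu in
  OuterState (out_y st) (in_w (inner_iter s (out_y st) batch T.+1)) s.

Definition outer_init : outer_state :=
  OuterState (\matrix_(i < m) x0) (\matrix_(i < m) x0)
             (\matrix_(i < m) grad (f_global fc) x0).

(* The run is a deterministic function of the drawn inner-loop lengths T k and
   batches B k t i (the l-th index drawn by agent i is B k t i l). *)
Fixpoint pmgt_svrg (T : nat -> nat) (B : nat -> nat -> 'I_m -> 'I_b -> 'I_n)
    (k : nat) : outer_state :=
  if k is k'.+1 then epoch (T k') (B k') (pmgt_svrg T B k') else outer_init.

Definition ybar (T : nat -> nat) (B : nat -> nat -> 'I_m -> 'I_b -> 'I_n)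
    (k : nat) : 'rV[R]_d :=
  row_mean (out_y (pmgt_svrg T B k)).

End Algorithm.

(* Cost of the first K epochs.  Per agent: n component gradients for
   shat^0; in each epoch n each for grad f_i(y^k) and grad f_i(y^(k-1)); and
   2b in each of the T + 1 inner iterations.  No reuse of previously computed
   gradients is assumed. *)
Definition sfo_calls (n b : nat) (T : nat -> nat) (K : nat) : nat :=
  (n + \sum_(k < K) (2 * n + (T k).+1 * (2 * b)))%N.

(* One FastMix per epoch and two per inner iteration, each of M rounds. *)
Definition comm_rounds (M : nat) (T : nat -> nat) (K : nat) : nat :=
  (\sum_(k < K) (M + (T k).+1 * (2 * M)))%N.

Section Sampling.
Variables (R : realType) (disp : measure_display) (Omega : measurableType disp).
Variable P : probability Omega R.

(* All subsets of nat are measurable, so the events quantified over are all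
   those of the sigma-algebras generated by the X i. *)
Definition mutually_independent (I : eqType) (X : I -> Omega -> nat) : Prop :=
  forall (J : seq I) (A : I -> set nat), uniq J ->
    P (\bigcap_(i in [set` J]) (X i @^-1` A i))
    = (\prod_(i <- J) P (X i @^-1` A i))%E.

Variables (m n b : nat).
Variables (T : nat -> Omega -> nat)
          (B : nat -> nat -> 'I_m -> 'I_b -> Omega -> 'I_n).

(* The joint family of all random draws, read in nat. *)
Definition draw (a : nat + nat * nat * 'I_m * 'I_b) (omega : Omega) : nat :=
  match a with
  | inl k => T k omega
  | inr (k, t, i, l) => B k t i l omega
  end.

(* ceil (n / b), for b > 0 *)
Definition t_zero : nat := ((n + b.-1) %/ b)%N.

Definition pmgt_sampling : Prop :=
  let p : R := t_zero%:R^-1 in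
  [/\ forall a, measurable_fun [set: Omega] (draw a),
      forall k t, P [set omega | T k omega = t] = ((1 - p) ^+ t * p)%:E,
      forall k t i l j, P [set omega | B k t i l omega = j] = (n%:R^-1)%:E &
      mutually_independent draw].

End Sampling.

(* log (Delta / eps) in the regime eps <= Delta / e; truncated below at 1
   because the output y^(k+1) always costs at least one epoch. *)
Definition log_acc (R : realType) (Delta eps : R) : R :=
  Num.max 1 (ln (Delta / eps)).

(* A fixed power of this factor is what the soft-O hides.  For m, n >= 1 and
   0 <= lam2 < 1 the argument of ln is at least 3, so the factor exceeds 1. *)
Definition log_params (R : realType) (m n : nat) (L l1 l2 sigma lam2 : R) : R :=
  ln (m%:R + n%:R + L / sigma + l1 / sigma + l2 / sigma + (1 - lam2)^-1).

(* Main.v *)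
(* Conditionally on the past, the average over the agents of the gradient estimates
   is the gradient at the average iterate, up to a bias controlled by the
   consensus errors; its variance is controlled by the distance to the reference
   point of the epoch through the co-coercivity of (l1, l2)-smooth functions,
   which is what produces sqrt (l1 * l2).  The proximal inequality then gives, in
   each inner step, the descent of plain proximal SVRG plus multiples of the
   consensus errors, and FastMix contracts the latter by a factor polynomially
   small in the problem parameters.  The geometric length of an epoch turns the
   sum over its steps into a telescoping one.  A Lyapunov function (gap plus
   weighted consensus error) does not increase over an epoch, and is halved by
   O(1 + p / (eta sigma)) = O(1 + kappa / sqrt n) epochs, where p is the parameter
   of the geometric law.  An epoch costs O(n) gradients and O(M sqrt n) rounds in
   expectation when b is about sqrt n. *)

Require Import Defs.
From mathcomp Require Import sesquilinear spectral complex.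
From mathcomp Require Import measurable_realfun ring lra zify.

Set Implicit Arguments.
Unset Strict Implicit.
Unset Printing Implicit Defensive.

Local Open Scope classical_set_scope.
Local Open Scope ring_scope.

(** * Spectrum of a gossip matrix *)

(** Bounding the variance by objective gaps rests on convex components, while here only the average
    is convex. The variance is bounded instead by [l1 * l2] times the squared distance to the
    reference point. Only the telescoping gain [p / (2 * eta)] can pay for that distance, so
    [eta ^+ 2 * (l1 * l2) / b] has to be at most of order [p]; a batch with [p * b >= 1] allows a
    step size that does not depend on [n].

    One epoch is too short to contract the gap when [kappa] exceeds [sqrt n]: the squared distance
    to the minimizer enters with weight [p / (2 * eta)], and the gap controls it only up to
    [2 / sigma]. This is why a potential containing that distance is summed over many epochs.

    No conditional expectation is formed. One inner step is an operator on functions of the state, a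
    finite average over batches; an epoch is a truncated geometric sum of its iterates. All
    estimates concern these operators, and [run_law] alone identifies them with integrals over the
    probability space. *)

Section Spectrum.
Variable R : realType.
Local Notation C := (complex R).
Local Notation toC := (real_complex R).
Local Open Scope sesquilinear_scope.

(** A real symmetric matrix is Hermitian over [C], hence unitarily diagonalizable with real
    eigenvalues. The eigenvectors may stay complex, since only norms in the new basis are compared
    later. *)
Lemma symmetric_real_spectral m (W : 'M[R]_m) : W^T = W ->
  exists (U : 'M[C]_m) (e : 'rV[R]_m),
    [/\ U *m U^t* = 1%:M, U^t* *m U = 1%:M &
        U *m map_mx toC W = diag_mx (map_mx toC e) *m U].
Proof.
move=> Wsym; pose A := map_mx toC W.
have Areal : A \is a realmx.
  by apply/mxOverP => i j; rewrite mxE; apply/complex_realP; exists (W i j).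
have Ah : A \is hermsymmx.
  rewrite is_hermitianmxE expr0 scale1r; apply/eqP.
  by rewrite /A map_trmx Wsym realmxC.
have dr := hermitian_spectral_diag_real Ah.
have /hermitian_normalmx /orthomx_spectralP AE := Ah.
have Uu := spectral_unitarymx A.
set U := spectralmx A in AE Uu; set D := spectral_diag A in AE dr.
exists U, (\row_j Re (D 0 j)); split.
- exact/unitarymxP.
- by rewrite -invmx_unitary // mulVmx // unitarymx_unit.
- have -> : map_mx toC (\row_j Re (D 0 j)) = D.
    apply/rowP => j; rewrite !mxE; apply: RRe_real.
    by move/mxOverP: dr; apply.
  by rewrite -/A {1}AE !mulmxA mulmxV ?unitarymx_unit // mul1mx.
Qed.

Section Gossip.
Variables (m : nat) (nbr : rel 'I_m) (W : 'M[R]_m).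
Hypothesis HW : gossip_matrix nbr W.

Let Wsym : W^T = W. Proof. by case: HW. Qed.

Lemma gossip_eigen_bounds (x : 'rV[R]_m) (a : R) :
  x != 0 -> x *m W = a *: x -> 0 <= a <= 1.
Proof.
case: HW => _ _ [p1 p2] _ _ x0 xW.
have nx : 0 < (x *m x^T) 0 0.
  rewrite mxE lt_def sumr_ge0 ?andbT; last first.
    by move=> i _; rewrite mxE -expr2 sqr_ge0.
  apply: contra x0; rewrite psumr_eq0 => [/allP h|i _]; last first.
    by rewrite mxE -expr2 sqr_ge0.
  apply/eqP/rowP => i; rewrite mxE; apply/eqP.
  by have := h i; rewrite mem_index_enum mxE -expr2 sqrf_eq0 => /(_ isT).
have := p1 x; rewrite xW -scalemxAl mxE pmulr_lge0 // => ->/=.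
have := p2 x; rewrite mulmxBr mulmx1 xW -[X in X - _]scale1r -scalerBl.
by rewrite -scalemxAl mxE pmulr_lge0 // subr_ge0.
Qed.

Lemma gossip_fixed_const (x : 'rV[R]_m) :
  x *m W = x -> exists c : R, x = const_mx c.
Proof.
case: HW => _ _ _ _ h xW.
have /h [c xc] : (1%:M - W) *m x^T = 0.
  by rewrite mulmxBl mul1mx -[in W *m _]Wsym -trmx_mul xW subrr.
by exists c; rewrite -[x]trmxK xc trmx_const.
Qed.

(** The real and imaginary parts of a row of [U] are real left eigenvectors of [W], not both zero;
    through them the real hypotheses on [W] reach [e]. The factorization of [char_poly W] links [e]
    to the sorted list [eigenvalues W]. *)
Lemma gossip_spectrum :
  exists (U : 'M[C]_m) (e : 'rV[R]_m),
    [/\ [/\ U *m U^t* = 1%:M, U^t* *m U = 1%:M &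
        U *m map_mx toC W = diag_mx (map_mx toC e) *m U],
        char_poly W = \prod_i ('X - (e 0 i)%:P),
        forall i, 0 <= e 0 i <= 1,
        forall i, e 0 i = 1 -> exists c : C, row i U = const_mx c &
        forall i j, e 0 i = 1 -> e 0 j = 1 -> i = j].
Proof.
have [U [e [U1 U2 UW]]] := symmetric_real_spectral Wsym.
have eig i : row i U *m map_mx toC W = toC (e 0 i) *: row i U.
  have := congr1 (row i) UW; rewrite row_mul => ->.
  by rewrite row_mul row_diag_mx mxE -scalemxAl -rowE.
pose re i : 'rV[R]_m := \row_j Re (U i j).
pose im i : 'rV[R]_m := \row_j Im (U i j).
have reE i : re i *m W = e 0 i *: re i.
  apply/rowP => k; have /rowP/(_ k) := eig i; rewrite !mxE => /(congr1 (@Re R)).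
  rewrite raddf_sum /= => h.
  transitivity (\sum_j Re (row i U 0 j * (map_mx toC W) j k)); last first.
    by rewrite h; case: (U i k) => a b /=; rewrite mul0r subr0.
  apply: eq_bigr => j _; rewrite !mxE; case: (U i j) => a b /=.
  by rewrite mulr0 subr0.
have imE i : im i *m W = e 0 i *: im i.
  apply/rowP => k; have /rowP/(_ k) := eig i; rewrite !mxE => /(congr1 (@Im R)).
  rewrite raddf_sum /= => h.
  transitivity (\sum_j Im (row i U 0 j * (map_mx toC W) j k)); last first.
    by rewrite h; case: (U i k) => a b /=; rewrite mul0r addr0.
  apply: eq_bigr => j _; rewrite !mxE; case: (U i j) => a b /=.
  by rewrite mulr0 add0r.
have Uri i : row i U = map_mx toC (re i) + Complex 0 1 *: map_mx toC (im i).
  apply/rowP => k; rewrite !mxE; case: (U i k) => a b /=; simpc.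
  by rewrite /= ?(mulr0, mul0r, mul1r, addr0, add0r, subr0).
have Uunit : U \in unitmx by case: (mulmx1_unit U1).
have nz i : (re i != 0) || (im i != 0).
  apply/negP => /negP; rewrite negb_or !negbK => /andP[/eqP r0 /eqP i0].
  have : row i U = 0 by rewrite Uri r0 i0 !map_mx0 scaler0 addr0.
  move=> ri0; have : (U *m U^t*) i i = 0.
    rewrite mxE big1 // => j _; have /rowP/(_ j) := ri0.
    by rewrite !mxE => ->; rewrite mul0r.
  by rewrite U1 mxE eqxx /= => /eqP; rewrite oner_eq0.
have fixc i : e 0 i = 1 -> exists c : C, row i U = const_mx c.
  move=> ei; have := reE i; have := imE i; rewrite ei !scale1r.
  move=> /gossip_fixed_const [c1 h1] /gossip_fixed_const [c2 h2].
  exists (toC c2 + Complex 0 1 * toC c1); rewrite Uri h1 h2.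
  by apply/rowP => k; rewrite !mxE.
exists U, e; split => //.
- apply: (@map_inj_poly _ _ toC (@complexI R) (rmorph0 _)).
  rewrite map_char_poly rmorph_prod /=.
  set D := diag_mx (map_mx toC e) in UW.
  have -> : \prod_i map_poly toC ('X - (e 0 i)%:P)
    = char_poly D :> {poly C}.
    rewrite char_poly_trig ?diag_mx_is_trig //.
    apply: eq_bigr => i _; rewrite rmorphB /= map_polyX map_polyC /=.
    by rewrite /D !mxE eqxx mulr1n.
  have UC : map_mx polyC U *m map_mx polyC (U^t*) = 1%:M :> 'M[{poly C}]_m.
    by rewrite -map_mxM U1 map_mx1.
  rewrite /char_poly /char_poly_mx.
  set Y := map_mx polyC (map_mx _ W).
  have e1 : map_mx polyC U *m ('X%:M - Y) = ('X%:M - map_mx polyC D) *m map_mx polyC U.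
    rewrite mulmxBr mulmxBl -!map_mxM UW.
    by rewrite scalar_mxC.
  have := congr1 (@determinant _ _) e1; rewrite !det_mulmx mulrC.
  apply: mulIf; apply: contraTneq Uunit.
  rewrite det_map_mx => /eqP; rewrite polyC_eq0 => d0.
  by rewrite unitmxE unitfE d0.
- move=> i; case/orP: (nz i) => h.
    exact: gossip_eigen_bounds h (reE i).
  exact: gossip_eigen_bounds h (imE i).
- move=> i j ei ej; apply/eqP/negP => /negP neq.
  have [ci hi] := fixc i ei; have [cj hj] := fixc j ej.
  have Uij k1 k2 : U k1 k2 = row k1 U 0 k2 by rewrite mxE.
  have h k1 k2 c1 c2 : row k1 U = const_mx c1 -> row k2 U = const_mx c2 ->
     (U *m U^t*) k1 k2 = (c1 * c2^*) *+ m.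
    move=> h1 h2; rewrite mxE (eq_bigr (fun=> c1 * c2^*)).
      by rewrite sumr_const card_ord.
    by move=> k _; rewrite !mxE (Uij k1) (Uij k2) h1 h2 !mxE.
  have := h i j _ _ hi hj; have := h i i _ _ hi hi; have := h j j _ _ hj hj.
  rewrite U1 !mxE !eqxx (negbTE neq) /= => /esym hjj /esym hii /esym hij.
  (* Constant rows are proportional, so Cauchy-Schwarz is an equality: the squared modulus of their
     Hermitian product is the product of their squared norms, 1, whereas orthogonality makes it
     0. *)
  have : ((ci * cj^*) *+ m) * ((cj * ci^*) *+ m) = 1.
    transitivity (((ci * ci^*) *+ m) * ((cj * cj^*) *+ m)).
      by rewrite !mulrnAl !mulrnAr mulrACA [cj^* * ci^*]mulrC -mulrACA.
    by rewrite hii hjj mulr1.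
  by rewrite hij mul0r => /eqP; rewrite eq_sym oner_eq0.
Qed.

(** The sorted list [eigenvalues W] is a permutation of the spectrum. Its head is 1, the largest
    eigenvalue, and as 1 is simple the next entry is smaller. *)
Lemma gossip_lambda2 : (0 < m)%N ->
  [/\ 0 <= lambda2 W, lambda2 W < 1 &
    exists (U : 'M[C]_m) (e : 'rV[R]_m),
    [/\ [/\ U *m U^t* = 1%:M, U^t* *m U = 1%:M &
        U *m map_mx toC W = diag_mx (map_mx toC e) *m U] &
      forall i, (exists c : C, row i U = const_mx c) \/ 0 <= e 0 i <= lambda2 W]].
Proof.
move=> m0; have [U [e [HU cp eb e1 euniq]]] := gossip_spectrum.
pose es := [seq e 0 i | i <- enum 'I_m].
have cpE : char_poly W = \prod_(a <- es) ('X - a%:P).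
  by rewrite cp /es big_map enumT.
pose ge : rel R := fun a b => b <= a.
have ge_tr : transitive ge by move=> y x z h1 h2; exact: le_trans h2 h1.
have ge_tot : total ge by move=> x y; exact: le_total.
have [srt] : sorted ge (eigenvalues W) /\
    char_poly W = \prod_(a <- eigenvalues W) ('X - a%:P).
  apply: (@xgetPex _ [::] [set s : seq R | sorted ge s /\
    char_poly W = \prod_(a <- s) ('X - a%:P)]).
  exists (sort ge es); split; first exact: sort_sorted.
  by rewrite cpE; apply: perm_big; rewrite perm_sym perm_sort.
rewrite cpE => /prod_XsubC_eq pe.
have [i0 ei0] : exists i, e 0 i = 1.
  have : eigenvalue W 1.
    apply/eigenvalueP; exists (const_mx 1); last first.
      apply/eqP => /rowP /(_ (Ordinal m0)); rewrite !mxE => /eqP.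
      by rewrite oner_eq0.
    rewrite scale1r -[LHS]trmxK trmx_mul Wsym trmx_const.
    by case: HW => _ _ _ -> _; rewrite trmx_const.
  rewrite eigenvalue_root_char cpE root_prod_XsubC => /mapP[i _ ->].
  by exists i.
have mem_es i : e 0 i \in eigenvalues W.
  by rewrite -(perm_mem pe) map_f // mem_enum.
have [l' lE] : exists l', eigenvalues W = 1 :: l'.
  have := mem_es i0; rewrite ei0.
  have : all (fun a => a <= 1) (eigenvalues W).
    rewrite -(perm_all _ pe); apply/allP => _ /mapP[i _ ->].
    by case/andP: (eb i).
  case: (eigenvalues W) srt => // a l' /= pa /andP[a1 _].
  rewrite inE => /orP[/eqP <-|h]; first by exists l'.
  have /allP/(_ _ h) := order_path_min ge_tr pa; rewrite /ge => ha.
  by exists l'; congr cons; apply/eqP; rewrite eq_le a1.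
have pe' : perm_eq [seq e 0 i | i <- rem i0 (enum 'I_m)] l'.
  rewrite -(perm_cons 1) -lE -{1}ei0 -map_cons.
  apply: perm_trans pe; apply: perm_map.
  by rewrite perm_sym; apply: perm_to_rem; rewrite mem_enum.
have n1 : 1 \notin l'.
  rewrite -(perm_mem pe'); apply/mapP => - [ i ].
  rewrite mem_rem_uniq ?enum_uniq // inE => /andP[/eqP ne _] /esym h.
  by apply: ne; apply: euniq.
have lam i : e 0 i = 1 \/ e 0 i <= lambda2 W.
  have := mem_es i; rewrite /lambda2 lE inE => /orP[/eqP ->|]; first by left.
  move: srt; rewrite lE /=; case: (l') => // b l2 /= /andP[_ pb].
  rewrite inE => /orP[/eqP -> |h]; right => //.
  by have /allP/(_ _ h) := order_path_min ge_tr pb.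
have [l0 l1] : 0 <= lambda2 W /\ lambda2 W < 1.
  (* For [m = 1] the tail is empty and [lambda2 W] is the default value 0. *)
  rewrite /lambda2 lE /=; case: (l') pe' n1 => [|b l2] pe' n1 /=; first by rewrite lexx ltr01.
  have : b \in b :: l2 by rewrite mem_head.
  rewrite -(perm_mem pe') => /mapP[j _ bE].
  have /andP[b0 b1] := eb j; rewrite -bE in b0 b1.
  split => //; rewrite lt_neqAle b1 andbT.
  by move: n1; rewrite inE negb_or eq_sym => /andP[].
split => //; exists U, e; split => // i.
case: (lam i) => [/e1|h]; first by left.
by right; rewrite h andbT; case/andP: (eb i).
Qed.

Let sqn n (x : 'M[C]_(m, n)) : C := \sum_i \sum_j `|x i j| ^+ 2.

Let sqnE n (x : 'M[C]_(m, n)) : sqn x = \tr (x^t* *m x).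
Proof.
rewrite /sqn exchange_big; apply: eq_bigr => j _; rewrite !mxE.
by apply: eq_bigr => i _; rewrite !mxE normCKC.
Qed.

(** In the eigenbasis a matrix of zero mean has no component along the constant eigenvectors, and
    every other component is multiplied by at most [lambda2 W]. *)
Lemma gossip_contract d (x : 'M[R]_(m, d)) : (0 < m)%N -> row_mean x = 0 ->
  normsq (W *m x) <= lambda2 W ^+ 2 * normsq x.
Proof.
move=> m0 x0.
have [l0 l1 [U [e [[U1 U2 UW] he]]]] := gossip_lambda2 m0.
have sqnU (y : 'M[C]_(m, d)) : sqn (U *m y) = sqn y.
  by rewrite !sqnE trmx_mul map_mxM mulmxA -[_ *m _ *m U]mulmxA U2 mulmx1.
have sqnC (y : 'M[R]_(m, d)) : sqn (map_mx toC y) = toC (normsq y).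
  rewrite /sqn rmorph_sum; apply: eq_bigr => i _.
  rewrite rmorph_sum; apply: eq_bigr => j _.
  by rewrite mxE -add_Re2_Im2 /= expr0n addr0 -expr2.
rewrite -lecR rmorphM /= -!sqnC map_mxM -[sqn (_ *m _)]sqnU -[sqn (map_mx _ x)]sqnU.
rewrite mulmxA UW -mulmxA; set y := U *m _.
have y0 i j c : row i U = const_mx c -> y i j = 0.
  move=> hc; rewrite /y mxE (eq_bigr (fun k => c * toC (x k j))).
    rewrite -mulr_sumr -rmorph_sum.
    have /rowP/(_ j) := x0; rewrite /row_mean !mxE => /eqP.
    rewrite mulf_eq0 invr_eq0 pnatr_eq0 (gtn_eqF m0) /=.
    under eq_bigr do rewrite mxE mul1r.
    by move=> /eqP ->; rewrite rmorph0 mulr0.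
  move=> k _; rewrite !mxE; congr (_ * _).
  by have /rowP/(_ k) := hc; rewrite !mxE.
move: y y0 => y y0.
rewrite /sqn mulr_sumr; apply: ler_sum => i _.
rewrite mulr_sumr; apply: ler_sum => j _.
rewrite mul_diag_mx !mxE normrM exprMn.
have [[c hc]|/andP[e0 e1]] := he i.
  by rewrite (y0 _ _ _ hc) normr0 expr0n !mulr0.
apply: ler_wpM2r; first by rewrite exprn_ge0.
rewrite -normrX -rmorphXn ger0_norm /= ?ler0c ?exprn_ge0 //.
rewrite lecR.
by rewrite ler_pXn2r // nnegrE.
Qed.

End Gossip.
End Spectrum.

(** * Averages, deviations and FastMix *)

Section InnerProduct.
Variable R : realType.

Section Bilinear.
Variables p d : nat.
Implicit Types x y z : 'M[R]_(p, d).

Lemma innerC x y : inner x y = inner y x.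
Proof. by apply: eq_bigr => i _; apply: eq_bigr => j _; rewrite mulrC. Qed.

Lemma innerDl x y z : inner (x + y) z = inner x z + inner y z.
Proof.
rewrite -big_split; apply: eq_bigr => i _; rewrite -big_split /=.
by apply: eq_bigr => j _; rewrite mxE mulrDl.
Qed.

Lemma innerZl a x y : inner (a *: x) y = a * inner x y.
Proof.
rewrite mulr_sumr; apply: eq_bigr => i _; rewrite mulr_sumr.
by apply: eq_bigr => j _; rewrite mxE mulrA.
Qed.

Lemma innerDr x y z : inner x (y + z) = inner x y + inner x z.
Proof. by rewrite innerC innerDl !(innerC _ x). Qed.

Lemma innerZr a x y : inner x (a *: y) = a * inner x y.
Proof. by rewrite innerC innerZl innerC. Qed.

Lemma innerNl x y : inner (- x) y = - inner x y.
Proof. by rewrite -scaleN1r innerZl mulN1r. Qed.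

Lemma innerNr x y : inner x (- y) = - inner x y.
Proof. by rewrite innerC innerNl innerC. Qed.

Lemma innerBl x y z : inner (x - y) z = inner x z - inner y z.
Proof. by rewrite innerDl innerNl. Qed.

Lemma innerBr x y z : inner x (y - z) = inner x y - inner x z.
Proof. by rewrite innerDr innerNr. Qed.

Lemma inner0l x : inner 0 x = 0.
Proof. by rewrite -(scale0r x) innerZl mul0r. Qed.

Lemma inner0r x : inner x 0 = 0.
Proof. by rewrite innerC inner0l. Qed.

Lemma inner_suml (I : Type) (r : seq I) (P : pred I) (F : I -> 'M[R]_(p, d)) y :
  inner (\sum_(i <- r | P i) F i) y = \sum_(i <- r | P i) inner (F i) y.
Proof.
apply: (big_ind2 (fun u v => inner u y = v)) => //; first exact: inner0l.
by move=> u1 v1 u2 v2 <- <-; rewrite innerDl.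
Qed.

Lemma inner_sumr (I : Type) (r : seq I) (P : pred I) (F : I -> 'M[R]_(p, d)) y :
  inner y (\sum_(i <- r | P i) F i) = \sum_(i <- r | P i) inner y (F i).
Proof. by rewrite innerC inner_suml; apply: eq_bigr => i _; rewrite innerC. Qed.

Lemma normsq_ge0 x : 0 <= normsq x.
Proof.
by apply: sumr_ge0 => i _; apply: sumr_ge0 => j _; rewrite -expr2 sqr_ge0.
Qed.

Lemma normsq0 : normsq (0 : 'M[R]_(p, d)) = 0.
Proof. exact: inner0l. Qed.

Lemma normsqN x : normsq (- x) = normsq x.
Proof. by rewrite /normsq innerNl innerNr opprK. Qed.

Lemma normsqZ a x : normsq (a *: x) = a ^+ 2 * normsq x.
Proof. by rewrite /normsq innerZl innerZr mulrA expr2. Qed.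

Lemma normsqD x y : normsq (x + y) = normsq x + 2 * inner x y + normsq y.
Proof. rewrite /normsq innerDl !innerDr (innerC y x); ring. Qed.

Lemma normsqB x y : normsq (x - y) = normsq x - 2 * inner x y + normsq y.
Proof. rewrite normsqD normsqN innerNr; ring. Qed.

Lemma normsq_sym x y : normsq (x - y) = normsq (y - x).
Proof. by rewrite -normsqN opprB. Qed.

Lemma young (a : R) x y : 0 < a ->
  inner x y <= a / 2 * normsq x + (2 * a)^-1 * normsq y.
Proof.
move=> a0; have := normsq_ge0 (a *: x - y).
rewrite normsqB innerZl normsqZ => h.
rewrite -subr_ge0.
have -> : a / 2 * normsq x + (2 * a)^-1 * normsq y - inner x y =
   (2 * a)^-1 * (a ^+ 2 * normsq x - 2 * (a * inner x y) + normsq y).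
  by field; lra.
by rewrite mulr_ge0 // invr_ge0; lra.
Qed.

Lemma normsqD_le2 x y : normsq (x + y) <= 2 * (normsq x + normsq y).
Proof.
have := normsq_ge0 (x - y); rewrite normsqB (normsqD x y); lra.
Qed.

Lemma normsqB_le2 x y : normsq (x - y) <= 2 * (normsq x + normsq y).
Proof. by have := normsqD_le2 x (- y); rewrite normsqN. Qed.

Lemma normsqD_le3 x y z :
  normsq (x + y + z) <= 3 * (normsq x + normsq y + normsq z).
Proof.
have := normsq_ge0 (x - y); have := normsq_ge0 (x - z).
have := normsq_ge0 (y - z).
rewrite (normsqD (x + y)) (normsqD x y) innerDl !normsqB; lra.
Qed.

Lemma normsq_eq0 x : normsq x = 0 -> x = 0.
Proof.
move=> /eqP; rewrite psumr_eq0 => [/allP h|i _]; last first.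
  by apply: sumr_ge0 => j _; rewrite -expr2 sqr_ge0.
apply/matrixP => i j; rewrite mxE.
have := h i; rewrite mem_index_enum => /(_ isT).
rewrite psumr_eq0 => [/allP /(_ j)|k _]; last by rewrite -expr2 sqr_ge0.
by rewrite mem_index_enum -expr2 sqrf_eq0 => /(_ isT)/eqP.
Qed.

Lemma normsq_sum_le (I : finType) (P : pred I) (F : I -> 'M[R]_(p, d)) :
  normsq (\sum_(i | P i) F i) <= #|P|%:R * \sum_(i | P i) normsq (F i).
Proof.
rewrite /normsq inner_suml.
have h (i k : I) : inner (F i) (F k) <= (normsq (F i) + normsq (F k)) / 2.
  have := normsq_ge0 (F i - F k); rewrite normsqB; lra.
apply: (@le_trans _ _ (\sum_(i | P i) \sum_(k | P k) (normsq (F i) + normsq (F k)) / 2)).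
  by apply: ler_sum => i _; rewrite inner_sumr; apply: ler_sum => k _.
under eq_bigr => i _ do rewrite -mulr_suml big_split /= sumr_const.
rewrite -mulr_suml big_split /= sumr_const -sumrMnl -[_ *+ #|P|]mulr_natl.
have -> : \sum_(i | P i) normsq (F i) *+ #|[pred i | P i]| = #|P|%:R * \sum_(i | P i) normsq (F i).
  by rewrite mulr_sumr; apply: eq_bigr => i _; rewrite mulr_natl.
rewrite /normsq; lra.
Qed.

End Bilinear.

Lemma inner_trace p d (x y : 'M[R]_(p, d)) : inner x y = \tr (x^T *m y).
Proof.
rewrite /inner exchange_big; apply: eq_bigr => j _; rewrite !mxE.
by apply: eq_bigr => i _; rewrite !mxE.
Qed.

Lemma inner_mulmx p d (A : 'M[R]_p) (x y : 'M[R]_(p, d)) :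
  inner (A *m x) y = inner x (A^T *m y).
Proof. by rewrite !inner_trace trmx_mul mulmxA. Qed.

Lemma inner_rows p d (x y : 'M[R]_(p, d)) :
  inner x y = \sum_i inner (row i x) (row i y).
Proof.
apply: eq_bigr => i _; rewrite /inner big_ord1.
by apply: eq_bigr => j _; rewrite !mxE.
Qed.

Lemma normsq_rows p d (x : 'M[R]_(p, d)) :
  normsq x = \sum_i normsq (row i x).
Proof. exact: inner_rows. Qed.

End InnerProduct.

Section Deviation.
Variables (R : realType) (m d : nat).
Hypothesis m_gt0 : (0 < m)%N.
Implicit Types x y : 'M[R]_(m, d).

Let m_neq0 : m%:R != 0 :> R. Proof. by rewrite pnatr_eq0 -lt0n. Qed.

Definition consensus (v : 'rV[R]_d) : 'M[R]_(m, d) := \matrix_(i < m) v.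

Definition dev x : R := \sum_i normsq (row i x - row_mean x).

Lemma row_meanE x : row_mean x = m%:R^-1 *: \sum_i row i x.
Proof.
rewrite /row_mean; congr (_ *: _); apply/rowP => j; rewrite mxE summxE.
by apply: eq_bigr => i _; rewrite !mxE mul1r.
Qed.

Lemma row_meanD x y : row_mean (x + y) = row_mean x + row_mean y.
Proof. by rewrite /row_mean mulmxDr scalerDr. Qed.

Lemma row_meanZ a x : row_mean (a *: x) = a *: row_mean x.
Proof. by rewrite /row_mean -scalemxAr !scalerA mulrC. Qed.

Lemma row_meanN x : row_mean (- x) = - row_mean x.
Proof. by rewrite -scaleN1r row_meanZ scaleN1r. Qed.

Lemma row_meanB x y : row_mean (x - y) = row_mean x - row_mean y.
Proof. by rewrite row_meanD row_meanN. Qed.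

Lemma sum_rows x : \sum_i row i x = m%:R *: row_mean x.
Proof. by rewrite row_meanE scalerA mulfV // scale1r. Qed.

Lemma row_consensus v i : row i (consensus v) = v.
Proof. exact: rowK. Qed.

Lemma row_mean_consensus v : row_mean (consensus v) = v.
Proof.
rewrite row_meanE (eq_bigr (fun=> v)) => [|i _]; last by rewrite row_consensus.
by rewrite sumr_const card_ord -[v *+ m]scaler_nat scalerA mulVf // scale1r.
Qed.

Lemma dev_ge0 x : 0 <= dev x.
Proof. by apply: sumr_ge0 => i _; exact: normsq_ge0. Qed.

Lemma devE x : dev x = normsq (x - consensus (row_mean x)).
Proof.
rewrite normsq_rows; apply: eq_bigr => i _.
by rewrite raddfB /= row_consensus.
Qed.

Lemma dev_consensus v : dev (consensus v) = 0.
Proof. by rewrite devE row_mean_consensus subrr normsq0. Qed.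

(** Bias-variance decomposition: the cross terms sum to zero because the deviations from the mean
    do. *)
Lemma sum_normsq_sub x (u : 'rV[R]_d) :
  \sum_i normsq (row i x - u) = dev x + m%:R * normsq (row_mean x - u).
Proof.
have E i : normsq (row i x - u) = normsq (row i x - row_mean x)
   + (2 * (inner (row i x) (row_mean x - u) - inner (row_mean x) (row_mean x - u))
     + normsq (row_mean x - u)).
  have -> : row i x - u = (row i x - row_mean x) + (row_mean x - u).
    by rewrite addrA subrK.
  by rewrite normsqD innerBl addrA.
rewrite (eq_bigr _ (fun i _ => E i)) big_split /=; congr (_ + _).
rewrite big_split /= -mulr_sumr big_split /= -inner_suml sum_rows innerZl.
rewrite !sumr_const !card_ord.
set a := inner _ _; set b := normsq _.
by rewrite -(mulr_natl (- a)) -(mulr_natl b) mulrN addrN mulr0 add0r.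
Qed.

Lemma sum_normsq_mean x : normsq x = dev x + m%:R * normsq (row_mean x).
Proof.
rewrite normsq_rows -[row_mean x]subr0 -sum_normsq_sub.
by apply: eq_bigr => i _; rewrite subr0.
Qed.

Lemma dev_le_normsq x : dev x <= normsq x.
Proof. by rewrite sum_normsq_mean lerDl mulr_ge0 ?normsq_ge0. Qed.

Lemma devD_le3 x y z : dev (x + y + z) <= 3 * (dev x + dev y + dev z).
Proof.
rewrite !devE !row_meanD; apply: le_trans (normsqD_le3 _ _ _).
rewrite le_eqVlt; apply/orP; left; apply/eqP; congr normsq.
by apply/matrixP => i j; rewrite !mxE; ring.
Qed.

End Deviation.

Section FastMix.
Variables (R : realType) (m : nat) (nbr : rel 'I_m) (W : 'M[R]_m).
Hypotheses (HW : gossip_matrix nbr W) (m_gt0 : (0 < m)%N).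
Let h := eta_w W.
Let lam := lambda2 W.

Let lam01 : 0 <= lam /\ lam < 1.
Proof. by have [? ? _] := gossip_lambda2 HW m_gt0. Qed.

Let r := Num.sqrt (1 - lam ^+ 2).

Let r01 : 0 <= r <= 1.
Proof.
rewrite sqrtr_ge0 /= -sqrtr1 ler_sqrt // lerBlDr lerDl sqr_ge0 //.
Qed.

Lemma eta_w_bounds : 0 <= eta_w W <= 1.
Proof.
move: r01 => /andP[r0 r1]; rewrite /eta_w -/lam -/r.
by rewrite divr_ge0 ?ler_pdivrMr; lra.
Qed.

(* [eta_w] makes the discriminant of [z^2 - (1 + eta_w) lambda2 z + eta_w] vanish. *)
Lemma eta_w_discriminant : (1 + h) ^+ 2 * lam ^+ 2 = 4 * h.
Proof.
move: r01 => /andP[r0 r1]; have [l0 l1] := lam01.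
have r2 : r ^+ 2 = 1 - lam ^+ 2.
  by rewrite sqr_sqrtr // subr_ge0 expr_le1 // ltW.
have l2 : lam ^+ 2 = 1 - r ^+ 2 by rewrite r2; ring.
by rewrite /h /eta_w -/lam -/r l2; field; lra.
Qed.

(** [eta_w <= 1 - r], and [lam ^+ 2 <= lam] gives [r >= sqrt (1 - lam)]. This is the accelerated
    rate behind the square root of the spectral gap in the round count. *)
Lemma eta_w_le_exp : eta_w W <= expR (- Num.sqrt (1 - lam)).
Proof.
move: r01 => /andP[r0 r1]; have [l0 l1] := lam01.
apply: (@le_trans _ _ (1 - r)).
  rewrite /eta_w -/lam -/r ler_pdivrMr; last lra.
  by rewrite ler_peMr; lra.
apply: (@le_trans _ _ (1 - Num.sqrt (1 - lam))).
  rewrite lerB // ler_sqrt ?lerB //.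
    by rewrite expr2 ler_piMl // ltW.
  by rewrite subr_ge0 expr_le1 // ltW.
exact: expR_ge1Dx.
Qed.

Section Dimension.
Variable d : nat.
Implicit Types x xp : 'M[R]_(m, d).

Lemma row_mean_mulmx x : row_mean (W *m x) = row_mean x.
Proof.
have [_ Wsym _ W1 _] := HW.
have h1 : const_mx 1 *m W = const_mx 1 :> 'rV[R]_m.
  by rewrite -[LHS]trmxK trmx_mul Wsym trmx_const W1 trmx_const.
by rewrite /row_mean mulmxA h1.
Qed.

Lemma mulmx_consensus v : W *m consensus m v = consensus m v :> 'M[R]_(m, d).
Proof.
have [_ Wsym _ W1 _] := HW.
have -> : consensus m v = const_mx 1 *m v :> 'M[R]_(m, d).
  by apply/matrixP => i j; rewrite !mxE big_ord1 mxE mul1r.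
by rewrite mulmxA W1.
Qed.

(* The quadratic form in the third hypothesis is multiplied by [eta_w] at each
   step.  With [u = ((1 + eta_w) / 2) W x], the choice of [eta_w] makes it
   dominate [normsq (x' - u)], and Young's inequality bounds [x' = u + (x' - u)]. *)
Lemma fastmix_rec_decay M : forall k (N : R) xp x,
  row_mean xp = 0 -> row_mean x = 0 ->
  normsq x - (1 + h) * inner x (W *m xp) + h * normsq xp <= 4 * (h ^+ k * N) ->
  normsq x <= 8 * k.+1%:R ^+ 2 * (h ^+ k * N) ->
  normsq (fastmix_rec W M xp x) <= 8 * (k + M).+1%:R ^+ 2 * (h ^+ (k + M) * N).
Proof.
have /andP[h0 h1] := eta_w_bounds; rewrite -/h in h0 h1.
have [_ Wsym _ _ _] := HW.
elim: M => [|M IH] k N xp x mp mx E nx; first by rewrite addn0.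
rewrite /= addnS -addSn -/h; apply: IH => //.
- by rewrite row_meanB !row_meanZ row_mean_mulmx mp mx !scaler0 subrr.
- rewrite exprS normsqB !normsqZ innerBl !innerZl !innerZr.
  rewrite (innerC _ xp).
  rewrite -[inner (W *m x) (W *m x)]/(normsq (W *m x)).
  have -> : inner xp (W *m x) = inner x (W *m xp).
    by rewrite innerC inner_mulmx Wsym.
  have -> : 4 * (h * h ^+ k * N) = h * (4 * (h ^+ k * N)) by ring.
  apply: le_trans (ler_wpM2l h0 E).
  rewrite le_eqVlt; apply/orP; left; apply/eqP; ring.
- set x' := _ - _.
  pose u := ((1 + h) / 2) *: (W *m x).
  have nu : normsq u <= h * normsq x.
    rewrite normsqZ; apply: (@le_trans _ _ (((1 + h) / 2) ^+ 2 * (lam ^+ 2 * normsq x))).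
      by rewrite ler_wpM2l ?sqr_ge0 ?(gossip_contract HW).
    rewrite mulrA exprMn [X in X * normsq x]mulrAC eta_w_discriminant.
    by rewrite le_eqVlt; apply/orP; left; apply/eqP; field.
  have E' : normsq x' - (1 + h) * inner x' (W *m x) + h * normsq x
      <= h * (4 * (h ^+ k * N)).
    apply: le_trans (ler_wpM2l h0 E); rewrite /x'.
    rewrite normsqB !normsqZ innerBl !innerZl !innerZr.
    have -> : inner (W *m x) xp = inner x (W *m xp) by rewrite inner_mulmx Wsym.
    have -> : inner xp (W *m x) = inner x (W *m xp).
      by rewrite innerC inner_mulmx Wsym.
    rewrite -[inner (W *m x) (W *m x)]/(normsq (W *m x)).
    rewrite le_eqVlt; apply/orP; left; apply/eqP; ring.
  have nxu : normsq (x' - u) <= h * (4 * (h ^+ k * N)).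
    apply: le_trans E'; rewrite normsqB [inner x' u]innerZr; lra.
  have k0 : 0 < k.+1%:R :> R by rewrite ltr0n.
  have -> : normsq x' = normsq (u + (x' - u)) by rewrite addrC subrK.
  rewrite normsqD.
  (* With weight [1 / K] the polynomial factor survives one step: [(1 + 1/K) * 8 K^2 + 4 (1 + K) <=
     8 (K + 1)^2]. *)
  have := @young _ _ _ (k.+1%:R^-1) u (x' - u); rewrite invr_gt0 => /(_ k0).
  have -> : (2 * k.+1%:R^-1)^-1 = k.+1%:R / 2 :> R by field; lra.
  rewrite -[k.+2]addn1 natrD; set K : R := k.+1%:R in k0 nx *.
  set X := h ^+ k * N in nx E' nxu *.
  have K1 : 1 <= K by rewrite ler1n.
  move=> y.
  have nu' : normsq u <= h * (8 * K ^+ 2 * X).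
    by apply: le_trans nu _; rewrite ler_wpM2l.
  have X0 : 0 <= h * X.
    have := le_trans (normsq_ge0 _) nxu; lra.
  have e1 : (1 + K^-1) * normsq u <= (1 + K^-1) * (h * (8 * K ^+ 2 * X)).
    by rewrite ler_wpM2l // addr_ge0 ?invr_ge0 // ltW.
  have e2 : (1 + K) * normsq (x' - u) <= (1 + K) * (4 * (h * X)).
    by rewrite ler_wpM2l //; lra.
  have e3 : (1 + K^-1) * (h * (8 * K ^+ 2 * X)) = (8 * K ^+ 2 + 8 * K) * (h * X).
    by field; lra.
  have -> : h ^+ k.+1 * N = h * X by rewrite exprS /X mulrA.
  rewrite e3 in e1.
  have : 0 <= (4 * K + 4) * (h * X) by rewrite mulr_ge0 //; lra.
  move: y e1 e2; clearbody K X.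
  move: (normsq u) (inner u _) (normsq (_ - u)) (h * X) => A I B Y.
  lra.
Qed.

Lemma fastmix_recD_consensus M v xp x :
  fastmix_rec W M (consensus m v + xp) (consensus m v + x) =
  consensus m v + fastmix_rec W M xp x.
Proof.
elim: M xp x => // M IH xp x /=; rewrite -IH; congr fastmix_rec.
rewrite mulmxDr mulmx_consensus; apply/matrixP => i j; rewrite !mxE; ring.
Qed.

Lemma row_mean_fastmix_rec M xp x : row_mean xp = row_mean x ->
  row_mean (fastmix_rec W M xp x) = row_mean x.
Proof.
elim: M xp x => // M IH xp x /= e.
have e2 : row_mean ((1 + eta_w W) *: (W *m x) - eta_w W *: xp) = row_mean x.
  by rewrite row_meanB !row_meanZ row_mean_mulmx e scalerDl scale1r addrK.
by rewrite IH.
Qed.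

Lemma row_mean_fastmix M x : row_mean (fastmix W M x) = row_mean x.
Proof. exact: row_mean_fastmix_rec. Qed.

Lemma dev_fastmix M x :
  dev (fastmix W M x) <= 8 * M.+1%:R ^+ 2 * h ^+ M * dev x.
Proof.
have /andP[h0 h1] := eta_w_bounds; rewrite -/h in h0 h1.
rewrite devE row_mean_fastmix [dev x]devE /fastmix.
set c := row_mean x; set z := x - consensus m c.
have -> : x = consensus m c + z by rewrite addrC subrK.
have z0 : row_mean z = 0 by rewrite row_meanB row_mean_consensus // subrr.
rewrite fastmix_recD_consensus addrC addKr -mulrA.
rewrite -[M.+1]/((0 + M).+1) -{2}[M]add0n.
apply: fastmix_rec_decay => //; rewrite expr0 mul1r.
  (* Both initial iterates equal [z], so the quadratic form is [(1 + h) (|z|^2 - <z, W z>)], at most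
     [4 |z|^2]. *)
  have : - inner z (W *m z) <= normsq z.
    have := @young _ _ _ 1 (- z) (W *m z) ltr01; rewrite innerNl normsqN.
    have := gossip_contract HW m_gt0 z0; have [l0 l1] := lam01.
    have : lam ^+ 2 * normsq z <= normsq z.
      by rewrite ler_piMl ?normsq_ge0 // expr_le1 // ltW.
    rewrite -/lam; lra.
  have := normsq_ge0 z; nra.
by rewrite expr1n mulr1 ler_peMl ?normsq_ge0 // ler1n.
Qed.

End Dimension.
End FastMix.

(** * Smoothness and convexity *)

Section Limits.
Variable R : realType.

(** Replaces the passage to the limit in inequalities along a segment, once they have been divided
    by the segment parameter [t]. *)
Lemma le0_of_small (A B : R) :
  (forall t, 0 < t <= 1 -> A <= t * B) -> A <= 0.
Proof.
move=> h; rewrite leNgt; apply/negP => A0.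
have B0 : 0 < B by have := h 1; rewrite mul1r ltr01 lexx => /(_ isT); lra.
have t0 : 0 < A / (A + 2 * B) by rewrite divr_gt0; lra.
have t1 : A / (A + 2 * B) <= 1 by rewrite ler_pdivrMr; lra.
have := h (A / (A + 2 * B)); rewrite t0 t1 => /(_ isT).
rewrite mulrAC ler_pdivlMr; last lra.
nra.
Qed.

End Limits.

Section TwoSided.
Variables (R : realType) (d : nat) (l1 l2 : R).
Hypotheses (l1_gt0 : 0 < l1) (l1_le_l2 : l1 <= l2).
Implicit Types (g : 'rV[R]_d -> R) (x y : 'rV[R]_d).

(* Compares the two bounds of the smoothness condition at [x - (l1 + l2)^-1 t]. *)
Let two_sided_half g x y (t := grad g x - grad g y + l2 *: (x - y)) :
  two_sided_smooth l1 l2 g ->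
  g y - g x + inner (grad g y) (x - y) - l2 / 2 * normsq (x - y)
    + (2 * (l1 + l2))^-1 * normsq t <= 0.
Proof.
have p1 := l1_gt0; have p2 := l1_le_l2.
move=> tg; have [a aE] : exists a, a = (l1 + l2)^-1 by exists (l1 + l2)^-1.
have a0 : 0 < a by rewrite aE invr_gt0; lra.
have /andP[_ up] := tg (x - a *: t) x.
have /andP[lo _] := tg (x - a *: t) y.
have e1 : x - a *: t - x = - (a *: t) by rewrite addrAC subrr add0r.
have e2 : x - a *: t - y = (x - y) - a *: t by rewrite addrAC.
have tt : normsq t = inner (grad g x) t - inner (grad g y) t + l2 * inner (x - y) t.
  by rewrite {1}/normsq {1}/t innerDl innerZl innerBl.
rewrite e1 normsqN normsqZ innerNr innerZr in up.
rewrite e2 normsqB normsqZ innerBr !innerZr in lo.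
have a2 : (2 * (l1 + l2))^-1 = a / 2 by rewrite aE invfM mulrC.
have al : a * (l1 + l2) = 1 by rewrite aE mulVf //; lra.
have al2 T : a ^+ 2 * T * (l1 + l2) = a * T.
  by rewrite -[RHS]mulr1 -al; ring.
have := al2 (normsq t); rewrite a2 => al3.
have al4 : a * normsq t = a * inner (grad g x) t - a * inner (grad g y) t + l2 * (a * inner (x - y) t).
  by rewrite [in LHS]tt; ring.
nra.
Qed.

(** Adding [two_sided_half] for both orders of the points cancels the function values. The inner
    product is kept rather than estimated, because its sum over all components has a sign (see
    [sum_grad_diff]). *)
Lemma two_sided_cocoercive g x y : two_sided_smooth l1 l2 g ->
  normsq (grad g x - grad g y) <=
    l1 * l2 * normsq (x - y) - (l2 - l1) * inner (grad g x - grad g y) (x - y).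
Proof.
have p1 := l1_gt0; have p2 := l1_le_l2.
move=> tg; have := two_sided_half y x tg; have := two_sided_half x y tg.
set e := grad g x - grad g y; set t := e + _.
have -> : grad g y - grad g x + l2 *: (y - x) = - t.
  by rewrite opprD -scalerN !opprB.
rewrite normsqN (normsq_sym y x).
have -> : inner (grad g x) (y - x) = - inner (grad g x) (x - y).
  by rewrite -opprB innerNr.
have tE : normsq t = normsq e + 2 * (l2 * inner e (x - y)) + l2 ^+ 2 * normsq (x - y).
  by rewrite /t normsqD innerZr normsqZ; ring.
have eE : inner e (x - y) = inner (grad g x) (x - y) - inner (grad g y) (x - y).
  by rewrite innerBl.
move=> h1 h2.
have : (l1 + l2)^-1 * normsq t <= inner e (x - y) + l2 * normsq (x - y).
  have -> : (l1 + l2)^-1 = 2 * (2 * (l1 + l2))^-1 by field; lra.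
  rewrite eE; lra.
rewrite ler_pdivrMl; last lra.
rewrite tE; lra.
Qed.

(** Young's inequality absorbs the inner product of the cocoercivity bound and leaves
    [l1 ^+ 2 + l2 ^+ 2]. The constant is crude, but it enters only consensus errors and terms with a
    small factor [rho]. *)
Lemma two_sided_lipschitz g x y : two_sided_smooth l1 l2 g ->
  normsq (grad g x - grad g y) <= 2 * l2 ^+ 2 * normsq (x - y).
Proof.
have p1 := l1_gt0; have p2 := l1_le_l2.
move=> tg; have := two_sided_cocoercive x y tg.
set e := grad g x - grad g y => h.
have := @young _ _ _ 1 (- e) ((l2 - l1) *: (x - y)) ltr01.
rewrite innerNl innerZr normsqN normsqZ => h1.
have n0 := normsq_ge0 (x - y).
have : l1 ^+ 2 * normsq (x - y) <= l2 ^+ 2 * normsq (x - y).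
  by rewrite ler_wpM2r // ler_pXn2r // nnegrE; lra.
move: h h1; set E := normsq e; set N := normsq _; set I := inner _ _ => h h1 h2.
have -> : 2 * l2 ^+ 2 * N = l2 ^+ 2 * N + l2 ^+ 2 * N by ring.
have h3 : (2 * 1)^-1 * ((l2 - l1) ^+ 2 * N) = 2^-1 * (l2 ^+ 2 * N + l1 ^+ 2 * N) - l1 * l2 * N.
  by rewrite mulr1; field.
rewrite h3 in h1; lra.
Qed.

(** Convexity along the segment is combined with the lower smoothness bound at [x], whose error is
    quadratic in [t] and disappears after division by [t]. *)
Lemma convex_gradient_le g x y : two_sided_smooth l1 l2 g ->
  strongly_convex 0 (EFin \o g) -> g x + inner (grad g x) (y - x) <= g y.
Proof.
move=> tg cg; rewrite -subr_le0.
apply: (@le0_of_small _ _ (l2 / 2 * normsq (y - x))) => t /andP[t0 t1].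
have := cg y x t; rewrite (ltW t0) t1 => /(_ isT) /=.
rewrite !mul0r sube0 -!EFinM -EFinD lee_fin => c.
have /andP[lo _] := tg (t *: y + (1 - t) *: x) x.
have e : t *: y + (1 - t) *: x - x = t *: (y - x).
  by apply/rowP => j; rewrite !mxE; ring.
rewrite e innerZr normsqZ in lo.
rewrite -(ler_pM2l t0); nra.
Qed.

(* The constant [L] instead of [L / 2] avoids an integral along the segment. *)
Lemma convex_smooth_descent L g x y : two_sided_smooth l1 l2 g ->
  strongly_convex 0 (EFin \o g) -> 0 <= L -> lipschitz_smooth L g ->
  g y <= g x + inner (grad g x) (y - x) + L * normsq (y - x).
Proof.
move=> tg cg L0 sg; have := convex_gradient_le y x tg cg.
have -> : x - y = - (y - x) by rewrite opprB.
rewrite innerNr => h.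
suff : inner (grad g y - grad g x) (y - x) <= L * normsq (y - x).
  rewrite innerBl; lra.
have hs : normsq (grad g y - grad g x) <= L ^+ 2 * normsq (y - x).
  have := sg y x; rewrite /enorm => hs.
  rewrite -(sqr_sqrtr (normsq_ge0 (grad g y - grad g x))).
  rewrite -(sqr_sqrtr (normsq_ge0 (y - x))) -exprMn.
  by rewrite ler_pXn2r // nnegrE ?mulr_ge0 ?sqrtr_ge0.
have [L00|Lp] := eqVneq L 0.
  have : normsq (grad g y - grad g x) = 0.
    apply/eqP; rewrite eq_le normsq_ge0 andbT.
    by move: hs; rewrite L00 expr0n mul0r.
  by move=> /normsq_eq0 ->; rewrite inner0l L00 mul0r.
have {}Lp : 0 < L by rewrite lt_def Lp.
rewrite innerC.
apply: le_trans (young _ _ Lp) _.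
have : (2 * L)^-1 * normsq (grad g y - grad g x) <= (2 * L)^-1 * (L ^+ 2 * normsq (y - x)).
  by rewrite ler_wpM2l // invr_ge0; lra.
have -> : (2 * L)^-1 * (L ^+ 2 * normsq (y - x)) = L / 2 * normsq (y - x).
  by field; lra.
lra.
Qed.

End TwoSided.

Section GradientMean.
Variables (R : realType) (m n d : nat) (fc : 'I_m -> 'I_n -> 'rV[R]_d -> R).
Hypothesis fc_diff : forall i j x, differentiable (fc i j) x.

Let der_fc i j x v : derivable (fc i j) x v.
Proof. exact/diff_derivable/fc_diff. Qed.

Let f_localE i : f_local fc i = n%:R^-1 \*: \sum_(j < n) fc i j.
Proof. by apply/funext => x; rewrite /f_local /= fct_sumE. Qed.

Let f_globalE : f_global fc = m%:R^-1 \*: \sum_(i < m) f_local fc i.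
Proof. by apply/funext => x; rewrite /f_global /= fct_sumE. Qed.

Let der_local i x v : derivable (f_local fc i) x v.
Proof. by rewrite f_localE; apply: derivableZ; apply: derivable_sum. Qed.

Lemma grad_f_local i x :
  grad (f_local fc i) x = n%:R^-1 *: \sum_(j < n) grad (fc i j) x.
Proof.
apply/rowP => k; rewrite !mxE summxE f_localE.
rewrite deriveZ; last exact: derivable_sum.
rewrite derive_sum //; congr (_ * _).
by apply: eq_bigr => j _; rewrite mxE.
Qed.

Lemma grad_f_global x :
  grad (f_global fc) x = m%:R^-1 *: \sum_(i < m) grad (f_local fc i) x.
Proof.
apply/rowP => k; rewrite !mxE summxE f_globalE.
rewrite deriveZ; last exact: derivable_sum.
rewrite derive_sum //; congr (_ * _).
by apply: eq_bigr => j _; rewrite mxE.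
Qed.

Lemma two_sided_f_local l1 l2 i : (0 < n)%N ->
  (forall j, two_sided_smooth l1 l2 (fc i j)) ->
  two_sided_smooth l1 l2 (f_local fc i).
Proof.
move=> n0 tg x y.
have nn : n%:R != 0 :> R by rewrite pnatr_eq0 -lt0n.
have E : f_local fc i x - f_local fc i y - inner (grad (f_local fc i) y) (x - y)
  = n%:R^-1 * \sum_(j < n) (fc i j x - fc i j y - inner (grad (fc i j) y) (x - y)).
  rewrite grad_f_local innerZl inner_suml !sumrB /f_local; ring.
have K (c : R) : c = n%:R^-1 * \sum_(j < n) c.
  by rewrite sumr_const card_ord -[c *+ n]mulr_natl mulKf.
apply/andP; split; [rewrite E [leLHS]K|rewrite E [leRHS]K];
  rewrite ler_pM2l ?invr_gt0 ?ltr0n //; apply: ler_sum => j _;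
  by case/andP: (tg j x y).
Qed.

Lemma two_sided_f_global l1 l2 : (0 < m)%N -> (0 < n)%N ->
  (forall i j, two_sided_smooth l1 l2 (fc i j)) ->
  two_sided_smooth l1 l2 (f_global fc).
Proof.
move=> m0 n0 tg x y.
have nn : m%:R != 0 :> R by rewrite pnatr_eq0 -lt0n.
have E : f_global fc x - f_global fc y - inner (grad (f_global fc) y) (x - y)
  = m%:R^-1 * \sum_(i < m) (f_local fc i x - f_local fc i y - inner (grad (f_local fc i) y) (x - y)).
  rewrite grad_f_global innerZl inner_suml !sumrB /f_global; ring.
have K (c : R) : c = m%:R^-1 * \sum_(j < m) c.
  by rewrite sumr_const card_ord -[c *+ m]mulr_natl mulKf.
apply/andP; split; [rewrite E [leLHS]K|rewrite E [leRHS]K];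
  rewrite ler_pM2l ?invr_gt0 ?ltr0n //; apply: ler_sum => i _;
  by case/andP: (two_sided_f_local n0 (tg i) x y).
Qed.

End GradientMean.

(** * Extended-valued convex functions and the proximal step *)

Section ExtendedConvex.
Variables (R : realType) (d : nat) (psi : 'rV[R]_d -> \bar R).
Hypotheses (psi_proper : proper_fun psi) (psi_convex : strongly_convex 0 psi).
Implicit Types x y z u : 'rV[R]_d.

Lemma proper_fin_num x (c : R) :
  (psi x <= c%:E)%E -> psi x \is a fin_num /\ fine (psi x) <= c.
Proof.
case: psi_proper => /(_ x); case: (psi x) => [r| |] //= _ _.
Qed.

Lemma convex_comb_fine x y t : 0 <= t <= 1 ->
  psi x \is a fin_num -> psi y \is a fin_num ->
  psi (t *: x + (1 - t) *: y) \is a fin_num /\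
  fine (psi (t *: x + (1 - t) *: y)) <= t * fine (psi x) + (1 - t) * fine (psi y).
Proof.
move=> t01 dx dy; apply: proper_fin_num; apply: le_trans (psi_convex x y t01) _.
by rewrite -(fineK dx) -(fineK dy) !mul0r sube0 -!EFinM -EFinD.
Qed.

Lemma jensen_fine k (v : 'I_k.+1 -> 'rV[R]_d) :
  (forall i, psi (v i) \is a fin_num) ->
  psi (k.+1%:R^-1 *: \sum_i v i) \is a fin_num /\
  fine (psi (k.+1%:R^-1 *: \sum_i v i)) <= k.+1%:R^-1 * \sum_i fine (psi (v i)).
Proof.
elim: k v => [|k IH] v dv.
  by rewrite !big_ord1 invr1 scale1r mul1r lexx.
rewrite [\sum_i v i]big_ord_recr [\sum_i fine _]big_ord_recr /=.
have [dm im] := IH (fun i => v (widen_ord (leqnSn k.+1) i)) (fun i => dv _).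
have t1 : 0 <= (k.+1%:R / k.+2%:R : R) <= 1.
  by rewrite divr_ge0 //= ler_pdivrMr ?ltr0n // mul1r ler_nat.
have [dt it] := convex_comb_fine t1 dm (dv ord_max).
have e : 1 - k.+1%:R / k.+2%:R = k.+2%:R^-1 :> R.
  have k0 : (k.+2%:R : R) != 0 by rewrite pnatr_eq0.
  transitivity ((k.+2%:R - k.+1%:R) / k.+2%:R : R); first by rewrite mulrBl divff.
  by rewrite -natrB // subSnn mul1r.
have e' : k.+1%:R / k.+2%:R * k.+1%:R^-1 = k.+2%:R^-1 :> R.
  by rewrite mulrAC divff ?mul1r // pnatr_eq0.
rewrite scalerA e e' -scalerDr in dt it.
split => //; apply: le_trans it _.
apply: (@le_trans _ _ (k.+1%:R / k.+2%:R * (k.+1%:R^-1 * \sum_(i < k.+1) fine (psi (v (widen_ord (leqnSn k.+1) i)))) + k.+2%:R^-1 * fine (psi (v ord_max)))).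
  by rewrite lerD2r ler_wpM2l // divr_ge0.
by rewrite mulrA e' mulrDr.
Qed.

Lemma jensen_row_mean m (z : 'M[R]_(m, d)) : (0 < m)%N ->
  (forall i, psi (row i z) \is a fin_num) ->
  psi (row_mean z) \is a fin_num /\
  fine (psi (row_mean z)) <= m%:R^-1 * \sum_i fine (psi (row i z)).
Proof.
by case: m z => // m z _ dz; rewrite row_meanE; exact: jensen_fine.
Qed.

Section Prox.
Variables (m : nat) (eta : R).
Hypotheses (m_gt0 : (0 < m)%N) (eta_gt0 : 0 < eta).
Implicit Types w s U : 'M[R]_(m, d).

Let m_pos : 0 < m%:R :> R. Proof. by rewrite ltr0n. Qed.

Definition row_sum_fine (z : 'M[R]_(m, d)) : R := \sum_i fine (psi (row i z)).

Lemma Psi_fine (z : 'M[R]_(m, d)) : (forall i, psi (row i z) \is a fin_num) ->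
  Psi psi z = (m%:R^-1 * row_sum_fine z)%:E.
Proof.
move=> dz; rewrite /Psi (eq_bigr (fun i => (fine (psi (row i z)))%:E)).
  by rewrite sumEFin -EFinM.
by move=> i _; rewrite fineK.
Qed.

Lemma Psi_lty (z : 'M[R]_(m, d)) : Psi psi z != +oo%E ->
  forall i, psi (row i z) \is a fin_num.
Proof.
move=> h i; rewrite fin_numE (proj1 psi_proper) /=.
apply: contra h => /eqP pi; rewrite /Psi.
suff -> : (\sum_(i < m) psi (row i z))%E = +oo%E.
  by rewrite gt0_muley // lte_fin invr_gt0.
apply/eqP; rewrite esum_eqy; last by move=> k _; case: psi_proper.
by apply/existsP; exists i; rewrite pi.
Qed.

Hypothesis prox_exists :
  forall x, exists z, is_prox eta psi x z.

(** The factor [m] in the parameter cancels the [1 / m] in [Psi], so the problem separates into row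
    problems with parameter [eta]. Their solutions, stacked, solve it; hence [prox] does not fall
    back on its default value. *)
Lemma prox_Psi (x : 'M[R]_(m, d)) : is_prox (m%:R * eta) (@Psi R m d psi) x
  (prox (m%:R * eta) (@Psi R m d psi) x).
Proof.
apply: (@xgetPex _ _ [set z | is_prox (m%:R * eta) (@Psi R m d psi) x z]).
have [zf zfP] := choice (fun i => prox_exists (row i x)).
have [u0 du0] : exists u0, psi u0 \is a fin_num.
  by case: psi_proper => h [u hu]; exists u; rewrite fin_numE h.
have dz i : psi (zf i) \is a fin_num.
  have := zfP i u0; rewrite -(fineK du0) -EFinD.
  case: psi_proper => /(_ (zf i)).
  by case: (psi (zf i)) => [r| |].
pose z : 'M[R]_(m, d) := \matrix_(i < m) zf i.
have zi i : row i z = zf i by rewrite rowK.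
exists z => u.
have [->|hu] := eqVneq (Psi psi u) +oo%E; first by rewrite addye ?leey.
have du := Psi_lty hu.
have dzr i : psi (row i z) \is a fin_num by rewrite zi.
rewrite (Psi_fine dzr) (Psi_fine du) -!EFinD lee_fin.
have e (y : 'M[R]_(m, d)) : (2 * (m%:R * eta))^-1 * normsq (y - x) =
   m%:R^-1 * \sum_i (2 * eta)^-1 * normsq (row i y - row i x).
  rewrite normsq_rows -mulr_sumr [RHS]mulrA; congr (_ * _).
    by field; rewrite !lt0r_neq0.
  by apply: eq_bigr => i _; rewrite raddfB.
rewrite !e -!mulrDr ler_pM2l ?invr_gt0 // -!big_split /=.
apply: ler_sum => i _; rewrite zi; have := zfP i (row i u).
by rewrite -(fineK (dz i)) -(fineK (du i)) -!EFinD lee_fin.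
Qed.

(** First-order optimality: the minimizer [z] is compared with [z + t (U - z)], and convexity of
    [psi] allows division by [t]. *)
Lemma prox_variational (x : 'M[R]_(m, d)) U (z := prox (m%:R * eta) (@Psi R m d psi) x) :
  (forall i, psi (row i U) \is a fin_num) ->
  (forall i, psi (row i z) \is a fin_num) /\
  row_sum_fine z - row_sum_fine U <= eta^-1 * inner (z - x) (U - z).
Proof.
move=> dU; have := prox_Psi x; rewrite -/z => zP.
have dz : forall i, psi (row i z) \is a fin_num.
  apply: Psi_lty; have := zP U; rewrite (Psi_fine dU) -EFinD.
  by case: (Psi psi z).
split => //; rewrite -subr_le0.
apply: (@le0_of_small _ _ ((2 * eta)^-1 * normsq (U - z))) => t /andP[t0 t1].
pose w := t *: U + (1 - t) *: z.
have t01 : 0 <= t <= 1 by rewrite ltW.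
have wi i : row i w = t *: row i U + (1 - t) *: row i z.
  by rewrite /w raddfD /= !linearZ.
have dw i : psi (row i w) \is a fin_num.
  by rewrite wi; case: (convex_comb_fine t01 (dU i) (dz i)).
have := zP w; rewrite (Psi_fine dz) (Psi_fine dw) -!EFinD lee_fin.
have wz : w - x = (z - x) + t *: (U - z).
  by apply/matrixP => i j; rewrite !mxE; ring.
rewrite wz (normsqD (z - x)) innerZr normsqZ.
have sw : row_sum_fine w <= t * row_sum_fine U + (1 - t) * row_sum_fine z.
  rewrite /row_sum_fine !mulr_sumr -big_split; apply: ler_sum => i _.
  by rewrite wi; case: (convex_comb_fine t01 (dU i) (dz i)).
move: (normsq _) (normsq _) (inner _ _) => A B I.
rewrite -(ler_pM2l m_pos) !mulrDr.
have m0 := lt0r_neq0 m_pos; have e0 := lt0r_neq0 eta_gt0.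
have E (c : R) : m%:R * ((2 * (m%:R * eta))^-1 * c) = (2 * eta)^-1 * c.
  by field; rewrite m0 e0.
rewrite !E !mulVKf // => h.
have h' : row_sum_fine z <= row_sum_fine w +
   ((2 * eta)^-1 * (2 * (t * I)) + (2 * eta)^-1 * (t ^+ 2 * A)).
  lra.
have e2 : (2 * eta)^-1 * (2 * (t * I)) = t * (eta^-1 * I) by field.
rewrite e2 in h'.
rewrite -(ler_pM2l t0).
have e3 : t * (t * ((2 * eta)^-1 * A)) = (2 * eta)^-1 * (t ^+ 2 * A) by ring.
rewrite e3; lra.
Qed.

Let center (x : 'M[R]_(m, d)) := x - consensus m (row_mean x).

Let inner_center (x y : 'M[R]_(m, d)) :
  inner x y = inner (center x) (center y) + m%:R * inner (row_mean x) (row_mean y).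
Proof.
have E (a : 'rV[R]_d) (b : 'M[R]_(m, d)) : inner (consensus m a) b = m%:R * inner a (row_mean b).
  rewrite inner_rows -innerZr -sum_rows // inner_sumr.
  by apply: eq_bigr => i _; rewrite row_consensus.
rewrite /center innerBl !innerBr (innerC x (consensus _ _)) !E.
by rewrite row_mean_consensus // (innerC (row_mean y)); ring.
Qed.

Let centerB (x y : 'M[R]_(m, d)) : center (x - y) = center x - center y.
Proof.
by rewrite /center row_meanB; apply/matrixP => i j; rewrite !mxE; ring.
Qed.

Let centerZ a (x : 'M[R]_(m, d)) : center (a *: x) = a *: center x.
Proof.
by rewrite /center row_meanZ; apply/matrixP => i j; rewrite !mxE; ring.
Qed.

Let center_consensus u : center (consensus m u) = 0.
Proof. by rewrite /center row_mean_consensus // subrr. Qed.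

Lemma prox_finite (x : 'M[R]_(m, d)) (z := prox (m%:R * eta) (@Psi R m d psi) x) :
  (forall i, psi (row i z) \is a fin_num).
Proof.
have [u0 du0] : exists u0, psi u0 \is a fin_num.
  by case: psi_proper => h [u hu]; exists u; rewrite fin_numE h.
by have [] := @prox_variational x (consensus m u0) (fun i => ltac:(by rewrite row_consensus)).
Qed.

Lemma prox_row_mean_finite (x : 'M[R]_(m, d)) :
  psi (row_mean (prox (m%:R * eta) (@Psi R m d psi) x)) \is a fin_num.
Proof. by have [] := jensen_row_mean m_gt0 (@prox_finite x). Qed.

(** The variational inequality is tested at the consensus matrix of the mean of [z]. By Jensen its
    left side is nonnegative, the means drop out, and what is left is [|zc|^2 <= <xc, zc>] for the
    centered parts. *)
Lemma dev_prox (x : 'M[R]_(m, d)) : dev (prox (m%:R * eta) (@Psi R m d psi) x) <= dev x.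
Proof.
set z := prox _ _ _; have dz := prox_finite x.
have [dzm jz] := jensen_row_mean m_gt0 dz.
have [|_] := @prox_variational x (consensus m (row_mean z)).
  by move=> i; rewrite row_consensus.
rewrite -/z => h.
have h0 : 0 <= eta^-1 * inner (z - x) (consensus m (row_mean z) - z).
  apply: le_trans h; rewrite subr_ge0 /row_sum_fine.
  rewrite (eq_bigr (fun=> fine (psi (row_mean z)))) => [|i _]; last first.
    by rewrite row_consensus.
  rewrite sumr_const card_ord -[fine _ *+ m]mulr_natl.
  by rewrite -(ler_pM2l (_ : 0 < m%:R^-1)) ?invr_gt0 // mulKf // lt0r_neq0.
move: h0; rewrite pmulr_rge0 ?invr_gt0 // inner_center.
rewrite !row_meanB row_mean_consensus // (subrr (row_mean z)) inner0r mulr0 addr0.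
rewrite !centerB center_consensus sub0r innerNr oppr_ge0 innerBl subr_le0 => h1.
rewrite !devE -/(center z) -/(center x).
have := @young _ _ _ 1 (center x) (center z) ltr01.
move: h1; rewrite -/(normsq _) mulr1; lra.
Qed.

(** The three-point inequality of a proximal step, for the averages. The variational inequality is
    tested at a consensus matrix, and Jensen passes to the mean of [z]. The centered part of [z]
    occurs as [- |zc|^2], which absorbs both Young terms and leaves only the deviations of [w] and
    [s]. *)
Lemma prox_step (w s : 'M[R]_(m, d)) (u : 'rV[R]_d)
  (z := prox (m%:R * eta) (@Psi R m d psi) (w - eta *: s)) :
  psi u \is a fin_num ->
  fine (psi (row_mean z)) - fine (psi u) <=
    (2 * eta)^-1 * (normsq (u - row_mean w) - normsq (row_mean z - row_mean w)
                    - normsq (u - row_mean z))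
    + inner (row_mean s) (u - row_mean z)
    + (2 * eta * m%:R)^-1 * (dev w + eta ^+ 2 * dev s).
Proof.
move=> du; have dz := prox_finite (w - eta *: s).
have [dzm jz] := jensen_row_mean m_gt0 dz; rewrite -/z in dz dzm jz.
have [|_] := @prox_variational (w - eta *: s) (consensus m u).
  by move=> i; rewrite row_consensus.
rewrite -/z => h.
have h' : fine (psi (row_mean z)) - fine (psi u) <=
    m%:R^-1 * (eta^-1 * inner (z - (w - eta *: s)) (consensus m u - z)).
  apply: (@le_trans _ _ (m%:R^-1 * (row_sum_fine z - row_sum_fine (consensus m u)))).
    rewrite mulrBr lerB // {1}/row_sum_fine.
    rewrite (eq_bigr (fun=> fine (psi u))) => [|i _]; last first.
      by rewrite row_consensus.
    by rewrite sumr_const card_ord -[fine _ *+ m]mulr_natl mulKf // lt0r_neq0.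
  by rewrite ler_pM2l // invr_gt0.
apply: le_trans h' _.
rewrite inner_center !row_meanB !row_meanZ row_mean_consensus //.
rewrite !(centerB, centerZ) center_consensus sub0r.
set zc := center z; set wc := center w; set sc := center s.
set zm := row_mean z; set wm := row_mean w; set sm := row_mean s.
rewrite !devE -/(center w) -/(center s) -/wc -/sc.
have -> : zm - (wm - eta *: sm) = (zm - wm) + eta *: sm.
  by apply/rowP => j; rewrite !mxE; ring.
have -> : zc - (wc - eta *: sc) = (zc - wc) + eta *: sc.
  by apply/matrixP => i j; rewrite !mxE; ring.
rewrite (innerDl (zc - wc)) (innerDl (zm - wm)) !(innerZl eta) !innerNr.
have -> : inner (zm - wm) (u - zm) = (normsq (u - wm) - normsq (zm - wm) - normsq (u - zm)) / 2.
  have -> : u - wm = (zm - wm) + (u - zm).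
    by apply/rowP => j; rewrite !mxE; ring.
  by rewrite normsqD; field.
have -> : inner (zc - wc) zc = normsq zc - inner wc zc by rewrite innerBl.
have y1 := @young _ _ _ 1 wc zc ltr01.
have y2 := @young _ _ _ 1 (- (eta *: sc)) zc ltr01.
rewrite innerNl innerZl normsqN normsqZ in y2.
have p1 := m_pos; have p2 := eta_gt0.
move: (normsq zc) (normsq wc) (normsq sc) (inner wc zc) (inner sc zc) y1 y2 => Z W S WZ SZ y1 y2.
move: (inner sm _) (_ - normsq _) => V Q.
have q : 0 <= (2 * eta * m%:R)^-1 by rewrite invr_ge0 !mulr_ge0 // ltW.
have E : m%:R^-1 * (eta^-1 * (- (Z - WZ) + eta * - SZ + m%:R * (Q / 2 + eta * V)))
   = (2 * eta)^-1 * Q + V + (2 * eta * m%:R)^-1 * (2 * (- (Z - WZ) + eta * - SZ)).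
  by field; rewrite !lt0r_neq0.
rewrite E lerD2l ler_wpM2l //; lra.
Qed.

End Prox.
End ExtendedConvex.

(** * Geometric averages over an epoch *)

Section GeometricSums.
Variables (R : realType) (p : R).
Hypotheses (p_gt0 : 0 < p) (p_le1 : p <= 1).
Implicit Types (a : nat -> R) (N : nat).

Definition geo_sum N a : R := \sum_(t < N) (1 - p) ^+ t * p * a t.

Let q_ge0 : 0 <= 1 - p. Proof. by rewrite subr_ge0. Qed.

Let weight_ge0 t : 0 <= (1 - p) ^+ t * p.
Proof. by rewrite mulr_ge0 ?exprn_ge0 // ltW. Qed.

Lemma geo_sum_le N a b : (forall t, a t <= b t) -> geo_sum N a <= geo_sum N b.
Proof. by move=> h; apply: ler_sum => t _; rewrite ler_wpM2l. Qed.

Lemma geo_sum_ge0 N a : (forall t, 0 <= a t) -> 0 <= geo_sum N a.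
Proof. by move=> h; apply: sumr_ge0 => t _; rewrite mulr_ge0. Qed.

Lemma geo_sumD N a b : geo_sum N (fun t => a t + b t) = geo_sum N a + geo_sum N b.
Proof. by rewrite -big_split; apply: eq_bigr => t _; rewrite mulrDr. Qed.

Lemma geo_sumZ N c a : geo_sum N (fun t => c * a t) = c * geo_sum N a.
Proof. by rewrite mulr_sumr; apply: eq_bigr => t _; rewrite mulrCA. Qed.

Lemma geo_sumB N a b : geo_sum N (fun t => a t - b t) = geo_sum N a - geo_sum N b.
Proof. by rewrite -sumrB; apply: eq_bigr => t _; rewrite mulrBr. Qed.

Lemma geo_sum_lin N c1 c2 c3 c4 x y u v w z :
  geo_sum N (fun t => c1 * (x t - y t) + c2 * u t + c3 * v t + c4 * (w t + z t)) =
  c1 * (geo_sum N x - geo_sum N y) + c2 * geo_sum N u + c3 * geo_sum N v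
    + c4 * (geo_sum N w + geo_sum N z).
Proof. by rewrite -geo_sumB -(geo_sumD N w z) -!geo_sumZ -!geo_sumD. Qed.

Lemma geo_sum_lin2 N c1 c2 x z w v :
  geo_sum N (fun t => x t + c1 * (z t + w t + c2 * v t)) =
  geo_sum N x + c1 * (geo_sum N z + geo_sum N w + c2 * geo_sum N v).
Proof.
by rewrite -(geo_sumZ N c2) -(geo_sumD N z) -geo_sumD -geo_sumZ -geo_sumD.
Qed.

Lemma geo_sum_cst N (c : R) : geo_sum N (fun=> c) = (1 - (1 - p) ^+ N) * c.
Proof.
rewrite /geo_sum -mulr_suml; congr (_ * _).
elim: N => [|N IH]; first by rewrite big_ord0 expr0 subrr.
by rewrite big_ord_recr /= IH exprSr; ring.
Qed.

Lemma geo_sum_cst_le N (c : R) : 0 <= c -> geo_sum N (fun=> c) <= c.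
Proof.
by move=> c0; rewrite geo_sum_cst ler_piMl // gerBl exprn_ge0.
Qed.

(** For the full law this is the identity [E a(T) = p a(0) + (1 - p) E a(T + 1)]; the truncation
    leaves an additional nonnegative term on the right. *)
Lemma geo_sum_shift N a : (forall t, 0 <= a t) ->
  geo_sum N a <= p * a 0%N + (1 - p) * geo_sum N (fun t => a t.+1).
Proof.
move=> a0; case: N => [|N].
  by rewrite /geo_sum !big_ord0 mulr0 addr0 mulr_ge0 // ltW.
rewrite {1}/geo_sum big_ord_recl /= expr0 mul1r lerD2l.
rewrite /geo_sum big_ord_recr /= mulrDr mulr_sumr -[leLHS]addr0; apply: lerD.
  rewrite le_eqVlt; apply/orP; left; apply/eqP; apply: eq_bigr => t _.
  by rewrite /bump /= add1n exprS !mulrA.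
by rewrite mulr_ge0 // mulr_ge0.
Qed.

(** The reason for a geometric epoch length: the difference between consecutive iterates at a random
    time becomes [p] times the difference between the start and the end of the epoch. *)
Lemma geo_sum_telescope N a : (forall t, 0 <= a t) ->
  geo_sum N a - geo_sum N (fun t => a t.+1)
    <= p * (a 0%N - geo_sum N (fun t => a t.+1)).
Proof. by move=> /geo_sum_shift -/(_ N); lra. Qed.

(** One epoch reduced to real sequences, the expectations after [t] inner steps: [D] is the
    objective gap, [d] the squared distance to the reference point, [Q] the consensus error, [S] the
    squared distance to the minimizer. [U0] is the deviation of the reference point, [r] the
    consensus rate and [a] a Young weight. *)
Variables (eta mm r a B C sig U0 : R) (D d Q S : nat -> R).
Hypotheses (eta_gt0 : 0 < eta) (mm_gt0 : 0 < mm) (r_ge0 : 0 <= r) (r_half : 2 * r <= 1)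
  (a_gt0 : 0 < a) (B_ge0 : 0 <= B) (C_ge0 : 0 <= C) (sig_gt0 : 0 < sig).
Hypotheses (D_ge0 : forall t, 0 <= D t) (d_ge0 : forall t, 0 <= d t)
  (Q_ge0 : forall t, 0 <= Q t) (S_ge0 : forall t, 0 <= S t).
Hypotheses (d_0 : d 0%N = 0) (U0_ge0 : 0 <= U0) (U0_le : U0 <= Q 0%N).
Hypothesis Q_step : forall t, Q t.+1 <= r * (Q t + U0 + mm * d t).
Hypothesis D_step_ref : forall t, D t.+1 - D 0%N <=
  (2 * eta)^-1 * (d t - d t.+1) + a / 2 * d t + B * d t + C * (Q t + U0).
Hypothesis D_step_opt : forall t, D t.+1 <=
  (2 * eta)^-1 * (S t - S t.+1) + a / 2 * S t + B * d t + C * (Q t + U0).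
Hypothesis S_le : forall t, sig / 2 * S t <= D t.
Hypothesis a_le : a <= p / (8 * eta).
Hypothesis a_sig : 50 * a <= sig * p.
Hypothesis B_le : B + 2 * r * mm * C <= p / (8 * eta).

Let hat N (x : nat -> R) := geo_sum N (fun t => x t.+1).

(** Averaging [Q_step] reproduces [hat N Q] on the right with factor [r], and [2 * r <= 1] absorbs
    it. *)
Lemma epoch_consensus N : hat N Q <= 4 * r * Q 0%N + 2 * r * mm * hat N d.
Proof.
have h := geo_sum_le N Q_step.
have : hat N Q <= r * (geo_sum N Q + geo_sum N (fun=> U0) + mm * geo_sum N d).
  apply: le_trans h _.
  by rewrite geo_sumZ !geo_sumD geo_sumZ.
have c := geo_sum_cst_le N U0_ge0.
have sQ := geo_sum_shift N Q_ge0; have sd := geo_sum_shift N d_ge0.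
have q0 : 0 <= hat N Q by apply: geo_sum_ge0.
have d0 : 0 <= hat N d by apply: geo_sum_ge0.
move: sQ sd; rewrite -/(hat N Q) -/(hat N d) d_0 mulr0 add0r => sQ sd.
have p0 := p_gt0; have p1 := p_le1; have u1 := U0_le; have Q0 := Q_ge0 0.
have r0 := r_ge0; have r1 := r_half; have m0 := mm_gt0.
have sQ' : geo_sum N Q <= Q 0%N + hat N Q.
  have h1 : p * Q 0%N <= Q 0%N by rewrite ler_piMl.
  have h2 : (1 - p) * hat N Q <= hat N Q by rewrite ler_piMl //; lra.
  lra.
have sd' : geo_sum N d <= hat N d.
  have h2 : (1 - p) * hat N d <= hat N d by rewrite ler_piMl //; lra.
  lra.
move=> h1.
have h2 : hat N Q <= r * (2 * Q 0%N + hat N Q + mm * hat N d).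
  apply: le_trans h1 _; rewrite ler_wpM2l //.
  have : mm * geo_sum N d <= mm * hat N d by rewrite ler_pM2l.
  lra.
have h3 : 2 * r * hat N Q <= 1 * hat N Q by rewrite ler_wpM2r.
lra.
Qed.

Let err_sum_le N : C * (geo_sum N Q + geo_sum N (fun=> U0)) <=
  4 * C * Q 0%N + 2 * r * mm * C * hat N d.
Proof.
have eQ := epoch_consensus N.
have c := geo_sum_cst_le N U0_ge0.
have sQ := geo_sum_shift N Q_ge0.
have q0 : 0 <= hat N Q by apply: geo_sum_ge0.
have p0 := p_gt0; have p1 := p_le1; have u1 := U0_le; have Q0 := Q_ge0 0.
have r0 := r_ge0; have r1 := r_half.
have -> : 4 * C * Q 0%N + 2 * r * mm * C * hat N d = C * (4 * Q 0%N + 2 * r * mm * hat N d) by ring.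
rewrite ler_wpM2l //.
have h1 : p * Q 0%N <= Q 0%N by rewrite ler_piMl.
have h2 : (1 - p) * hat N Q <= hat N Q by rewrite ler_piMl //; lra.
have h3 : 2 * r * Q 0%N <= 1 * Q 0%N by rewrite ler_wpM2r.
rewrite -/(hat N Q) in sQ; lra.
Qed.

Let geo_d_le N : geo_sum N d <= hat N d.
Proof.
have sd := geo_sum_shift N d_ge0; rewrite d_0 mulr0 add0r in sd.
have p0 := p_gt0; have p1 := p_le1.
have d0 : 0 <= hat N d by apply: geo_sum_ge0.
have h2 : (1 - p) * hat N d <= hat N d by rewrite ler_piMl //; lra.
rewrite -/(hat N d) in sd; lra.
Qed.

(** As [d 0 = 0], telescoping turns the distances into [- p / (2 * eta) * hat N d]. Half of this
    pays for the variance, the Young term and the consensus errors; the other half is kept on the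
    left. *)
Lemma epoch_descent N :
  hat N D + p / (4 * eta) * hat N d <= D 0%N + 4 * C * Q 0%N.
Proof.
have h := geo_sum_le N D_step_ref.
have E : hat N D - geo_sum N (fun=> D 0%N) <= (2 * eta)^-1 * (geo_sum N d - hat N d)
   + (a / 2 + B) * geo_sum N d + C * (geo_sum N Q + geo_sum N (fun=> U0)).
  rewrite -geo_sumB; apply: le_trans h _.
  by rewrite geo_sum_lin /hat le_eqVlt; apply/orP; left; apply/eqP; ring.
have c := geo_sum_cst_le N (D_ge0 0).
have t := geo_sum_telescope N d_ge0; rewrite -/(hat N d) d_0 sub0r in t.
have eta0 := eta_gt0; have p0 := p_gt0; have a0 := a_gt0; have B0 := B_ge0.
have t' : (2 * eta)^-1 * (geo_sum N d - hat N d) <= (2 * eta)^-1 * (p * (- hat N d)).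
  by rewrite ler_pM2l // invr_gt0 mulr_gt0.
have dle := geo_d_le N.
have d0 : 0 <= hat N d by apply: geo_sum_ge0.
have h1 : (a / 2 + B) * geo_sum N d <= (a / 2 + B) * hat N d.
  by rewrite ler_wpM2l //; lra.
have es := err_sum_le N.
have aB : a / 2 + B + 2 * r * mm * C <= p / (4 * eta).
  have e1 := a_le; have e2 := B_le.
  have -> : p / (4 * eta) = p / (8 * eta) + p / (8 * eta) by field; rewrite lt0r_neq0.
  lra.
have aBd : (a / 2 + B + 2 * r * mm * C) * hat N d <= p / (4 * eta) * hat N d.
  by rewrite ler_wpM2r.
have e3 : (2 * eta)^-1 * (p * (- hat N d)) = - (p / (4 * eta) * hat N d) - (p / (4 * eta) * hat N d).
  by field; rewrite lt0r_neq0.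
lra.
Qed.

(** Compared with the minimizer, [S] telescopes instead of [d], so the variance stays unpaid on the
    right; the surplus of [epoch_descent] will cover it. The Young term in [S] costs only a fiftieth
    of the gaps, by [a_sig] and the growth of the objective. *)
Lemma epoch_optimum N :
  hat N D <= p / (4 * eta) * hat N d + p / (2 * eta) * (S 0%N - hat N S)
     + (D 0%N + hat N D) / 50 + 4 * C * Q 0%N.
Proof.
have h := geo_sum_le N D_step_opt.
have E : hat N D <= (2 * eta)^-1 * (geo_sum N S - hat N S) + a / 2 * geo_sum N S
   + B * geo_sum N d + C * (geo_sum N Q + geo_sum N (fun=> U0)).
  apply: le_trans h _.
  by rewrite geo_sum_lin.
have t := geo_sum_telescope N S_ge0; rewrite -/(hat N S) in t.
have sS := geo_sum_shift N S_ge0; rewrite -/(hat N S) in sS.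
have eta0 := eta_gt0; have p0 := p_gt0; have a0 := a_gt0; have B0 := B_ge0.
have p1 := p_le1; have s0 := sig_gt0.
have t' : (2 * eta)^-1 * (geo_sum N S - hat N S) <= (2 * eta)^-1 * (p * (S 0%N - hat N S)).
  by rewrite ler_pM2l // invr_gt0 mulr_gt0.
have dle := geo_d_le N.
have d0 : 0 <= hat N d by apply: geo_sum_ge0.
have hS0 : 0 <= hat N S by apply: geo_sum_ge0.
have h1 : B * geo_sum N d <= B * hat N d by rewrite ler_wpM2l.
have es := err_sum_le N.
have Bd : (B + 2 * r * mm * C) * hat N d <= p / (4 * eta) * hat N d.
  rewrite ler_wpM2r //; apply: le_trans B_le _.
  rewrite ler_pM2l // lef_pV2 ?posrE ?mulr_gt0 //.
  by rewrite ler_pM2r // ler_nat.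
have e3 : (2 * eta)^-1 * (p * (S 0%N - hat N S)) = p / (2 * eta) * (S 0%N - hat N S).
  by field; rewrite lt0r_neq0.
have SD : sig / 2 * hat N S <= hat N D.
  rewrite /hat -geo_sumZ; exact: geo_sum_le.
have S0D := S_le 0%N.
have sS' : geo_sum N S <= S 0%N + hat N S.
  have h3 : p * S 0%N <= S 0%N by rewrite ler_piMl.
  have h4 : (1 - p) * hat N S <= hat N S by rewrite ler_piMl //; lra.
  lra.
have as1 : a / 2 * geo_sum N S <= (D 0%N + hat N D) / 50.
  apply: (@le_trans _ _ (a / 2 * (S 0%N + hat N S))).
    by rewrite ler_wpM2l //; lra.
  have SS : 0 <= S 0%N + hat N S by rewrite addr_ge0.
  have h5 : 50 * a * (S 0%N + hat N S) <= sig * (S 0%N + hat N S).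
    rewrite ler_wpM2r //; apply: le_trans a_sig _.
    by rewrite ler_piMr // ltW.
  lra.
lra.
Qed.

End GeometricSums.

(** * The expected effect of one step, of one epoch and of a run *)

Section BatchAverage.
Variables (R : realType) (A : finType) (n : nat).
Hypothesis n_gt0 : (0 < n)%N.
Local Notation batch := {ffun A -> 'I_n}.

Let n_neq0 : n%:R != 0 :> R. Proof. by rewrite pnatr_eq0 -lt0n. Qed.

(** The expectation under independent uniform draws indexed by [A]. *)
Definition batch_avg (g : batch -> R) : R := (n%:R ^+ #|A|)^-1 * \sum_B g B.

Lemma batch_avg_prod (F : A -> 'I_n -> R) :
  batch_avg (fun B => \prod_a F a (B a)) = \prod_a (n%:R^-1 * \sum_j F a j).
Proof.
rewrite big_split /= prodr_const exprVn /batch_avg; congr (_ * _).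
by rewrite bigA_distr_bigA.
Qed.

Lemma batch_avgD g1 g2 :
  batch_avg (fun B => g1 B + g2 B) = batch_avg g1 + batch_avg g2.
Proof. by rewrite /batch_avg big_split mulrDr. Qed.

Lemma batch_avgZ c g : batch_avg (fun B => c * g B) = c * batch_avg g.
Proof. by rewrite /batch_avg -mulr_sumr mulrCA. Qed.

Lemma batch_avg_sum (I : Type) (r : seq I) (P : pred I) (g : I -> batch -> R) :
  batch_avg (fun B => \sum_(i <- r | P i) g i B) =
  \sum_(i <- r | P i) batch_avg (g i).
Proof. by rewrite /batch_avg exchange_big /= mulr_sumr. Qed.

Lemma batch_avg_le g1 g2 : (forall B, g1 B <= g2 B) -> batch_avg g1 <= batch_avg g2.
Proof.
move=> h; rewrite /batch_avg ler_wpM2l //; last exact: ler_sum.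
Qed.

Lemma batch_avg_cst c : batch_avg (fun=> c) = c.
Proof.
rewrite /batch_avg sumr_const card_ffun card_ord -[c *+ _]mulr_natl natrX mulKf //.
by rewrite expf_neq0.
Qed.

Lemma batch_avg_ext g1 g2 : g1 =1 g2 -> batch_avg g1 = batch_avg g2.
Proof. by move=> h; congr (_ * _); apply: eq_bigr. Qed.

Lemma batch_avg_affine_le (X Y Z V : batch -> R) (v c k e : R) :
  (forall B, X B - v <= c + k * Y B + (e * Z B + V B)) ->
  batch_avg X - v <= c + k * batch_avg Y + (e * batch_avg Z + batch_avg V).
Proof.
move=> h; rewrite -{1}(batch_avg_cst v) -{1}(batch_avg_cst c) -!batch_avgZ.
rewrite -mulN1r -batch_avgZ -!batch_avgD; apply: batch_avg_le => B.
by rewrite mulN1r.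
Qed.

Lemma batch_avg_marginal a (h : 'I_n -> R) :
  batch_avg (fun B => h (B a)) = n%:R^-1 * \sum_j h j.
Proof.
pose F c j : R := if c == a then h j else 1.
rewrite (@batch_avg_ext _ (fun B => \prod_c F c (B c))).
  rewrite batch_avg_prod (bigD1 a) //= /F eqxx.
  rewrite [\prod_(_ | _) _]big1 ?mulr1 // => c /negbTE ->.
  by rewrite sumr_const card_ord mulVf.
move=> B; rewrite (bigD1 a) //= /F eqxx big1 ?mulr1 // => c /negbTE -> //.
Qed.

Lemma batch_avg_marginal2 a c (h k : 'I_n -> R) : a != c ->
  batch_avg (fun B => h (B a) * k (B c)) =
  (n%:R^-1 * \sum_j h j) * (n%:R^-1 * \sum_j k j).
Proof.
move=> ac.
pose F e j : R := if e == a then h j else if e == c then k j else 1.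
have ca : c == a = false by rewrite eq_sym (negbTE ac).
rewrite (@batch_avg_ext _ (fun B => \prod_c F c (B c))).
  rewrite batch_avg_prod (bigD1 a) //= (bigD1 c) /= ?ca //.
  rewrite /F !eqxx ca [\prod_(_ | _) _]big1 ?mulr1 // => e /andP[/negbTE -> /negbTE ->].
  by rewrite sumr_const card_ord mulVf.
move=> B; rewrite (bigD1 a) //= (bigD1 c) /= ?ca //.
by rewrite /F !eqxx ca big1 ?mulr1 // => e /andP[/negbTE -> /negbTE ->].
Qed.

Variables (p d : nat).
Variable xi : A -> 'I_n -> 'M[R]_(p, d).
Hypothesis xi_centered : forall a, \sum_j xi a j = 0.

Lemma batch_avg_inner_centered (y : 'M[R]_(p, d)) :
  batch_avg (fun B => inner y (\sum_a xi a (B a))) = 0.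
Proof.
rewrite (@batch_avg_ext _ (fun B => \sum_a inner y (xi a (B a)))).
  rewrite batch_avg_sum big1 // => a _.
  rewrite (batch_avg_marginal a (fun j => inner y (xi a j))).
  by rewrite -inner_sumr xi_centered inner0r mulr0.
by move=> B; rewrite inner_sumr.
Qed.

(** Draws with different indices are independent and centered, so the cross terms vanish and the
    variances add. *)
Lemma batch_avg_normsq_centered :
  batch_avg (fun B => normsq (\sum_a xi a (B a))) =
  \sum_a (n%:R^-1 * \sum_j normsq (xi a j)).
Proof.
rewrite (@batch_avg_ext _ (fun B => \sum_a \sum_c inner (xi a (B a)) (xi c (B c)))).
  rewrite batch_avg_sum; apply: eq_bigr => a _.
  rewrite batch_avg_sum (bigD1 a) //= big1 ?addr0.
    exact: (batch_avg_marginal a (fun j => normsq (xi a j))).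
  move=> c ca; rewrite batch_avg_sum big1 // => i _; rewrite batch_avg_sum big1 // => k _.
  rewrite (@batch_avg_marginal2 a c (fun j => xi a j i k) (fun j => xi c j i k)).
    by rewrite -!summxE !xi_centered !mxE !mulr0.
  by rewrite eq_sym.
move=> B; rewrite /normsq inner_suml; apply: eq_bigr => a _.
by rewrite inner_sumr.
Qed.

End BatchAverage.

(** * One inner step: consensus errors and expected descent *)

Section InnerStep.
Variables (R : realType) (m n d b M : nat).
Variables (fc : 'I_m -> 'I_n -> 'rV[R]_d -> R) (psi : 'rV[R]_d -> \bar R).
Variables (W : 'M[R]_m) (L l1 l2 eta rho : R).
Hypotheses (m_gt0 : (0 < m)%N) (n_gt0 : (0 < n)%N) (b_gt0 : (0 < b)%N).
Hypotheses (fc_diff : forall i j x, differentiable (fc i j) x)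
  (fc_smooth : forall i j, two_sided_smooth l1 l2 (fc i j))
  (f_convex : strongly_convex 0 (EFin \o f_global fc))
  (f_smooth : lipschitz_smooth L (f_global fc))
  (psi_proper : proper_fun psi) (psi_convex : strongly_convex 0 psi)
  (prox_exists : forall (c : R) (x : 'rV[R]_d), 0 < c -> exists z, is_prox c psi x z).
Hypotheses (L_ge0 : 0 <= L) (l1_gt0 : 0 < l1) (l1_le_l2 : l1 <= l2).
Hypotheses (eta_gt0 : 0 < eta) (rho_gt0 : 0 < rho) (rho_small : 10 * rho <= 1).
Hypothesis mix_mean : forall x : 'M[R]_(m, d), row_mean (fastmix W M x) = row_mean x.
Hypothesis mix_dev : forall x : 'M[R]_(m, d), dev (fastmix W M x) <= rho ^+ 2 * dev x.

Definition curry_batch (B : {ffun 'I_m * 'I_b -> 'I_n}) : 'I_m -> 'I_b -> 'I_n :=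
  fun i l => B (i, l).

Let m_pos : 0 < m%:R :> R. Proof. by rewrite ltr0n. Qed.
Let n_pos : 0 < n%:R :> R. Proof. by rewrite ltr0n. Qed.
Let b_pos : 0 < b%:R :> R. Proof. by rewrite ltr0n. Qed.

Section FixedReference.
Variables mu w0 : 'M[R]_(m, d).
Hypothesis mu_mean : row_mean mu = row_mean (local_grads fc w0).

Local Notation step B := (inner_step fc psi W eta M mu w0 (curry_batch B)).
Implicit Types st : inner_state R m d.

(** Gradient tracking: mixing preserves means, so the mean of [s] remains that of the estimators
    [v]. Finiteness of [psi] at the mean lets the objective be handled as a real number. *)
Definition inner_inv st : Prop :=
  row_mean (in_s st) = row_mean (in_v st) /\ psi (row_mean (in_w st)) \is a fin_num.

(** The last term is carried because the tracker is updated by the increment of [v], so the previous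
    [v] enters the next error. It does so with a factor [rho ^+ 2]; the weight [rho] leaves the
    other [rho] as the rate. *)
Definition inner_err st : R :=
  dev (in_w st) + eta ^+ 2 * dev (in_s st)
  + rho * (eta ^+ 2 * normsq (in_v st - mu)).

Definition inner_dist st : R := normsq (row_mean (in_w st) - row_mean w0).

Lemma inner_inv_step B st : inner_inv st -> inner_inv (step B st).
Proof.
move=> [h1 h2]; split.
  by rewrite /inner_step /= mix_mean row_meanB row_meanD h1 addrAC subrr add0r.
rewrite /= mix_mean; apply: prox_row_mean_finite => // x.
exact: prox_exists.
Qed.

(** The squared Lipschitz constant of [two_sided_lipschitz] in the units [eta ^+ 2] of a step. *)
Definition lam_err : R := 2 * eta ^+ 2 * l2 ^+ 2.
Definition rate_err : R := rho * (4 + 6 * lam_err).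

Lemma normsq_sub_dev (x y : 'M[R]_(m, d)) :
  normsq (x - y) <= 3 * (dev x + dev y + m%:R * normsq (row_mean x - row_mean y)).
Proof.
have -> : x - y = (x - consensus m (row_mean x)) + (- (y - consensus m (row_mean y)))
   + consensus m (row_mean x - row_mean y).
  by apply/matrixP => i j; rewrite !mxE; ring.
apply: le_trans (normsqD_le3 _ _ _) _.
rewrite normsqN -!devE [normsq (consensus _ _)]sum_normsq_mean //.
by rewrite dev_consensus // row_mean_consensus // add0r.
Qed.

(** It holds for each batch separately, so the consensus recursion is pathwise and involves no
    variance. *)
Lemma in_v_step_sub B st :
  normsq (in_v (step B st) - mu) <= 2 * l2 ^+ 2 * normsq (in_w st - w0).
Proof.
rewrite !normsq_rows mulr_sumr; apply: ler_sum => i _.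
rewrite !raddfB /= rowK addrAC subrr add0r normsqZ.
apply: (@le_trans _ _ (b%:R^-1 ^+ 2 * (b%:R * \sum_(l < b)
  2 * l2 ^+ 2 * normsq (row i (in_w st) - row i w0)))).
  rewrite ler_pM2l ?exprn_gt0 ?invr_gt0 //.
  apply: le_trans (normsq_sum_le _ _) _.
  rewrite card_ord ler_pM2l //; apply: ler_sum => l _.
  exact: (two_sided_lipschitz l1_gt0).
rewrite sumr_const card_ord -[(2 * _ * _) *+ b]mulr_natl.
set X := 2 * _ * _.
rewrite le_eqVlt; apply/orP; left; apply/eqP.
by field; rewrite lt0r_neq0.
Qed.

Lemma inner_err_step B st : inner_inv st ->
  inner_err (step B st) <=
    rate_err * (inner_err st + dev w0 + m%:R * inner_dist st).
Proof.
move=> inv; have h1 := in_v_step_sub B st.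
have h2 := normsq_sub_dev (in_w st) w0.
have hs : dev (in_s (step B st)) <= rho ^+ 2 * (3 * (dev (in_s st)
   + normsq (in_v (step B st) - mu) + normsq (in_v st - mu))).
  rewrite {1}/inner_step /=; apply: le_trans (mix_dev _) _.
  rewrite ler_wpM2l ?sqr_ge0 //.
  rewrite -[X in dev X]/(in_s st + in_v (step B st) - in_v st).
  have -> : in_s st + in_v (step B st) - in_v st =
     in_s st + (in_v (step B st) - mu) + (- (in_v st - mu)).
    by move: (in_v _) => v; apply/matrixP => i j; rewrite !mxE; ring.
  apply: le_trans (devD_le3 _ _ _) _.
  rewrite ler_wpM2l // !lerD // ?dev_le_normsq //.
  by rewrite -(normsqN (in_v st - mu)) dev_le_normsq.
have hw : dev (in_w (step B st)) <=
    rho ^+ 2 * (2 * (dev (in_w st) + eta ^+ 2 * dev (in_s (step B st)))).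
  rewrite {1}/inner_step /=; apply: le_trans (mix_dev _) _.
  rewrite ler_wpM2l ?sqr_ge0 //.
  apply: le_trans (dev_prox psi_proper psi_convex m_gt0 eta_gt0 _ _) _.
    by move=> x; exact: prox_exists.
  rewrite -[fastmix W M _]/(in_s (step B st)).
  rewrite !devE row_meanB row_meanZ -normsqZ.
  set a := in_w st; set c := in_s _.
  have -> : a - eta *: c - consensus m (row_mean a - eta *: row_mean c) =
    (a - consensus m (row_mean a)) - eta *: (c - consensus m (row_mean c)).
    by apply/matrixP => i j; rewrite !mxE; ring.
  exact: normsqB_le2.
have p1 := eta_gt0; have p2 := rho_gt0; have p3 := rho_small.
rewrite /inner_err /inner_dist /rate_err /lam_err.
have d1 := dev_ge0 (in_w st); have d2 := dev_ge0 (in_s st).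
have d3 := normsq_ge0 (in_v st - mu); have d4 := normsq_ge0 (in_v (step B st) - mu).
have d5 := dev_ge0 w0.
have d6 : 0 <= m%:R * normsq (row_mean (in_w st) - row_mean w0).
  by rewrite mulr_ge0 ?normsq_ge0 // ltW.
have d7 := dev_ge0 (in_s (step B st)).
move: (dev (in_w (step _ _))) (dev (in_s (step _ _))) hw hs d7 h1 d4 => U' S'.
move: (normsq (in_v (step _ _) - mu)) => V'.
move: (normsq (in_w st - w0)) h2 d1 d2 d3 d5 d6 => N.
move: (dev (in_w st)) (dev (in_s st)) (normsq (in_v st - mu)) (dev w0) => U S V U0.
move: (m%:R * _) => D h2 U_0 S_0 V_0 U0_0 D_0 hw hs S'_0 h1 V'_0.
have e2 : 0 <= eta ^+ 2 by rewrite sqr_ge0.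
have hV : eta ^+ 2 * V' <= 3 * (2 * eta ^+ 2 * l2 ^+ 2) * (U + U0 + D).
  apply: (@le_trans _ _ (eta ^+ 2 * (2 * l2 ^+ 2 * N))); first by rewrite ler_wpM2l.
  apply: (@le_trans _ _ (eta ^+ 2 * (2 * l2 ^+ 2 * (3 * (U + U0 + D))))).
    by rewrite ler_wpM2l // ler_wpM2l // mulr_ge0 // sqr_ge0.
  rewrite le_eqVlt; apply/orP; left; apply/eqP; ring.
have hS := ler_wpM2l e2 hs.
have sc (x : R) : eta ^+ 2 * (rho ^+ 2 * (3 * x)) = rho ^+ 2 * (3 * (eta ^+ 2 * x)) by ring.
rewrite sc !mulrDr in hS.
have {}S_0 : 0 <= eta ^+ 2 * S by rewrite mulr_ge0.
have {}V_0 : 0 <= eta ^+ 2 * V by rewrite mulr_ge0.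
have {}V'_0 : 0 <= eta ^+ 2 * V' by rewrite mulr_ge0.
have {}S'_0 : 0 <= eta ^+ 2 * S' by rewrite mulr_ge0.
have lam0 : 0 <= 2 * eta ^+ 2 * l2 ^+ 2 by rewrite mulr_ge0 ?sqr_ge0 // mulr_ge0.
move: (2 * eta ^+ 2 * l2 ^+ 2) hV lam0 => La.
move: (eta ^+ 2 * S') (eta ^+ 2 * V') (eta ^+ 2 * S) (eta ^+ 2 * V) hS S_0 V_0 V'_0 S'_0 hw.
move=> {hs S' h1 S V V'} S' V' S V hS S_0 V_0 V'_0 S'_0 hw hV lam0.
(* FastMix provides [rho ^+ 2]: one factor remains as the rate, the other, at most 1/10, absorbs the
   numerical constants. *)
have r2 : 10 * rho ^+ 2 <= rho by rewrite expr2 mulrA ler_piMl // ltW.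
have r20 : 0 <= rho ^+ 2 by rewrite sqr_ge0.
have a1 : 10 * rho ^+ 2 * U <= rho * U by rewrite ler_wpM2r.
have a2 : 10 * rho ^+ 2 * S' <= S'.
  by rewrite -[leRHS]mul1r ler_wpM2r //; lra.
have a3 : 10 * rho ^+ 2 * S <= rho * S by rewrite ler_wpM2r.
have a4 : 10 * rho ^+ 2 * V' <= rho * V' by rewrite ler_wpM2r.
have a5 : rho * V' <= rho * (3 * La * (U + U0 + D)) by rewrite ler_wpM2l // ltW.
have a6 : 0 <= rho * La * (S + rho * V).
  by rewrite !mulr_ge0 // ?addr_ge0 // ?mulr_ge0 // ltW.
have a7 : 0 <= rho * (U0 + D) by rewrite mulr_ge0 ?addr_ge0 // ltW.
have a8 : 0 <= rho * U by rewrite mulr_ge0 // ltW.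
have a9 : 0 <= rho * S by rewrite mulr_ge0 // ltW.
have a10 : 0 <= rho ^+ 2 * V by rewrite mulr_ge0.
have a11 : 0 <= rho * V' by rewrite mulr_ge0 // ltW.
have E : rho * (4 + 6 * La) * (U + S + rho * V + U0 + D) =
   4 * (rho * U) + 4 * (rho * S) + 4 * (rho ^+ 2 * V) + 4 * (rho * (U0 + D))
   + 2 * (rho * (3 * La * (U + U0 + D))) + 6 * (rho * La * (S + rho * V)) by ring.
rewrite E.
lra.
Qed.

(** The Markov operator of an inner step: conditional expectation of [g] at the next state, given
    the current one. *)
Definition inner_op (g : inner_state R m d -> R) st : R :=
  batch_avg (fun B => g (step B st)).

Definition value (x : 'rV[R]_d) : R := f_global fc x + fine (psi x).

Let bias st : 'rV[R]_d := m%:R^-1 *: \sum_(i < m)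
  (grad (f_local fc i) (row i (in_w st)) - grad (f_local fc i) (row_mean (in_w st))).

Let Xi st (a : 'I_m * 'I_b) (j : 'I_n) : 'rV[R]_d :=
  grad (fc a.1 j) (row a.1 (in_w st)) - grad (fc a.1 j) (row a.1 w0).

Let xi st a j := Xi st a j - n%:R^-1 *: \sum_j' Xi st a j'.

Let xi_centered st a : \sum_j xi st a j = 0.
Proof.
rewrite /xi sumrB sumr_const card_ord -[(_ *: _) *+ n]scaler_nat scalerA.
by rewrite mulfV ?scale1r ?subrr // lt0r_neq0.
Qed.

(** By [mu_mean] the mean of [mu] cancels the expected reference gradients. What remains is the
    error of evaluating gradients at the rows rather than at their mean, plus a centered sum over
    the draws. *)
Let noiseE B st :
  row_mean (in_v (step B st)) - grad (f_global fc) (row_mean (in_w st)) =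
  bias st + (m%:R * b%:R)^-1 *: \sum_a xi st a (B a).
Proof.
have mn := lt0r_neq0 m_pos; have bn := lt0r_neq0 b_pos.
have gl i x : n%:R^-1 *: \sum_(j < n) grad (fc i j) x = grad (f_local fc i) x.
  by rewrite grad_f_local.
pose G i := grad (f_local fc i) (row i (in_w st)) - grad (f_local fc i) (row i w0).
have -> : \sum_a xi st a (B a) =
    \sum_i \sum_l Xi st (i, l) (B (i, l)) - b%:R *: \sum_i G i.
  rewrite /xi sumrB; congr (_ - _); first by rewrite pair_bigA; apply: eq_bigr => -[].
  rewrite scaler_sumr (eq_bigr (fun a : 'I_m * 'I_b => G a.1)).
    rewrite -(pair_bigA _ (fun i (l : 'I_b) => G i)) /=; apply: eq_bigr => i _.
    by rewrite sumr_const card_ord scaler_nat.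
  by move=> a _; rewrite /Xi sumrB scalerBr !gl.
rewrite row_meanE (eq_bigr (fun i => row i mu + b%:R^-1 *: \sum_l Xi st (i, l) (B (i, l)))).
  rewrite big_split /= scalerDr -row_meanE mu_mean row_meanE -scaler_sumr.
  rewrite grad_f_global // /bias.
  have -> : \sum_i row i (local_grads fc w0) = \sum_i grad (f_local fc i) (row i w0).
    by apply: eq_bigr => i _; exact: rowK.
  rewrite /G !sumrB.
  have alg (S S1 S2 S3 : 'rV[R]_d) : m%:R^-1 *: S3 + m%:R^-1 *: (b%:R^-1 *: S)
     - m%:R^-1 *: S2 = m%:R^-1 *: (S1 - S2) + (m%:R * b%:R)^-1 *: (S - b%:R *: (S1 - S3)).
    by apply/rowP => k; rewrite !mxE; field; rewrite mn bn.
  exact: alg.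
by move=> i _; rewrite rowK.
Qed.

Let avg_noise_inner st (y : 'rV[R]_d) :
  batch_avg (fun B => inner (row_mean (in_v (step B st))
    - grad (f_global fc) (row_mean (in_w st))) y) = inner (bias st) y.
Proof.
rewrite (@batch_avg_ext _ _ _ _ (fun B => inner (bias st) y +
   (m%:R * b%:R)^-1 * inner y (\sum_a xi st a (B a)))); last first.
  by move=> B; rewrite noiseE innerDl (innerZl (m%:R * b%:R)^-1) (innerC y).
rewrite batch_avgD batch_avg_cst // batch_avgZ batch_avg_inner_centered //.
by rewrite mulr0 addr0.
Qed.

Let avg_noise_normsq st :
  batch_avg (fun B => normsq (row_mean (in_v (step B st))
    - grad (f_global fc) (row_mean (in_w st)))) <= normsq (bias st)
  + ((m%:R * b%:R)^-1 ^+ 2 * (b%:R * (n%:R^-1 * \sum_i \sum_j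
      normsq (grad (fc i j) (row i (in_w st)) - grad (fc i j) (row i w0))))).
Proof.
rewrite (@batch_avg_ext _ _ _ _ (fun B => normsq (bias st) +
   ((m%:R * b%:R)^-1 * 2 * inner (bias st) (\sum_a xi st a (B a)) +
    (m%:R * b%:R)^-1 ^+ 2 * normsq (\sum_a xi st a (B a))))); last first.
  move=> B; rewrite noiseE normsqD (innerZr (m%:R * b%:R)^-1) (normsqZ (m%:R * b%:R)^-1); ring.
rewrite !batch_avgD batch_avg_cst // !batch_avgZ batch_avg_inner_centered //.
rewrite mulr0 add0r batch_avg_normsq_centered // lerD2l.
rewrite ler_pM2l ?exprn_gt0 ?invr_gt0 ?mulr_gt0 //.
apply: (@le_trans _ _ (\sum_(a : 'I_m * 'I_b) n%:R^-1 * \sum_j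
    normsq (grad (fc a.1 j) (row a.1 (in_w st)) - grad (fc a.1 j) (row a.1 w0)))).
  apply: ler_sum => a _; rewrite ler_pM2l ?invr_gt0 //.
  (* The vectors [Xi st a j] are stacked as rows, so that the variance is a [dev] and the second
     moment a [normsq]. *)
  have := dev_le_normsq n_gt0 (\matrix_(j < n) Xi st a j).
  rewrite /dev normsq_rows row_meanE.
  under [X in X <= _ -> _]eq_bigr do rewrite rowK.
  under [X in _ <= X -> _]eq_bigr do rewrite rowK.
  by under [X in _ *: X]eq_bigr do rewrite rowK.
rewrite -(pair_bigA _ (fun i (l : 'I_b) => n%:R^-1 * \sum_j
    normsq (grad (fc i j) (row i (in_w st)) - grad (fc i j) (row i w0)))) /=.
rewrite !mulr_sumr; apply: ler_sum => i _.
by rewrite sumr_const card_ord mulr_natl.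
Qed.

Let normsq_bias st :
  normsq (bias st) <= m%:R^-1 * (2 * l2 ^+ 2 * dev (in_w st)).
Proof.
rewrite /bias normsqZ.
apply: (@le_trans _ _ (m%:R^-1 ^+ 2 * (m%:R * (2 * l2 ^+ 2 * dev (in_w st))))).
  rewrite ler_pM2l ?exprn_gt0 ?invr_gt0 //; apply: le_trans (normsq_sum_le _ _) _.
  rewrite card_ord ler_pM2l // mulr_sumr; apply: ler_sum => i _.
  apply: (two_sided_lipschitz l1_gt0 l1_le_l2).
  exact: two_sided_f_local.
rewrite le_eqVlt; apply/orP; left; apply/eqP; field.
by rewrite lt0r_neq0.
Qed.

(** Summed over all components, the inner products in the cocoercivity bounds are [m * n] times the
    one of [f], nonnegative because the gradient of a convex function is monotone. Only [l1 * l2]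
    survives; this is where the global convexity makes up for nonconvex components. *)
Lemma sum_grad_diff (x y : 'rV[R]_d) :
  \sum_i \sum_j normsq (grad (fc i j) x - grad (fc i j) y) <=
  m%:R * (n%:R * (l1 * l2 * normsq (x - y))).
Proof.
have two := two_sided_f_global fc_diff m_gt0 n_gt0 fc_smooth.
have mono : 0 <= inner (grad (f_global fc) x - grad (f_global fc) y) (x - y).
  have h1 := convex_gradient_le x y two f_convex.
  have h2 := convex_gradient_le y x two f_convex.
  move: h1; rewrite -opprB innerNr innerBl; lra.
have E : \sum_i \sum_j inner (grad (fc i j) x - grad (fc i j) y) (x - y) =
   m%:R * (n%:R * inner (grad (f_global fc) x - grad (f_global fc) y) (x - y)).
  rewrite !grad_f_global // -scalerBr innerZl -sumrB inner_suml.
  rewrite mulrCA mulVKf ?lt0r_neq0 // mulr_sumr; apply: eq_bigr => i _.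
  rewrite !grad_f_local // -scalerBr innerZl -sumrB inner_suml.
  by rewrite mulVKf ?lt0r_neq0.
apply: (@le_trans _ _ (\sum_(i < m) \sum_(j < n) (l1 * l2 * normsq (x - y)
   - (l2 - l1) * inner (grad (fc i j) x - grad (fc i j) y) (x - y)))).
  by apply: ler_sum => i _; apply: ler_sum => j _; apply: two_sided_cocoercive.
have c0 : 0 <= (l2 - l1) * (m%:R * (n%:R * inner (grad (f_global fc) x - grad (f_global fc) y) (x - y))).
  by rewrite !mulr_ge0 // ?subr_ge0.
rewrite -E in c0; move: (l1 * l2 * _) (l2 - l1) c0 => c k c0.
rewrite (eq_bigr (fun i => n%:R * c - k * \sum_(j < n)
    inner (grad (fc i j) x - grad (fc i j) y) (x - y))) => [|i _]; last first.
  by rewrite sumrB sumr_const card_ord -[c *+ n]mulr_natl mulr_sumr.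
rewrite sumrB sumr_const card_ord -[(_ * c) *+ m]mulr_natl.
by rewrite -mulr_sumr gerBl.
Qed.

(** Monotonicity of the averaged gradient needs the same two points for all agents, so the rows are
    first replaced by their means at the cost of deviations. *)
Let sum_component_diff st :
  \sum_i \sum_j normsq (grad (fc i j) (row i (in_w st)) - grad (fc i j) (row i w0))
  <= 3 * (m%:R * (n%:R * (l1 * l2 * inner_dist st))
      + n%:R * (2 * l2 ^+ 2 * (dev (in_w st) + dev w0))).
Proof.
set wm := row_mean (in_w st); set wm0 := row_mean w0.
apply: (@le_trans _ _ (\sum_i \sum_j 3 * (normsq (grad (fc i j) wm - grad (fc i j) wm0)
   + (2 * l2 ^+ 2 * normsq (row i (in_w st) - wm) + 2 * l2 ^+ 2 * normsq (row i w0 - wm0))))).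
  apply: ler_sum => i _; apply: ler_sum => j _.
  set x := row i _; set y := row i w0.
  have -> : grad (fc i j) x - grad (fc i j) y =
     (grad (fc i j) wm - grad (fc i j) wm0) + (grad (fc i j) x - grad (fc i j) wm)
     + (- (grad (fc i j) y - grad (fc i j) wm0)).
    by apply/rowP => k; rewrite !mxE; ring.
  apply: le_trans (normsqD_le3 _ _ _) _.
  rewrite normsqN addrA ler_pM2l // !lerD //;
  exact: (two_sided_lipschitz l1_gt0 l1_le_l2).
under eq_bigr do rewrite -mulr_sumr big_split /= sumr_const card_ord.
rewrite -mulr_sumr ler_pM2l // big_split /=.
apply: lerD; first exact: sum_grad_diff.
by rewrite [n%:R * _]mulr_natl mulrDr /dev !mulr_sumr -big_split /= -sumrMnl.
Qed.

Definition err_coef (a : R) : R := 1 + 4 * lam_err + eta * l2 ^+ 2 / a.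

(** Used with [u] the reference point and with [u] the minimizer. The bias of the estimator is
    paired with [u - wm] by Young's inequality of weight [a]: one half is paid later by the growth
    of the objective or by the telescoping gain, the other is a consensus error and produces the
    last term of [err_coef]. *)
Lemma inner_descent (u : 'rV[R]_d) (a : R) st :
  inner_inv st -> psi u \is a fin_num -> 0 < a -> 4 * (eta * L) <= 1 ->
  rate_err <= 1 ->
  inner_op (fun st' => value (row_mean (in_w st'))) st - value u <=
    (2 * eta)^-1 * (normsq (u - row_mean (in_w st))
      - inner_op (fun st' => normsq (u - row_mean (in_w st'))) st)
    + a / 2 * normsq (u - row_mean (in_w st))
    + (3 * eta * (l1 * l2) / b%:R + rate_err / (2 * eta)) * inner_dist st
    + err_coef a / (eta * m%:R) * (inner_err st + dev w0).
Proof.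
move=> inv du a0 etaL rle1.
have p1 := eta_gt0; have p2 := m_pos; have p3 := b_pos; have p4 := n_pos.
have two := two_sided_f_global fc_diff m_gt0 n_gt0 fc_smooth.
set wm := row_mean (in_w st).
pose dl B := row_mean (in_v (step B st)) - grad (f_global fc) wm.
pose z B := row_mean (in_w (step B st)).
have err0 : 0 <= inner_err st + dev w0 + m%:R * inner_dist st.
  rewrite !addr_ge0 ?mulr_ge0 ?addr_ge0 ?sqr_ge0 ?dev_ge0 ?normsq_ge0 //; exact: ltW.
have main B : value (z B) - value u <=
    ((2 * eta)^-1 * normsq (u - wm)
    + (2 * eta * m%:R)^-1 * (dev (in_w st) + rate_err * (inner_err st + dev w0 + m%:R * inner_dist st)))
    + (- (2 * eta)^-1) * normsq (u - z B)
    + (eta * normsq (dl B) + inner (dl B) (u - wm)).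
  have := @prox_step R d psi psi_proper psi_convex m eta m_gt0 eta_gt0
     (fun x => prox_exists x eta_gt0) (in_w st) (in_s (step B st)) u du.
  have zE : row_mean (prox (m%:R * eta) (@Psi R m d psi) (in_w st - eta *: in_s (step B st))) = z B.
    by rewrite /z {2}/inner_step /= mix_mean.
  rewrite zE.
  have -> : row_mean (in_s (step B st)) = row_mean (in_v (step B st)).
    by have [] := inner_inv_step B inv.
  have herr := inner_err_step B inv.
  have hs : eta ^+ 2 * dev (in_s (step B st)) <= inner_err (step B st).
    rewrite /inner_err -addrA addrCA lerDl addr_ge0 ?dev_ge0 //.
    by rewrite !mulr_ge0 ?sqr_ge0 ?normsq_ge0 // ltW.
  have hq : (2 * eta * m%:R)^-1 * (dev (in_w st) + eta ^+ 2 * dev (in_s (step B st)))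
     <= (2 * eta * m%:R)^-1 * (dev (in_w st) + rate_err * (inner_err st + dev w0 + m%:R * inner_dist st)).
    rewrite ler_pM2l ?invr_gt0 ?mulr_gt0 // lerD2l; exact: le_trans hs herr.
  have f1 := convex_smooth_descent wm (z B) two f_convex L_ge0 f_smooth.
  have f2 := convex_gradient_le wm u two f_convex.
  have y := @young _ _ _ (2 * eta) (dl B) (wm - z B).
  have e1 : inner (row_mean (in_v (step B st))) (u - z B) =
     inner (dl B) (u - wm) + inner (dl B) (wm - z B)
      + inner (grad (f_global fc) wm) (u - wm) - inner (grad (f_global fc) wm) (z B - wm).
    rewrite -innerDr; have -> : u - wm + (wm - z B) = u - z B by rewrite addrA subrK.
    rewrite /dl innerBl -[X in _ = X]addrA -innerBr.
    have -> : u - wm - (z B - wm) = u - z B by rewrite opprB addrA subrK.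
    by rewrite subrK.
  rewrite e1 -/wm.
  rewrite (normsq_sym wm (z B)) in y.
  (* The proximal inequality supplies [- (2 * eta)^-1 * |z - wm|^2]; half of it absorbs this noise
     term and half the smoothness term [h3]. *)
  have y' : inner (dl B) (wm - z B) <= eta * normsq (dl B) + (4 * eta)^-1 * normsq (z B - wm).
    apply: le_trans (y _) _; first by rewrite mulr_gt0.
    rewrite le_eqVlt; apply/orP; left; apply/eqP; field.
    by rewrite lt0r_neq0.
  have h3 : L * normsq (z B - wm) <= (4 * eta)^-1 * normsq (z B - wm).
    rewrite ler_wpM2r ?normsq_ge0 // -[X in _ <= X]mul1r ler_pdivlMr ?mulr_gt0 //; lra.
  have e4 : (2 * eta)^-1 = (4 * eta)^-1 + (4 * eta)^-1 :> R by field; rewrite lt0r_neq0.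
  rewrite /value; move: hq.
  rewrite !e4.
  move: (_^-1 * (dev _ + eta ^+ 2 * dev _)) (_^-1 * (dev _ + rate_err * _)) => E1 E2.
  move: (normsq (u - wm)) (normsq (u - z B)) (normsq (z B - wm)) f1 y' h3 => N1 N2 N3 f1 y' h3.
  move: (inner (dl B) _) (inner (dl B) _) (eta * normsq _) y' => I1 I2 DD y'.
  move: (inner (grad _ _) _) (inner (grad _ _) _) f1 f2 => J1 J2 f1 f2 hq.
  rewrite !mulrBr; lra.
have := batch_avg_affine_le n_gt0 main.
rewrite /dl avg_noise_inner -/wm.
have hvar := avg_noise_normsq st; rewrite -/wm in hvar.
have hb := normsq_bias st; have hc := sum_component_diff st.
have hyb := @young _ _ _ a (u - wm) (bias st) a0.
rewrite innerC in hyb.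
have -> : inner_op (fun st' => normsq (u - row_mean (in_w st'))) st =
   batch_avg (fun B => normsq (u - z B)) by [].
have -> : inner_op (fun st' => value (row_mean (in_w st'))) st =
   batch_avg (fun B => value (z B)) by [].
have hdev : dev (in_w st) <= inner_err st.
  rewrite /inner_err -addrA lerDl addr_ge0 ?mulr_ge0 ?sqr_ge0 ?dev_ge0 ?normsq_ge0 //;
  exact: ltW.
have dw0 := dev_ge0 (in_w st); have dw00 := dev_ge0 w0.
have dist0 : 0 <= inner_dist st by exact: normsq_ge0.
move: hvar; move: (batch_avg (fun B => normsq (_ - grad _ _))) => V.
move: (\sum_i \sum_j _) hc => S hc hvar.
move: (batch_avg _) (batch_avg _) => A1 A2.
move: (normsq (bias st)) (inner (bias st) _) hb hvar hyb => nb ib hb hvar hyb.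
move: (normsq (u - wm)) hyb => N hyb.
rewrite /err_coef /lam_err.
move: rate_err rle1 => r rle1.
move: (inner_dist st) (inner_err st) (dev (in_w st)) (dev w0) hdev dw0 dw00 dist0 err0 hb hc => D Q U U0 hdev dw0 dw00 dist0 err0 hb hc.
have m1 : 1 <= m%:R :> R by rewrite ler1n.
have b1 : 1 <= b%:R :> R by rewrite ler1n.
move: (m%:R) (b%:R) (n%:R) m1 b1 p2 p3 p4 err0 hb hc hvar => m' b' n' m1 b1 p2 p3 p4 err0 hb hc hvar hA.
have en := lt0r_neq0 p1; have mn := lt0r_neq0 p2; have bn := lt0r_neq0 p3; have nn := lt0r_neq0 p4.
have an := lt0r_neq0 a0.
(* In the main variance term the gain [1 / m] from averaging over the agents is given up. *)
have hV : V <= m'^-1 * (2 * l2 ^+ 2 * U) + (3 * (l1 * l2) / b' * D + 6 * l2 ^+ 2 / m' * (U + U0)).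
  apply: le_trans hvar _; apply: lerD => //.
  apply: (@le_trans _ _ ((m' * b')^-1 ^+ 2 * (b' * (n'^-1 *
     (3 * (m' * (n' * (l1 * l2 * D)) + n' * (2 * l2 ^+ 2 * (U + U0)))))))).
    rewrite ler_pM2l ?exprn_gt0 ?invr_gt0 ?mulr_gt0 // ler_pM2l // ler_pM2l ?invr_gt0 //.
  have -> : (m' * b')^-1 ^+ 2 * (b' * (n'^-1 *
     (3 * (m' * (n' * (l1 * l2 * D)) + n' * (2 * l2 ^+ 2 * (U + U0)))))) =
     m'^-1 * (3 * (l1 * l2) / b' * D) + b'^-1 * m'^-1 * (6 * l2 ^+ 2 / m' * (U + U0)).
    by field; rewrite mn bn nn.
  have lpos := l1_gt0; have lle := l1_le_l2.
  have mi : m'^-1 <= 1 by rewrite invf_le1.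
  have bi : b'^-1 <= 1 by rewrite invf_le1.
  apply: lerD; rewrite ler_piMl //.
  - by rewrite !mulr_ge0 ?invr_ge0 //; lra.
  - by rewrite !mulr_ge0 ?addr_ge0 ?invr_ge0 ?sqr_ge0 //; lra.
  - by rewrite -[1]mulr1 ler_pM ?invr_ge0 //; lra.
have heV : eta * V <= eta * (m'^-1 * (2 * l2 ^+ 2 * U) + (3 * (l1 * l2) / b' * D + 6 * l2 ^+ 2 / m' * (U + U0))).
  by rewrite ler_pM2l.
have hb' : (2 * a)^-1 * nb <= (2 * a)^-1 * (m'^-1 * (2 * l2 ^+ 2 * U)).
  by rewrite ler_pM2l ?invr_gt0 ?mulr_gt0.
have c0 : 0 <= (eta * m')^-1 by rewrite invr_ge0 mulr_ge0 // ltW.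
have key : (2 * eta * m')^-1 * (U + r * (Q + U0 + m' * D)) +
    eta * (m'^-1 * (2 * l2 ^+ 2 * U) + (3 * (l1 * l2) / b' * D + 6 * l2 ^+ 2 / m' * (U + U0)))
    + (2 * a)^-1 * (m'^-1 * (2 * l2 ^+ 2 * U)) =
    (3 * eta * (l1 * l2) / b' + r / (2 * eta)) * D +
    (eta * m')^-1 * (U / 2 + r / 2 * (Q + U0) + 2 * eta ^+ 2 * l2 ^+ 2 * U
       + 6 * eta ^+ 2 * l2 ^+ 2 * (U + U0) + eta * l2 ^+ 2 / a * U).
  by field; rewrite en mn bn an.
have fin : U / 2 + r / 2 * (Q + U0) + 2 * eta ^+ 2 * l2 ^+ 2 * U
       + 6 * eta ^+ 2 * l2 ^+ 2 * (U + U0) + eta * l2 ^+ 2 / a * U <=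
      (1 + 4 * (2 * eta ^+ 2 * l2 ^+ 2) + eta * l2 ^+ 2 / a) * (Q + U0).
  have g1 : 0 <= eta ^+ 2 * l2 ^+ 2 by rewrite mulr_ge0 ?sqr_ge0.
  have g2 : 0 <= eta * l2 ^+ 2 / a.
    by rewrite divr_ge0 ?(ltW a0) // mulr_ge0 ?sqr_ge0 // ltW.
  have h1 : r / 2 * (Q + U0) <= 1 / 2 * (Q + U0).
    by rewrite ler_wpM2r ?addr_ge0 //; lra.
  have h2 : eta ^+ 2 * l2 ^+ 2 * U <= eta ^+ 2 * l2 ^+ 2 * Q by rewrite ler_wpM2l.
  have h3 : eta * l2 ^+ 2 / a * U <= eta * l2 ^+ 2 / a * Q by rewrite ler_wpM2l.
  have h4 : 0 <= eta ^+ 2 * l2 ^+ 2 * U0 by rewrite mulr_ge0.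
  have h5 : 0 <= eta * l2 ^+ 2 / a * U0 by rewrite mulr_ge0.
  lra.
have := ler_wpM2l c0 fin.
have -> : (eta * m')^-1 * ((1 + 4 * (2 * eta ^+ 2 * l2 ^+ 2) + eta * l2 ^+ 2 / a) * (Q + U0))
  = (1 + 4 * (2 * eta ^+ 2 * l2 ^+ 2) + eta * l2 ^+ 2 / a) / (eta * m') * (Q + U0).
  by rewrite [LHS]mulrCA [LHS]mulrA.
move: (_ / (eta * m') * (Q + U0)) (_^-1 * (U / 2 + _ + _ + _ + _)) key => E1 E2 key hE.
move: heV hb' key hA hyb.
move: (eta * (_ + _)) => X1; move: (_^-1 * (_ * (2 * l2 ^+ 2 * U))) => X2.
move: (_^-1 * (U + _)) => X3; move: ((_ + _) * D) => X4.
move: ((2 * a)^-1 * nb) ((2 * eta)^-1) => X5 X6 heV hb' key hA hyb.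
rewrite mulrBr; lra.
Qed.

End FixedReference.

Section InnerIteration.
Variables mu w0 : 'M[R]_(m, d).
Hypothesis mu_mean : row_mean mu = row_mean (local_grads fc w0).
Local Notation K := (inner_op mu w0).
Implicit Types (g h : inner_state R m d -> R) (ist : inner_state R m d).

Definition inner_iter_op t g := iter t K g.

Lemma inner_iter_opS t g : inner_iter_op t.+1 g = inner_iter_op t (K g).
Proof. exact: iterSr. Qed.

Lemma inner_iter_opD t g h ist :
  inner_iter_op t (g \+ h) ist = inner_iter_op t g ist + inner_iter_op t h ist.
Proof.
elim: t g h => // t IH g h; rewrite !inner_iter_opS -IH.
by congr inner_iter_op; apply/funext => x; rewrite /inner_op /= batch_avgD.
Qed.

Lemma inner_iter_opZ t c g ist :
  inner_iter_op t (fun x => c * g x) ist = c * inner_iter_op t g ist.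
Proof.
elim: t g => // t IH g; rewrite !inner_iter_opS -IH.
by congr inner_iter_op; apply/funext => x; rewrite /inner_op /= batch_avgZ.
Qed.

Lemma inner_iter_op_cst t c ist : inner_iter_op t (fun=> c) ist = c.
Proof.
elim: t => // t IH; rewrite inner_iter_opS -[RHS]IH.
by congr inner_iter_op; apply/funext => x; rewrite /inner_op batch_avg_cst.
Qed.

Lemma inner_iter_op_le t g h : (forall ist, inner_inv ist -> g ist <= h ist) ->
  forall ist, inner_inv ist -> inner_iter_op t g ist <= inner_iter_op t h ist.
Proof.
move=> gh; elim: t => // t IH ist inv; rewrite /inner_iter_op !iterS.
by apply: batch_avg_le => B; apply: IH; exact: inner_inv_step.
Qed.

Lemma inner_iter_op_ge0 t g : (forall ist, inner_inv ist -> 0 <= g ist) ->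
  forall ist, inner_inv ist -> 0 <= inner_iter_op t g ist.
Proof.
move=> g0 ist inv; rewrite -(inner_iter_op_cst t 0 ist).
exact: inner_iter_op_le.
Qed.

Let lin2 t (c1 c2 U0 : R) x y ist :
  inner_iter_op t (fun i => c1 * (x i + U0 + c2 * y i)) ist =
  c1 * (inner_iter_op t x ist + U0 + c2 * inner_iter_op t y ist).
Proof.
rewrite -[in RHS](inner_iter_op_cst t U0 ist) -inner_iter_opZ.
by rewrite -[inner_iter_op t x ist + _]inner_iter_opD -inner_iter_opD -inner_iter_opZ.
Qed.

Let lin4 t (v c1 c2 c3 c4 U0 : R) x y u z w ist :
  inner_iter_op t (fun i => v + (c1 * (x i + -1 * y i) + c2 * u i + c3 * z i + c4 * (w i + U0))) ist =
  v + (c1 * (inner_iter_op t x ist + -1 * inner_iter_op t y ist) + c2 * inner_iter_op t u ist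
    + c3 * inner_iter_op t z ist + c4 * (inner_iter_op t w ist + U0)).
Proof.
rewrite -{2}(inner_iter_op_cst t U0 ist) -{2}(inner_iter_op_cst t v ist).
rewrite -[inner_iter_op t w ist + _]inner_iter_opD -(inner_iter_opZ t (-1)).
rewrite -[inner_iter_op t x ist + _]inner_iter_opD -!inner_iter_opZ.
by rewrite -!inner_iter_opD.
Qed.

Lemma inner_err_iter t ist : inner_inv ist ->
  inner_iter_op t.+1 (inner_err mu) ist <=
  rate_err * (inner_iter_op t (inner_err mu) ist + dev w0
              + m%:R * inner_iter_op t (inner_dist w0) ist).
Proof.
move=> inv; rewrite inner_iter_opS -lin2; apply: inner_iter_op_le => // i ii.
rewrite -[leRHS](batch_avg_cst ('I_m * 'I_b)%type n_gt0).
by apply: batch_avg_le => B; exact: inner_err_step.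
Qed.

Lemma inner_value_iter t (u : 'rV[R]_d) (a v : R) ist : inner_inv ist ->
  psi u \is a fin_num -> 0 < a -> 4 * (eta * L) <= 1 -> rate_err <= 1 ->
  inner_iter_op t.+1 (fun i => value (row_mean (in_w i)) - v) ist <=
    value u - v
    + ((2 * eta)^-1 * (inner_iter_op t (fun i => normsq (u - row_mean (in_w i))) ist
      + -1 * inner_iter_op t.+1 (fun i => normsq (u - row_mean (in_w i))) ist)
    + a / 2 * inner_iter_op t (fun i => normsq (u - row_mean (in_w i))) ist
    + (3 * eta * (l1 * l2) / b%:R + rate_err / (2 * eta)) * inner_iter_op t (inner_dist w0) ist
    + err_coef a / (eta * m%:R) * (inner_iter_op t (inner_err mu) ist + dev w0)).
Proof.
move=> inv du a0 eL r1; rewrite !inner_iter_opS -lin4.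
apply: inner_iter_op_le => // i ii.
have h := inner_descent mu_mean ii du a0 eL r1.
have -> : K (fun i => value (row_mean (in_w i)) - v) i =
   K (fun i => value (row_mean (in_w i))) i - v.
  by rewrite /inner_op batch_avgD batch_avg_cst.
by rewrite mulN1r addrAC lerD2r -lerBlDl.
Qed.

End InnerIteration.

(** * Epochs and runs as operators; potentials *)

Section EpochOperator.
Variables (sigma p : R) (xstar : 'rV[R]_d).
Hypotheses (p_gt0 : 0 < p) (p_le1 : p <= 1).
Hypotheses (sigma_gt0 : 0 < sigma).
Hypothesis xstar_fin : psi xstar \is a fin_num.
Hypothesis growth : forall x, psi x \is a fin_num ->
  sigma / 2 * normsq (xstar - x) <= value x - value xstar.
Hypotheses (eta_L : 4 * (eta * L) <= 1) (eta_sigma : eta * sigma <= 1)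
  (eta_l : 48 * (eta ^+ 2 * (l1 * l2)) <= 1).
(** The Young weight is the largest one satisfying the hypothesis [a_sig] of [epoch_optimum]. *)
Let coef : R := err_coef (p * sigma / 50).
Hypothesis rate_small : 1000 * (rate_err * coef) <= p.
Hypothesis b_large : 1 <= p * b%:R.

Implicit Types (st : outer_state R m d) (g h : outer_state R m d -> R).

Definition tracker st : 'M[R]_(m, d) :=
  fastmix W M (out_s st + local_grads fc (out_y st) - local_grads fc (out_yprev st)).

Definition inner_start st : inner_state R m d :=
  InnerState (out_y st) (tracker st) (tracker st).

Definition close_epoch st (ist : inner_state R m d) : outer_state R m d :=
  OuterState (out_y st) (in_w ist) (tracker st).

(* The expectation of [g] after one epoch started at [st], on the event [T < N]:
   truncation keeps every expectation a finite sum, and [N] is sent to infinity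
   only in [expected_state_le]. *)
Definition epoch_op N g st : R :=
  geo_sum p N (fun t => inner_iter_op (tracker st) (out_y st) t.+1
                          (g \o close_epoch st) (inner_start st)).

(** The tracking invariant across epochs. It refers to the previous iterate because [out_s] is
    corrected by the latest gradient difference only in [tracker]. *)
Definition outer_inv st : Prop :=
  row_mean (out_s st) = row_mean (local_grads fc (out_yprev st)) /\
  psi (row_mean (out_y st)) \is a fin_num.

Lemma tracker_mean st : outer_inv st ->
  row_mean (tracker st) = row_mean (local_grads fc (out_y st)).
Proof.
by move=> [h _]; rewrite mix_mean row_meanB row_meanD h addrAC subrr add0r.
Qed.

Lemma inner_start_inv st : outer_inv st -> inner_inv (inner_start st).
Proof. by case. Qed.

Lemma close_epoch_inv st ist : outer_inv st -> inner_inv ist ->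
  outer_inv (close_epoch st ist).
Proof. by move=> i1 [_ i2]; split => //=; exact: tracker_mean. Qed.

Lemma epoch_op_le N g h : (forall st, outer_inv st -> g st <= h st) ->
  forall st, outer_inv st -> epoch_op N g st <= epoch_op N h st.
Proof.
move=> gh st inv; apply: geo_sum_le => // t.
apply: inner_iter_op_le; last exact: inner_start_inv.
by move=> ist ii; apply: gh; exact: close_epoch_inv.
Qed.

Lemma epoch_opD N g h st : epoch_op N (g \+ h) st = epoch_op N g st + epoch_op N h st.
Proof.
rewrite -geo_sumD; congr geo_sum; apply/funext => t.
exact: inner_iter_opD.
Qed.

Lemma epoch_opZ N c g st : epoch_op N (fun x => c * g x) st = c * epoch_op N g st.
Proof.
rewrite -geo_sumZ; congr geo_sum; apply/funext => t.
exact: inner_iter_opZ.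
Qed.

Lemma epoch_op_ge0 N g : (forall st, outer_inv st -> 0 <= g st) ->
  forall st, outer_inv st -> 0 <= epoch_op N g st.
Proof.
move=> g0 st inv; apply: geo_sum_ge0 => // t.
apply: inner_iter_op_ge0; last exact: inner_start_inv.
by move=> ist ii; apply: g0; exact: close_epoch_inv.
Qed.

Definition gap st : R := value (row_mean (out_y st)) - value xstar.
Definition outer_err st : R := dev (out_y st) + eta ^+ 2 * dev (tracker st).
Definition opt_dist st : R := normsq (xstar - row_mean (out_y st)).
(** Scaled to be exactly the error term [4 * C * Q 0] of [epoch_descent] and [epoch_optimum]. *)
Definition track_pot st : R := 4 * (coef / (eta * m%:R)) * outer_err st.
Definition lyapunov st : R := gap st + 2 * track_pot st.
Definition energy st : R :=
  2 * gap st + 7 / 2 * track_pot st + p / (2 * eta) * opt_dist st.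

Lemma gap_ge0 st : outer_inv st -> 0 <= gap st.
Proof.
move=> [_ h]; apply: le_trans _ (growth h).
by rewrite mulr_ge0 ?normsq_ge0 // divr_ge0 // ltW.
Qed.

Let lam0 : 0 <= lam_err.
Proof. by rewrite /lam_err mulr_ge0 ?sqr_ge0 // mulr_ge0 ?sqr_ge0. Qed.

Let a_gt0 : 0 < p * sigma / 50. Proof. by rewrite divr_gt0 // mulr_gt0. Qed.

Let coef_ge1 : 1 <= coef.
Proof.
rewrite /coef /err_coef -addrA lerDl; apply: addr_ge0; first by rewrite mulr_ge0.
apply: divr_ge0; last exact: ltW.
by apply: mulr_ge0; [exact: ltW|exact: sqr_ge0].
Qed.

Let rate_ge0 : 0 <= rate_err.
Proof. by rewrite /rate_err mulr_ge0 ?ltW // ltr_wpDr // mulr_ge0. Qed.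

Let rate_1000 : 1000 * rate_err <= p.
Proof.
have h : rate_err <= rate_err * coef by rewrite ler_peMr.
have := rate_small; lra.
Qed.

Lemma outer_err_ge0 st : 0 <= outer_err st.
Proof.
apply: addr_ge0; first exact: dev_ge0.
by apply: mulr_ge0; [exact: sqr_ge0|exact: dev_ge0].
Qed.

Lemma track_pot_ge0 st : 0 <= track_pot st.
Proof.
have c0 : 0 <= coef := le_trans ler01 coef_ge1.
by rewrite mulr_ge0 ?outer_err_ge0 // mulr_ge0 // divr_ge0 // mulr_ge0 // ltW.
Qed.

Lemma opt_dist_le st : outer_inv st -> sigma / 2 * opt_dist st <= gap st.
Proof. by move=> [_ h]; exact: growth. Qed.

(* Over one epoch [lyapunov] does not increase and [energy] drops by about
   [lyapunov / 4].  As [energy <= (2 + p / (eta * sigma)) lyapunov], summing over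
   [O(1 + p / (eta * sigma))] epochs halves [lyapunov]. *)
Section OneEpoch.
Variables (N : nat) (st : outer_state R m d).
Hypothesis inv : outer_inv st.

Let y := out_y st.
Let mu := tracker st.
Let ist := inner_start st.
Let Dt t := inner_iter_op mu y t (fun i => value (row_mean (in_w i)) - value xstar) ist.
Let dt t := inner_iter_op mu y t (inner_dist y) ist.
Let Qt t := inner_iter_op mu y t (inner_err mu) ist.
Let St t := inner_iter_op mu y t (fun i => normsq (xstar - row_mean (in_w i))) ist.
Let a := p * sigma / 50.
Let Bc := 3 * eta * (l1 * l2) / b%:R + rate_err / (2 * eta).
Let Cc := coef / (eta * m%:R).
Let hat (x : nat -> R) := geo_sum p N (fun t => x t.+1).

Let ii : inner_inv ist. Proof. exact: inner_start_inv. Qed.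
Let mm : row_mean mu = row_mean (local_grads fc y). Proof. exact: tracker_mean. Qed.

Let rate_le1 : rate_err <= 1.
Proof. have h1 := rate_1000; have h2 := p_le1; have h3 := rate_ge0; lra. Qed.

Let inner_err_ge0 i : 0 <= inner_err mu i.
Proof.
by rewrite /inner_err !addr_ge0 ?mulr_ge0 ?dev_ge0 ?normsq_ge0 ?sqr_ge0 // ltW.
Qed.

Let Q0E : Qt 0 = outer_err st.
Proof. by rewrite /Qt /= /inner_err /= subrr normsq0 !mulr0 addr0. Qed.

Let d0E : dt 0 = 0.
Proof. by rewrite /dt /= /inner_dist subrr normsq0. Qed.

Let D_ge0 t : 0 <= Dt t.
Proof.
apply: inner_iter_op_ge0 => // i [_ h]; apply: le_trans _ (growth h).
by rewrite mulr_ge0 ?normsq_ge0 // divr_ge0 // ltW.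
Qed.

Let d_ge0 t : 0 <= dt t.
Proof. by apply: inner_iter_op_ge0 => // i _; exact: normsq_ge0. Qed.

Let Q_ge0 t : 0 <= Qt t.
Proof. by apply: inner_iter_op_ge0 => // i _. Qed.

Let S_ge0 t : 0 <= St t.
Proof. by apply: inner_iter_op_ge0 => // i _; exact: normsq_ge0. Qed.

Let C_ge0 : 0 <= Cc.
Proof. by rewrite divr_ge0 ?(le_trans ler01 coef_ge1) // mulr_ge0 // ltW. Qed.

Let B_ge0 : 0 <= Bc.
Proof.
have l10 := l1_gt0; have l12 := l1_le_l2; have e0 := eta_gt0.
by rewrite addr_ge0 // divr_ge0 // ?mulr_ge0 //; lra.
Qed.

Let Q_step t : Qt t.+1 <= rate_err * (Qt t + dev y + m%:R * dt t).
Proof. exact: inner_err_iter. Qed.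

Let D_step_ref t : Dt t.+1 - Dt 0 <=
  (2 * eta)^-1 * (dt t - dt t.+1) + a / 2 * dt t + Bc * dt t + Cc * (Qt t + dev y).
Proof.
have := @inner_value_iter mu y mm t (row_mean y) a (value xstar) ist ii (proj2 inv)
   a_gt0 eta_L rate_le1.
have -> : (fun i : inner_state R m d => normsq (row_mean y - row_mean (in_w i))) = inner_dist y.
  by apply/funext => i; rewrite normsq_sym.
rewrite mulN1r -/(dt t) -/(dt t.+1) -/(Qt t) -/(Dt t.+1) -/Bc -/coef -/Cc.
by rewrite -lerBlDl.
Qed.

Let D_step_opt t : Dt t.+1 <=
  (2 * eta)^-1 * (St t - St t.+1) + a / 2 * St t + Bc * dt t + Cc * (Qt t + dev y).
Proof.
have := @inner_value_iter mu y mm t xstar a (value xstar) ist ii xstar_fin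
   a_gt0 eta_L rate_le1.
rewrite subrr add0r mulN1r.
by rewrite -/(dt t) -/(St t) -/(St t.+1) -/(Qt t) -/(Dt t.+1) -/Bc -/coef -/Cc.
Qed.

Let S_le t : sigma / 2 * St t <= Dt t.
Proof.
rewrite /St -inner_iter_opZ; apply: inner_iter_op_le => // i [_ h].
exact: growth.
Qed.

Let a_le : a <= p / (8 * eta).
Proof.
have e0 := eta_gt0; have p0 := p_gt0; have es := eta_sigma.
rewrite /a ler_pdivlMr ?mulr_gt0 //.
have -> : p * sigma / 50 * (8 * eta) = p * (8 / 50 * (eta * sigma)) by field.
rewrite -[leRHS]mulr1 ler_pM2l //; lra.
Qed.

Let a_sig : 50 * a <= sigma * p.
Proof. by rewrite le_eqVlt; apply/orP; left; apply/eqP; rewrite /a; field. Qed.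

(** Here step size, batch size and mixing meet [p]. After multiplication by [8 * eta] the variance
    takes at most [p / 2], by [eta_l] and [b_large], and [rate_small] makes the consensus terms fit
    into the rest. *)
Let B_le : Bc + 2 * rate_err * m%:R * Cc <= p / (8 * eta).
Proof.
have e0 := eta_gt0; have p0 := p_gt0; have c1 := coef_ge1; have r0 := rate_ge0.
have rs := rate_small; have bl := b_large; have b0 := b_pos; have m0 := m_pos.
have el := eta_l.
rewrite ler_pdivlMr ?mulr_gt0 //.
have -> : (Bc + 2 * rate_err * m%:R * Cc) * (8 * eta) =
    24 * (eta ^+ 2 * (l1 * l2)) / b%:R + 4 * rate_err + 16 * (rate_err * coef).
  by rewrite /Bc /Cc; field; rewrite !lt0r_neq0.
have h1 : 24 * (eta ^+ 2 * (l1 * l2)) / b%:R <= p / 2.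
  rewrite ler_pdivrMr //; lra.
have h2 : rate_err <= rate_err * coef by rewrite ler_peMr.
lra.
Qed.

Let U0_le : dev y <= Qt 0.
Proof. by rewrite Q0E /outer_err lerDl mulr_ge0 ?dev_ge0 ?sqr_ge0. Qed.

Let r_half : 2 * rate_err <= 1.
Proof. have h1 := rate_1000; have h2 := p_le1; have h3 := rate_ge0; lra. Qed.

Let consensus_hat : hat Qt <= 4 * rate_err * Qt 0 + 2 * rate_err * m%:R * hat dt.
Proof.
exact: (@epoch_consensus _ _ p_gt0 p_le1 _ _ _ _ _ m_pos rate_ge0 r_half d_ge0 Q_ge0 d0E
  (dev_ge0 y) U0_le Q_step).
Qed.

Let descent_hat : hat Dt + p / (4 * eta) * hat dt <= Dt 0 + 4 * Cc * Qt 0.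
Proof.
by apply: (@epoch_descent _ p p_gt0 p_le1 eta m%:R rate_err a Bc Cc (dev y) Dt dt Qt) => //; exact: dev_ge0.
Qed.

Let optimum_hat : hat Dt <= p / (4 * eta) * hat dt + p / (2 * eta) * (St 0 - hat St)
     + (Dt 0 + hat Dt) / 50 + 4 * Cc * Qt 0.
Proof.
by apply: (@epoch_optimum _ p p_gt0 p_le1 eta m%:R rate_err a Bc Cc sigma (dev y) Dt dt Qt St) => //; exact: dev_ge0.
Qed.

(** The next tracker mixes [mu] plus the local gradients at the new iterate minus those at the old
    one, so its deviation is controlled by that of [mu] and by the displacement during the epoch. *)
Let close_err i : inner_inv i -> outer_err (close_epoch st i) <=
  inner_err mu i + rate_err * (outer_err st + inner_err mu i + m%:R * inner_dist y i).
Proof.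
move=> inv_i; rewrite /outer_err.
have -> : dev (out_y (close_epoch st i)) = dev (in_w i) by [].
have hi : dev (in_w i) <= inner_err mu i.
  rewrite /inner_err -addrA lerDl addr_ge0 ?mulr_ge0 ?dev_ge0 ?normsq_ge0 ?sqr_ge0 //;
  exact: ltW.
apply: lerD => //.
have h1 : dev (tracker (close_epoch st i)) <= rho ^+ 2 * (3 * (dev mu
   + (2 * l2 ^+ 2 * normsq (in_w i - y)))).
  apply: le_trans (mix_dev _) _; rewrite ler_wpM2l ?sqr_ge0 //=.
  set G := local_grads fc (in_w i); set G' := local_grads fc _.
  have := devD_le3 mu (G - G') 0; rewrite addr0 addrA.
  have -> : dev (0 : 'M[R]_(m, d)) = 0.
    apply/eqP; rewrite eq_le dev_ge0 andbT -(normsq0 R m d); exact: dev_le_normsq.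
  rewrite addr0 => h; apply: le_trans h _; rewrite ler_pM2l // lerD2l.
  apply: le_trans (dev_le_normsq m_gt0 _) _.
  rewrite !normsq_rows mulr_sumr; apply: ler_sum => k _.
  rewrite !raddfB /= !rowK; apply: (two_sided_lipschitz l1_gt0 l1_le_l2).
  exact: two_sided_f_local.
have h2 := normsq_sub_dev (in_w i) y.
have d1 := dev_ge0 y; have d2 := dev_ge0 mu; have d3 := dev_ge0 (in_w i).
have d4 : 0 <= m%:R * inner_dist y i by rewrite mulr_ge0 ?normsq_ge0 // ltW.
have e2 : 0 <= eta ^+ 2 by rewrite sqr_ge0.
have l2p : 0 <= 2 * l2 ^+ 2 by rewrite mulr_ge0 ?sqr_ge0.
apply: (@le_trans _ _ (eta ^+ 2 * (rho ^+ 2 * (3 * (dev mu + (2 * l2 ^+ 2 * (3 * (dev (in_w i) + dev y + m%:R * inner_dist y i)))))))).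
  apply: ler_wpM2l => //; apply: le_trans h1 _; apply: ler_wpM2l; first exact: sqr_ge0.
  by rewrite ler_pM2l // lerD2l; apply: ler_wpM2l.
have p2 := rho_gt0; have p3 := rho_small.
have r2 : 10 * rho ^+ 2 <= rho by rewrite expr2 mulrA ler_piMl // ltW.
have r20 : 0 <= rho ^+ 2 by rewrite sqr_ge0.
have -> : eta ^+ 2 * (rho ^+ 2 * (3 * (dev mu + (2 * l2 ^+ 2 * (3 * (dev (in_w i) + dev y + m%:R * inner_dist y i))))))
  = rho ^+ 2 * (3 * (eta ^+ 2 * dev mu) + 9 * lam_err * (dev (in_w i) + dev y + m%:R * inner_dist y i)).
  rewrite /lam_err; ring.
rewrite -/y -/mu /rate_err.
have l0 := lam0.
have {}d2 : 0 <= eta ^+ 2 * dev mu by rewrite mulr_ge0.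
move: (eta ^+ 2 * dev mu) (dev y) (m%:R * _) (dev (in_w i)) (inner_err mu i) lam_err hi d1 d2 d3 d4 l0
  => X Y Z U V La hi d1 d2 d3 d4 l0.
apply: (@le_trans _ _ (rho * (3 * X + 9 * La * (U + Y + Z)) / 10)).
  suff h T : 0 <= T -> rho ^+ 2 * T <= rho * T / 10.
    by apply: h; rewrite addr_ge0 ?mulr_ge0 ?addr_ge0.
  by move=> T0; rewrite ler_pdivlMr // mulrC mulrA ler_wpM2r.
rewrite -mulrA -[leRHS]mulrA ler_pM2l //.
have t1 : La * U <= La * V by rewrite ler_wpM2l.
have t2 : 0 <= La * (X + Y + Z) by rewrite mulr_ge0 ?addr_ge0.
have t3 : 0 <= La * X by rewrite mulr_ge0.
have t4 : 0 <= La * Y by rewrite mulr_ge0.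
have t5 : 0 <= La * Z by rewrite mulr_ge0.
have t6 : 0 <= La * U by rewrite mulr_ge0.
clear h1 h2 e2 l2p inv_i.
lra.
Qed.

Let lin2 t (c1 c0 c2 : R) x z :
  inner_iter_op mu y t (fun i => x i + c1 * (c0 + x i + c2 * z i)) ist =
  inner_iter_op mu y t x ist + c1 * (c0 + inner_iter_op mu y t x ist + c2 * inner_iter_op mu y t z ist).
Proof.
rewrite -[in RHS](inner_iter_op_cst mu y t c0 ist) -(inner_iter_opZ mu y t c2).
rewrite -[inner_iter_op mu y t _ ist + inner_iter_op mu y t x ist]inner_iter_opD.
rewrite -[inner_iter_op mu y t (_ \+ x) ist + _]inner_iter_opD -inner_iter_opZ.
by rewrite -inner_iter_opD.
Qed.

Let outer_err_hat : epoch_op N outer_err st <=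
  7 * rate_err * Qt 0 + 4 * rate_err * m%:R * hat dt.
Proof.
have h : epoch_op N outer_err st <= geo_sum p N (fun t =>
    Qt t.+1 + rate_err * (outer_err st + Qt t.+1 + m%:R * dt t.+1)).
  apply: geo_sum_le => // t; rewrite -lin2.
  by apply: inner_iter_op_le => // i; exact: close_err.
apply: le_trans h _.
rewrite geo_sum_lin2 -/(hat Qt) -/(hat dt) -Q0E.
have c := geo_sum_cst_le p_le1 N (Q_ge0 0).
have h := consensus_hat; have r0 := rate_ge0; have r1 := r_half.
have hd0 : 0 <= hat dt by apply: geo_sum_ge0.
have q0 := Q_ge0 0; have m0 := m_pos.
have t1 : rate_err * (geo_sum p N (fun=> Qt 0)) <= rate_err * Qt 0 by rewrite ler_wpM2l.
have t2 : (1 + rate_err) * hat Qt <= 3 / 2 * (4 * rate_err * Qt 0 + 2 * rate_err * m%:R * hat dt).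
  apply: ler_pM => //; [lra| |lra].
  by apply: geo_sum_ge0.
have t3 : 0 <= rate_err * Qt 0 by rewrite mulr_ge0.
lra.
Qed.

Let track_hat : epoch_op N track_pot st <=
  1 / 8 * (track_pot st + p / (4 * eta) * hat dt).
Proof.
rewrite /track_pot epoch_opZ -/Cc.
apply: (@le_trans _ _ (4 * Cc * (7 * rate_err * Qt 0 + 4 * rate_err * m%:R * hat dt))).
  by rewrite ler_wpM2l // mulr_ge0.
have e0 := eta_gt0; have m0 := m_pos; have r0 := rate_ge0; have c1 := coef_ge1.
have rs := rate_small; have p1 := p_le1; have p0 := p_gt0.
have hd0 : 0 <= hat dt by apply: geo_sum_ge0.
rewrite Q0E [leLHS]mulrDr [leRHS]mulrDr; apply: lerD.
  have -> : 4 * Cc * (7 * rate_err * outer_err st) = 7 * rate_err * (4 * Cc * outer_err st) by ring.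
  apply: ler_wpM2r; first by exact: track_pot_ge0.
  have h := rate_1000; lra.
have -> : 4 * Cc * (4 * rate_err * m%:R * hat dt) = 16 * (rate_err * coef) / eta * hat dt.
  by rewrite /Cc; field; rewrite !lt0r_neq0.
rewrite [leRHS]mulrA; apply: ler_wpM2r => //.
have -> : 1 / 8 * (p / (4 * eta)) = p / 32 / eta by field; rewrite lt0r_neq0.
rewrite ler_pM2r ?invr_gt0 //; lra.
Qed.

(** [descent_hat] plus twice [track_hat]: the surplus in [hat dt] of the former pays for the
    consensus error caused by the displacement. *)
Lemma lyapunov_epoch : epoch_op N lyapunov st <= lyapunov st.
Proof.
have -> : epoch_op N lyapunov st = hat Dt + 2 * epoch_op N track_pot st.
  by rewrite -epoch_opZ; exact: epoch_opD.
have h1 := descent_hat; have h2 := track_hat; have h3 := track_pot_ge0 st.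
have h4 : 0 <= p / (4 * eta) * hat dt.
  rewrite mulr_ge0 ?geo_sum_ge0 // divr_ge0 ?ltW // mulr_gt0 //.
have e : 4 * Cc * Qt 0 = track_pot st by rewrite Q0E.
rewrite e in h1; rewrite /lyapunov -[gap st]/(Dt 0); lra.
Qed.

(** The weights in [energy] come from adding [optimum_hat], twice [descent_hat] and four times
    [track_hat]; the surplus of the descent covers both the unpaid variance and the displacement. *)
Lemma energy_epoch :
  epoch_op N (energy \+ (fun x => 1 / 4 * lyapunov x)) st <= energy st + lyapunov st / 50.
Proof.
have -> : epoch_op N (energy \+ (fun x => 1 / 4 * lyapunov x)) st =
   2 * hat Dt + 7 / 2 * epoch_op N track_pot st + p / (2 * eta) * hat St
    + 1 / 4 * (hat Dt + 2 * epoch_op N track_pot st).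
  rewrite epoch_opD epoch_opZ; congr (_ + _ * _).
    rewrite -[hat Dt]/(epoch_op N gap st) -[hat St]/(epoch_op N opt_dist st).
    by rewrite -!epoch_opZ -!epoch_opD.
  by rewrite -epoch_opZ; exact: epoch_opD.
have h1 := descent_hat; have h2 := track_hat; have h3 := track_pot_ge0 st.
have h5 := optimum_hat.
have h4 : 0 <= p / (4 * eta) * hat dt.
  rewrite mulr_ge0 ?geo_sum_ge0 // divr_ge0 ?ltW // mulr_gt0 //.
have h6 : 0 <= hat Dt by apply: geo_sum_ge0.
have h7 := D_ge0 0.
have h8 : 0 <= epoch_op N track_pot st.
  by apply: (epoch_op_ge0 N _ inv) => x _; exact: track_pot_ge0.
have e : 4 * Cc * Qt 0 = track_pot st by rewrite Q0E.
rewrite e in h1 h5; rewrite /energy /lyapunov -[gap st]/(Dt 0) -[opt_dist st]/(St 0).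
move: h5; rewrite mulrBr; lra.
Qed.

End OneEpoch.

Definition run_op N k g : outer_state R m d -> R := iter k (epoch_op N) g.

Lemma run_opS N k g : run_op N k.+1 g = run_op N k (epoch_op N g).
Proof. exact: iterSr. Qed.

Lemma run_opD N k g h st : run_op N k (g \+ h) st = run_op N k g st + run_op N k h st.
Proof.
elim: k g h => // k IH g h; rewrite !run_opS -IH; congr run_op.
by apply/funext => x; rewrite epoch_opD.
Qed.

Lemma run_opZ N k c g st : run_op N k (fun x => c * g x) st = c * run_op N k g st.
Proof.
elim: k g => // k IH g; rewrite !run_opS -IH; congr run_op.
by apply/funext => x; rewrite epoch_opZ.
Qed.

Lemma run_op_le N k g h : (forall st, outer_inv st -> g st <= h st) ->
  forall st, outer_inv st -> run_op N k g st <= run_op N k h st.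
Proof.
move=> gh; elim: k => // k IH st inv; rewrite /run_op !iterS.
exact: epoch_op_le.
Qed.

Lemma run_op_ge0 N k g : (forall st, outer_inv st -> 0 <= g st) ->
  forall st, outer_inv st -> 0 <= run_op N k g st.
Proof.
move=> g0; elim: k => // k IH st inv.
by rewrite /run_op iterS; exact: epoch_op_ge0.
Qed.

Lemma energy_le st : outer_inv st ->
  energy st <= (2 + p / (eta * sigma)) * lyapunov st.
Proof.
move=> inv; have h := opt_dist_le inv; have c0 := track_pot_ge0 st.
have g0 := gap_ge0 inv; have e0 := eta_gt0; have s0 := sigma_gt0; have p0 := p_gt0.
have x0 : 0 <= p / (eta * sigma) by rewrite divr_ge0 ?ltW // mulr_gt0.
have h1 : p / (2 * eta) * opt_dist st <= p / (eta * sigma) * gap st.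
  have -> : p / (2 * eta) * opt_dist st = p / (eta * sigma) * (sigma / 2 * opt_dist st).
    by field; rewrite !lt0r_neq0.
  exact: ler_wpM2l.
have h2 : 0 <= p / (eta * sigma) * track_pot st by rewrite mulr_ge0.
rewrite /energy /lyapunov.
move: (p / (2 * eta) * _) (p / (eta * sigma)) h1 h2 x0 => X Y h1 h2 x0.
lra.
Qed.

Lemma run_lyapunov_halving N K st : outer_inv st ->
  20 * (1 + p / (eta * sigma)) <= K%:R ->
  run_op N K lyapunov st <= lyapunov st / 2.
Proof.
move=> inv KB.
have lyap0 x : outer_inv x -> 0 <= lyapunov x.
  by move=> ix; rewrite /lyapunov addr_ge0 ?gap_ge0 // mulr_ge0 ?track_pot_ge0.
have eng0 x : outer_inv x -> 0 <= energy x.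
  move=> ix; have e0 := eta_gt0; have p0 := p_gt0.
  apply: addr_ge0.
    by apply: addr_ge0; apply: mulr_ge0 => //; [exact: gap_ge0|exact: track_pot_ge0].
  apply: mulr_ge0; last exact: normsq_ge0.
  by rewrite divr_ge0 ?ltW // mulr_gt0.
have mono k : run_op N k.+1 lyapunov st <= run_op N k lyapunov st.
  rewrite run_opS; apply: run_op_le inv => x ix; exact: lyapunov_epoch.
have step k : run_op N k.+1 energy st + 1 / 4 * run_op N k.+1 lyapunov st <=
    run_op N k energy st + 1 / 50 * run_op N k lyapunov st.
  rewrite -!run_opZ -!run_opD run_opS; apply: run_op_le inv => x ix.
  by apply: le_trans (energy_epoch N ix) _; rewrite mulrC mul1r.
(* [23/100 = 1/4 - 1/50] is the net drop of [energy] per epoch in units of [lyapunov]. By [mono] all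
   [k] drops are at least the latest one. *)
have claim k : run_op N k energy st + 1 / 50 * run_op N k lyapunov st
    + 23 / 100 * k%:R * run_op N k lyapunov st <= energy st + 1 / 50 * lyapunov st.
  elim: k => [|k IH]; first by rewrite mulr0 mul0r addr0.
  apply: le_trans _ IH; have h1 := step k; have h2 := mono k.
  have h3 : k%:R * run_op N k.+1 lyapunov st <= k%:R * run_op N k lyapunov st.
    by rewrite ler_wpM2l.
  rewrite -(natr1 k).
  move: (k%:R) (run_op N k.+1 lyapunov st) (run_op N k lyapunov st) h1 h2 h3 => a b1 b0.
  move: (run_op N k.+1 energy st) (run_op N k energy st) => e1 e0 h1 h2 h3.
  lra.
have cK := claim K; rewrite -(mulrA (23 / 100)) in cK.
have eK := run_op_ge0 N K eng0 inv.
have lK := run_op_ge0 N K lyap0 inv; have l0 := lyap0 _ inv.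
have e0 := energy_le inv.
have h1 : 20 * (1 + p / (eta * sigma)) * run_op N K lyapunov st <= K%:R * run_op N K lyapunov st.
  exact: ler_wpM2r.
have eta0 := eta_gt0; have s0 := sigma_gt0; have p0 := p_gt0.
have x0 : 0 <= p / (eta * sigma) by rewrite divr_ge0 ?ltW // mulr_gt0.
move: (run_op N K lyapunov st) (run_op N K energy st) (energy st) (lyapunov st)
  (K%:R * _) (p / (eta * sigma)) cK eK lK l0 e0 h1 x0.
move=> GK EK E0 G0 KG x cK eK lK l0 e0 h1 x0.
(* [46/10] is [20 * 23/100]; [202/100 + x] is [1/50] added to the factor of [energy_le]. *)
have h2 : (46 / 10 * (1 + x)) * GK <= (202 / 100 + x) * G0 by lra.
have h3 : (46 / 10 * (1 + x)) * (G0 / 2) >= (202 / 100 + x) * G0.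
  have : 0 <= x * G0 by rewrite mulr_ge0.
  lra.
have h4 : 0 < 46 / 10 * (1 + x) by lra.
rewrite -(ler_pM2l h4); exact: le_trans h2 h3.
Qed.

Lemma run_lyapunov_geometric N K j st : outer_inv st ->
  20 * (1 + p / (eta * sigma)) <= K%:R ->
  run_op N (K * j)%N lyapunov st <= 2^-1 ^+ j * lyapunov st.
Proof.
move=> inv KB; elim: j => [|j IH]; first by rewrite muln0 expr0 mul1r.
have -> : run_op N (K * j.+1)%N lyapunov = run_op N (K * j)%N (run_op N K lyapunov).
  by rewrite mulnS addnC /run_op iterD.
apply: (@le_trans _ _ (run_op N (K * j)%N (fun x => 2^-1 * lyapunov x) st)).
  apply: run_op_le inv => x ix; rewrite mulrC; exact: run_lyapunov_halving.
by rewrite run_opZ exprS -mulrA ler_pM2l // invr_gt0.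
Qed.

Lemma run_gap_geometric N K j st : outer_inv st ->
  20 * (1 + p / (eta * sigma)) <= K%:R ->
  run_op N (K * j)%N gap st <= 2^-1 ^+ j * lyapunov st.
Proof.
move=> inv KB; apply: le_trans _ (run_lyapunov_geometric N j inv KB).
apply: run_op_le inv => x ix; rewrite /lyapunov lerDl.
by rewrite mulr_ge0 ?track_pot_ge0.
Qed.

End EpochOperator.

End InnerStep.

(** * The law of a run *)

Section FunctionalSum.
Variables (R : realType) (S : Type) (F : (S -> R) -> R).
Hypotheses (FD : forall g h, F (g \+ h) = F g + F h)
  (FZ : forall c g, F (fun x => c * g x) = c * F g).

Lemma functional_sum (I : Type) (r : seq I) (g : I -> S -> R) :
  F (fun x => \sum_(i <- r) g i x) = \sum_(i <- r) F (g i).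
Proof.
elim: r => [|i r IH].
  rewrite big_nil -[RHS](mul0r (F (fun=> 0))) -FZ.
  by congr F; apply/funext => x; rewrite big_nil mul0r.
rewrite big_cons -IH -FD; congr F.
by apply/funext => x; rewrite big_cons.
Qed.

End FunctionalSum.

Section DiscreteMaps.
Context d (Omega : measurableType d) (R : realType) (P : probability Omega R).

(* The iterates depend on countably many discrete draws, so no sigma-algebra on
   the space of matrices is needed. *)
Definition discretely_measurable (X : Type) (f : Omega -> X) : Prop :=
  forall S : set X, measurable (f @^-1` S).

Lemma discretely_measurable_cst (X : Type) (x : X) :
  discretely_measurable (fun=> x).
Proof.
move=> S; have [xS|xS] := pselect (S x).
  by rewrite (_ : _ @^-1` _ = setT) //; apply/seteqP; split.
by rewrite (_ : _ @^-1` _ = set0) //; apply/seteqP; split.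
Qed.

Lemma discretely_measurable_comp (X Y : Type) (f : Omega -> X) (g : X -> Y) :
  discretely_measurable f -> discretely_measurable (g \o f).
Proof. by move=> mf S; rewrite comp_preimage; exact: mf. Qed.

Lemma discretely_measurable_countable (X : Type) (Y : countType)
    (h : Omega -> Y) (f : Y -> Omega -> X) :
  discretely_measurable h -> (forall y, discretely_measurable (f y)) ->
  discretely_measurable (fun omega => f (h omega) omega).
Proof.
move=> mh mf S.
have -> : (fun omega => f (h omega) omega) @^-1` S =
    \bigcup_(y in [set: Y]) (h @^-1` [set y] `&` f y @^-1` S).
  apply/seteqP; split => [w Sw|w [y _ [/= <- //]]].
  by exists (h w).
by apply: countable_bigcupT_measurable => // y; apply: measurableI; [exact: mh|exact: mf].
Qed.

Lemma discretely_measurable_EFin (X : Type) (f : Omega -> X) (g : X -> R) E :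
  discretely_measurable f -> measurable_fun E (EFin \o (g \o f)).
Proof.
move=> mf mE Y mY; apply: measurableI => //.
exact: (mf (fun x => Y (g x)%:E)).
Qed.

Lemma ge0_integral_partition (Y : choiceType) (s : seq Y) (h : Omega -> Y) E (f : Omega -> \bar R) :
  measurable E -> discretely_measurable h -> uniq s ->
  (forall omega, E omega -> h omega \in s) ->
  measurable_fun E f -> (forall omega, E omega -> (0 <= f omega)%E) ->
  (\int[P]_(omega in E) f omega =
   \sum_(y <- s) \int[P]_(omega in E `&` h @^-1` [set y]) f omega)%E.
Proof.
move=> mE mh us hs mf f0.
have EE : E = \big[setU/set0]_(y <- s) (E `&` h @^-1` [set y]).
  rewrite -bigcup_seq; apply/seteqP; split => [w Ew|w [y _ []//]].
  by exists (h w) => //=; exact: hs.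
rewrite {1}EE ge0_integral_bigsetU //.
- by move=> y; apply: measurableI => //; exact: mh.
- apply/trivIsetP => x y _ _ /eqP xy; rewrite -subset0 => w [[_ /= hx] [_ /= hy]].
  by apply: xy; rewrite -hx -hy.
- by rewrite -EE.
- by move=> x; rewrite -EE; exact: f0.
Qed.

End DiscreteMaps.

Section Law.
Variables (R : realType) (m n d b M : nat).
Variables (fc : 'I_m -> 'I_n -> 'rV[R]_d -> R) (psi : 'rV[R]_d -> \bar R).
Variables (x0 : 'rV[R]_d) (W : 'M[R]_m) (eta : R).
Variables (disp : measure_display) (Omega : measurableType disp).
Variables (P : probability Omega R) (T : nat -> Omega -> nat)
  (B : nat -> nat -> 'I_m -> 'I_b -> Omega -> 'I_n).
Hypothesis sampling : pmgt_sampling P T B.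

Local Notation index := (nat + nat * nat * 'I_m * 'I_b)%type.
Let p : R := (t_zero n b)%:R^-1.

Definition state_at k omega : outer_state R m d :=
  pmgt_svrg fc psi x0 W eta M (T ^~ omega) (fun k' t i l => B k' t i l omega) k.

Definition inner_at k t omega : inner_state R m d :=
  inner_iter fc psi W eta M (tracker M fc W (state_at k omega))
    (out_y (state_at k omega)) (fun t i l => B k t i l omega) t.

Definition batch_at k t omega : {ffun 'I_m * 'I_b -> 'I_n} :=
  [ffun a => B k t a.1 a.2 omega].

Lemma curry_batch_at k t omega :
  curry_batch (batch_at k t omega) = fun i l => B k t i l omega.
Proof. by apply/funext => i; apply/funext => l; rewrite /curry_batch ffunE. Qed.

Lemma state_atS k omega : state_at k.+1 omega =
  close_epoch M fc W (state_at k omega) (inner_at k (T k omega).+1 omega).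
Proof. by []. Qed.

Lemma inner_atS k t omega : inner_at k t.+1 omega =
  inner_step fc psi W eta M (tracker M fc W (state_at k omega))
    (out_y (state_at k omega)) (curry_batch (batch_at k t omega)) (inner_at k t omega).
Proof. by rewrite curry_batch_at. Qed.

Lemma draw_measurable a : discretely_measurable (draw T B a).
Proof.
case: sampling => md _ _ _ S; have := md a measurableT S.
by rewrite setTI; apply.
Qed.

Lemma T_measurable k : discretely_measurable (T k).
Proof. exact: (draw_measurable (inl k)). Qed.

Lemma B_measurable k t i l : discretely_measurable (B k t i l).
Proof.
move=> S.
have -> : B k t i l @^-1` S =
    draw T B (inr (k, t, i, l)) @^-1` [set x | exists2 j, S j & x = j :> nat].
  apply/seteqP; split => [w /= h|w /= [j Sj]]; first by exists (B k t i l w).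
  by move=> /ord_inj ->.
exact: draw_measurable.
Qed.

Lemma batch_measurable k t : discretely_measurable (batch_at k t).
Proof.
have h beta : measurable (batch_at k t @^-1` [set beta]).
  have -> : batch_at k t @^-1` [set beta] =
     \bigcap_(a in [set: 'I_m * 'I_b]) (B k t a.1 a.2 @^-1` [set beta a]).
    apply/seteqP; split => [w /= <- a _ /=|w /= h]; first by rewrite ffunE.
    by apply/ffunP => a; rewrite ffunE; exact: h.
  apply: fin_bigcap_measurable; first exact: finite_finset.
  by move=> a _; exact: B_measurable.
move=> S; have -> : batch_at k t @^-1` S =
    \bigcup_(beta in S) (batch_at k t @^-1` [set beta]).
  apply/seteqP; split => [w /= hw|w [beta Sb /= e]]; last by rewrite /= e.
  by exists (batch_at k t w).
by apply: fin_bigcup_measurable => //; exact: finite_finset.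
Qed.

(** The pair is treated jointly since an inner step reads both components; each step adds one
    discrete draw. At the end of an epoch the claim is needed for all [t] at once, as [T k] is
    substituted. *)
Lemma run_measurable k t :
  discretely_measurable (fun omega => (state_at k omega, inner_at k t omega)).
Proof.
elim: k t => [|k IHk] t.
  elim: t => [|t IH]; first exact: (discretely_measurable_cst _ (outer_init fc x0, inner_start M fc W (outer_init fc x0))).
  pose F (beta : {ffun 'I_m * 'I_b -> 'I_n}) (x : outer_state R m d * inner_state R m d) :=
    (x.1, inner_step fc psi W eta M (tracker M fc W x.1) (out_y x.1) (curry_batch beta) x.2).
  have -> : (fun omega => (state_at 0 omega, inner_at 0 t.+1 omega)) =
     fun omega => (F (batch_at 0 t omega) \o (fun omega => (state_at 0 omega, inner_at 0 t omega))) omega.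
    by apply/funext => w; rewrite inner_atS.
  apply: (discretely_measurable_countable (f := fun beta =>
     F beta \o (fun omega => (state_at 0 omega, inner_at 0 t omega)))).
    exact: batch_measurable.
  by move=> beta; exact: discretely_measurable_comp.
elim: t => [|t IH].
  pose F (x : outer_state R m d * inner_state R m d) :=
    (close_epoch M fc W x.1 x.2, inner_start M fc W (close_epoch M fc W x.1 x.2)).
  have -> : (fun omega => (state_at k.+1 omega, inner_at k.+1 0 omega)) =
     fun omega => (F \o (fun omega' => (state_at k omega', inner_at k (T k omega).+1 omega'))) omega.
    by [].
  apply: (discretely_measurable_countable (f := fun t omega =>
     (F \o (fun omega' => (state_at k omega', inner_at k t.+1 omega'))) omega)).
    exact: T_measurable.
  by move=> t; exact: (discretely_measurable_comp F (IHk t.+1)).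
pose F (beta : {ffun 'I_m * 'I_b -> 'I_n}) (x : outer_state R m d * inner_state R m d) :=
  (x.1, inner_step fc psi W eta M (tracker M fc W x.1) (out_y x.1) (curry_batch beta) x.2).
have -> : (fun omega => (state_at k.+1 omega, inner_at k.+1 t.+1 omega)) =
   fun omega => (F (batch_at k.+1 t omega) \o (fun omega => (state_at k.+1 omega, inner_at k.+1 t omega))) omega.
  by apply/funext => w; rewrite inner_atS.
apply: (discretely_measurable_countable (f := fun beta =>
   F beta \o (fun omega => (state_at k.+1 omega, inner_at k.+1 t omega)))).
  exact: batch_measurable.
by move=> beta; exact: discretely_measurable_comp.
Qed.

Definition cylinder (J : seq index) (A : index -> set nat) : set Omega :=
  \bigcap_(a in [set` J]) (draw T B a @^-1` A a).

Definition cylinder_weight (J : seq index) (A : index -> set nat) : R :=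
  \prod_(a <- J) fine (P (draw T B a @^-1` A a)).

Lemma cylinder_measurable J A : measurable (cylinder J A).
Proof.
apply: fin_bigcap_measurable; first exact: finite_seq.
by move=> a _; exact: draw_measurable.
Qed.

Lemma cylinder_prob J A : uniq J -> P (cylinder J A) = (cylinder_weight J A)%:E.
Proof.
case: sampling => _ _ _ ind uJ; rewrite ind // /cylinder_weight -prodEFin.
apply: eq_bigr => a _; rewrite fineK // fin_num_measure //.
exact: draw_measurable.
Qed.

(* Draws that neither an earlier epoch nor an earlier inner step of epoch [k] uses. *)
Definition fresh k t (a : index) : bool :=
  match a with
  | inl k' => (k <= k')%N
  | inr (k', t', _, _) => (k < k')%N || ((k == k') && (t <= t')%N)
  end.

(** The event that matches the truncation built into [epoch_op]. *)
Definition early k N : set Omega := [set omega | forall j, (j < k)%N -> (T j omega < N)%N].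

Lemma early_measurable k N : measurable (early k N).
Proof.
have -> : early k N = \bigcap_(j in `I_k) (T j @^-1` `I_N) by [].
by apply: fin_bigcap_measurable => // j _; exact: T_measurable.
Qed.

Definition batch_index k t : seq index :=
  [seq inr (k, t, a.1, a.2) | a <- enum {: 'I_m * 'I_b}].

Definition with_batch k t (beta : {ffun 'I_m * 'I_b -> 'I_n}) (A : index -> set nat) :
    index -> set nat :=
  fun a => match a with
  | inr (k', t', i, l) =>
      if (k' == k) && (t' == t) then [set (beta (i, l) : nat)] else A a
  | inl _ => A a
  end.

Definition with_length k t (A : index -> set nat) : index -> set nat :=
  fun a => if a == inl k then [set t] else A a.

Lemma fresh_batch k t a : fresh k t.+1 a -> fresh k t a /\ a \notin batch_index k t.
Proof.
case: a => [k'|[[[k' t'] i] l]] /=.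
  by move=> h; split => //; apply/mapP => -[].
move=> /orP[h|/andP[/eqP <- h]].
  by split; [rewrite h|apply/mapP => -[a _ [e]]; rewrite e ltnn in h].
split; first by rewrite eqxx (ltnW h) orbT.
by apply/mapP => -[a _ [e]]; rewrite e ltnn in h.
Qed.

Lemma batch_index_uniq k t : uniq (batch_index k t).
Proof.
rewrite map_inj_uniq ?enum_uniq // => -[i l] [i' l'] /=.
by case=> -> ->.
Qed.

Lemma fresh_batch_cat k t J : all (fresh k t.+1) J -> uniq J ->
  uniq (batch_index k t ++ J) /\ all (fresh k t) (batch_index k t ++ J).
Proof.
move=> /allP fJ uJ; split.
  rewrite cat_uniq batch_index_uniq uJ andbT /=.
  by apply/hasPn => a /fJ /fresh_batch[].
rewrite all_cat; apply/andP; split; last by apply/allP => a /fJ /fresh_batch[].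
by apply/allP => _ /mapP[a _ ->] /=; rewrite eqxx leqnn orbT.
Qed.

Lemma with_batch_out k t beta A a : a \notin batch_index k t -> with_batch k t beta A a = A a.
Proof.
case: a => [//|[[[k' t'] i] l]] /=; case: andP => // -[/eqP -> /eqP ->].
by move=> /mapP[]; exists (i, l); rewrite ?mem_enum.
Qed.

Lemma cylinder_batch k t beta J A : all (fresh k t.+1) J ->
  cylinder (batch_index k t ++ J) (with_batch k t beta A) =
  cylinder J A `&` batch_at k t @^-1` [set beta].
Proof.
move=> /allP fJ; apply/seteqP; split => [w /= h|w [h /= hb] a].
  split => [a /= aJ|/=].
    have := h a; rewrite /= mem_cat aJ orbT => /(_ isT).
    by rewrite /= with_batch_out //; have [] := fresh_batch (fJ _ aJ).
  apply/ffunP => -[i l]; rewrite ffunE /=; apply: ord_inj.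
  have := h (inr (k, t, i, l)); rewrite /= !eqxx /=; apply.
  by rewrite mem_cat; apply/orP; left; apply/mapP; exists (i, l); rewrite ?mem_enum.
rewrite /= mem_cat => /orP[/mapP[[i l] _ ->]|aJ] /=.
  by rewrite !eqxx /= -hb ffunE.
by rewrite with_batch_out; [exact: h|have [] := fresh_batch (fJ _ aJ)].
Qed.

Lemma cylinder_weight_batch k t beta J A : all (fresh k t.+1) J ->
  cylinder_weight (batch_index k t ++ J) (with_batch k t beta A) =
  (n%:R ^+ #|{: 'I_m * 'I_b}|)^-1 * cylinder_weight J A.
Proof.
move=> /allP fJ; rewrite /cylinder_weight big_cat /=; congr (_ * _); last first.
  apply: eq_big_seq => a aJ; rewrite with_batch_out //.
  by have [] := fresh_batch (fJ _ aJ).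
rewrite big_map (eq_bigr (fun=> n%:R^-1)) => [|[i l] _].
  by rewrite big_const_seq count_predT -cardE -exprVn iter_mulr_1.
rewrite /= !eqxx /=; case: sampling => _ _ hB _.
have := hB k t i l (beta (i, l)).
have -> : [set omega | B k t i l omega = beta (i, l)] =
    (fun omega => B k t i l omega : nat) @^-1` [set (beta (i, l) : nat)].
  by apply/seteqP; split => w /=; [move=> ->|move=> /ord_inj].
by move=> ->.
Qed.

Lemma fresh_length k t J : all (fresh k.+1 0) J -> uniq J ->
  uniq (inl k :: J) /\ all (fresh k t) (inl k :: J).
Proof.
move=> /allP fJ uJ; rewrite /= uJ leqnn andbT; split.
  by apply/negP => /fJ /=; rewrite ltnn.
apply/allP => a /fJ; case: a => [k'|[[[k' t'] i] l]] /=; first exact: ltnW.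
move=> /orP[h|/andP[/eqP <- _]]; last by rewrite ltnSn.
by rewrite (ltn_trans (ltnSn k) h).
Qed.

Lemma cylinder_length k t J A : all (fresh k.+1 0) J ->
  cylinder (inl k :: J) (with_length k t A) = cylinder J A `&` T k @^-1` [set t].
Proof.
move=> /allP fJ.
have ne a : a \in J -> (a == inl k) = false.
  by move=> /fJ; case: eqP => // -> /=; rewrite ltnn.
apply/seteqP; split => [w /= h|w [h /= hb] a].
  split => [a /= aJ|/=].
    have := h a; rewrite /= in_cons aJ orbT => /(_ isT).
    by rewrite /with_length /= ne.
  have := h (inl k); rewrite /= in_cons eqxx => /(_ isT).
  by rewrite /with_length eqxx.
rewrite /= in_cons /with_length; case: eqP => [-> _ //|_ /= aJ].
exact: h.
Qed.

Lemma cylinder_weight_length k t J A : all (fresh k.+1 0) J ->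
  cylinder_weight (inl k :: J) (with_length k t A) =
  (1 - p) ^+ t * p * cylinder_weight J A.
Proof.
move=> /allP fJ; rewrite /cylinder_weight big_cons; congr (_ * _); last first.
  apply: eq_big_seq => a /fJ fa; rewrite /with_length.
  by case: eqP fa => // -> /=; rewrite ltnn.
rewrite /with_length eqxx; case: sampling => _ hT _ _.
by have := hT k t; rewrite -/p => h; rewrite [P _]h.
Qed.

Local Notation iter_op := (inner_iter_op b M fc psi W eta).
Local Notation run := (run_op b M fc psi W eta p).

(** The value, computed by the operators, of the expectation of [g] at inner step [t] of epoch [k],
    restricted to [early k N]. *)
Definition run_functional N k t (g : outer_state R m d -> inner_state R m d -> R) : R :=
  run N k (fun st => iter_op (tracker M fc W st) (out_y st) t (g st) (inner_start M fc W st))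
    (outer_init fc x0).

Lemma run_functional_batch N k t g : run_functional N k t.+1 g =
  (n%:R ^+ #|{: 'I_m * 'I_b}|)^-1 * \sum_(beta : {ffun 'I_m * 'I_b -> 'I_n}) run_functional N k t
    (fun st ist => g st (inner_step fc psi W eta M (tracker M fc W st) (out_y st)
       (curry_batch beta) ist)).
Proof.
rewrite /run_functional -(functional_sum (F := fun h => run N k h (outer_init fc x0))).
- rewrite -run_opZ; congr (run _ _ _ _); apply/funext => st.
  rewrite inner_iter_opS -(functional_sum
    (F := fun h => iter_op (tracker M fc W st) (out_y st) t h (inner_start M fc W st))).
  + by rewrite -inner_iter_opZ.
  + by move=> g1 g2; exact: inner_iter_opD.
  + by move=> c g1; exact: inner_iter_opZ.
- by move=> g1 g2; exact: run_opD.
- by move=> c g1; exact: run_opZ.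
Qed.

Lemma run_functional_length N k g : run_functional N k.+1 0 g =
  \sum_(t < N) (1 - p) ^+ t * p * run_functional N k t.+1
    (fun st ist => g (close_epoch M fc W st ist)
       (inner_start M fc W (close_epoch M fc W st ist))).
Proof.
rewrite /run_functional run_opS.
under eq_bigr do rewrite -run_opZ.
rewrite -(functional_sum (F := fun h => run N k h (outer_init fc x0))) //.
- by move=> g1 g2; exact: run_opD.
- by move=> c g1; exact: run_opZ.
Qed.

(* By induction on [(k, t)]: the most recent draw is fresh for [J], so the event
   that it takes a given value only adds one factor to the cylinder. *)
Lemma run_law N k t g J A : (forall st ist, 0 <= g st ist) ->
  uniq J -> all (fresh k t) J ->
  (\int[P]_(omega in cylinder J A `&` early k N) (g (state_at k omega) (inner_at k t omega))%:E
   = (cylinder_weight J A * run_functional N k t g)%:E)%E.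
Proof.
have mE k' J' A' : measurable (cylinder J' A' `&` early k' N).
  by apply: measurableI; [exact: cylinder_measurable|exact: early_measurable].
have mg k' t' (h : outer_state R m d -> inner_state R m d -> R) E :
    measurable_fun E (EFin \o (fun omega => h (state_at k' omega) (inner_at k' t' omega))).
  exact: (discretely_measurable_EFin (fun x => h x.1 x.2) (run_measurable k' t')).
have batch_step k' t' : (forall h J' A', (forall st ist, 0 <= h st ist) -> uniq J' ->
     all (fresh k' t') J' ->
   (\int[P]_(omega in cylinder J' A' `&` early k' N) (h (state_at k' omega) (inner_at k' t' omega))%:E
   = (cylinder_weight J' A' * run_functional N k' t' h)%:E)%E) ->
   forall h J' A', (forall st ist, 0 <= h st ist) -> uniq J' ->
     all (fresh k' t'.+1) J' ->
   (\int[P]_(omega in cylinder J' A' `&` early k' N) (h (state_at k' omega) (inner_at k' t'.+1 omega))%:E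
   = (cylinder_weight J' A' * run_functional N k' t'.+1 h)%:E)%E.
  move=> IH h J' A' h0 uJ fJ.
  (* On each piece the last batch is a constant [beta], so the next state is a fixed function of the
     current one and the induction hypothesis applies to the enlarged cylinder. *)
  rewrite (ge0_integral_partition (s := index_enum _) P (mE _ _ _) (batch_measurable k' t')) //.
  - rewrite run_functional_batch mulrCA mulrA mulr_sumr -sumEFin.
    apply: eq_bigr => beta _; rewrite -(cylinder_weight_batch beta A' fJ).
    have [uJ' fJ'] := fresh_batch_cat fJ uJ.
    pose h' st ist := h st (inner_step fc psi W eta M (tracker M fc W st) (out_y st)
      (curry_batch beta) ist).
    have <- := IH h' _ (with_batch k' t' beta A') (fun st ist => h0 _ _) uJ' fJ'.
    rewrite setIAC -(cylinder_batch beta A' fJ).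
    apply: eq_integral => w; rewrite inE => -[+ _].
    rewrite (cylinder_batch beta A' fJ) => -[_ /= bE].
    by rewrite /h' inner_atS bE.
  - exact: index_enum_uniq.
  - by move=> w _; rewrite mem_index_enum.
  - exact: mg.
  - by move=> w _; rewrite lee_fin.
elim: k t g J A => [|k IHk] t g J A.
  elim: t g J A => [|t IH] g J A; last exact: batch_step.
  move=> g0 uJ _.
  rewrite (_ : early 0 N = setT) ?setIT; last by apply/seteqP; split.
  pose c := g (outer_init fc x0) (inner_start M fc W (outer_init fc x0)).
  transitivity (\int[P]_(omega in cylinder J A) cst c%:E omega)%E; first exact: eq_integral.
  rewrite integral_cst; last exact: cylinder_measurable.
  by rewrite [X in (_ * X)%E](cylinder_prob A uJ) -EFinM mulrC.
elim: t g J A => [|t IH] g J A; last exact: batch_step.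
move=> g0 uJ fJ.
(* The values below [N] suffice, because [early k.+1 N] bounds [T k]. *)
rewrite (ge0_integral_partition (s := iota 0 N) P (mE _ _ _) (T_measurable k)) //.
- rewrite run_functional_length mulr_sumr -sumEFin.
  have -> : iota 0 N = index_iota 0 N by rewrite /index_iota subn0.
  rewrite big_mkord.
  apply: eq_bigr => t _; rewrite mulrA [cylinder_weight _ _ * _]mulrC.
  rewrite -(cylinder_weight_length t A fJ).
  have [uJ' fJ'] := fresh_length t.+1 fJ uJ.
  pose g' st ist := g (close_epoch M fc W st ist)
    (inner_start M fc W (close_epoch M fc W st ist)).
  have <- := IHk t.+1 g' _ (with_length k t A) (fun st ist => g0 _ _) uJ' fJ'.
  rewrite (cylinder_length t A fJ).
  have -> : cylinder J A `&` early k.+1 N `&` T k @^-1` [set (t : nat)] =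
      cylinder J A `&` T k @^-1` [set (t : nat)] `&` early k N.
    apply/seteqP; split => w /= [[h1 h2] h3].
      by split => // j jk; apply: h2; exact: ltnW.
    split => //; split => // j; rewrite ltnS leq_eqVlt => /orP[/eqP ->|]; last exact: h3.
    by rewrite h2.
  by apply: eq_integral => w; rewrite inE => -[[_ /= <-] _].
- exact: iota_uniq.
- by move=> w [_ /(_ k (ltnSn k))]; rewrite mem_iota.
- exact: mg.
- by move=> w _; rewrite lee_fin.
Qed.

End Law.

Section IntegralLimit.
Context d (Omega : measurableType d) (R : realType) (P : probability Omega R).

Lemma ge0_integral_le_exhaustion (E : nat -> set Omega) (f : Omega -> \bar R) (c : R) :
  {homo E : n m / (n <= m)%N >-> (n <= m)%O} -> (forall N, measurable (E N)) ->
  \bigcup_N E N = setT -> (forall A, measurable_fun A f) ->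
  (forall omega, (0 <= f omega)%E) ->
  (forall N, (\int[P]_(omega in E N) f omega <= c%:E)%E) ->
  (\int[P]_omega f omega <= c%:E)%E.
Proof.
move=> ndE mE UE mf f0 fc.
have := @ge0_nondecreasing_set_cvg_integral _ _ _ E f P ndE mE (fun i => mf _) (fun i x _ => f0 x).
rewrite UE => cv; rewrite -(cvg_lim _ cv) //.
apply: lime_le; first by apply/cvg_ex; exists (\int[P]_omega f omega)%E.
by near=> N; exact: fc.
Unshelve. all: by end_near. Qed.

End IntegralLimit.

Section Expectations.
Variables (R : realType) (m n d b M : nat).
Variables (fc : 'I_m -> 'I_n -> 'rV[R]_d -> R) (psi : 'rV[R]_d -> \bar R).
Variables (x0 : 'rV[R]_d) (W : 'M[R]_m) (eta : R).
Variables (disp : measure_display) (Omega : measurableType disp).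
Variables (P : probability Omega R) (T : nat -> Omega -> nat)
  (B : nat -> nat -> 'I_m -> 'I_b -> Omega -> 'I_n).
Hypothesis sampling : pmgt_sampling P T B.
Let p : R := (t_zero n b)%:R^-1.

Lemma expected_state_le k (g : outer_state R m d -> R) (c : R) :
  (forall st, 0 <= g st) ->
  (forall N, run_op b M fc psi W eta p N k g (outer_init fc x0) <= c) ->
  (\int[P]_omega (g (state_at M fc psi x0 W eta T B k omega))%:E <= c%:E)%E.
Proof.
move=> g0 gc.
have mS : discretely_measurable (state_at M fc psi x0 W eta T B k).
  exact: (discretely_measurable_comp fst (run_measurable M fc psi x0 W eta sampling k 0)).
apply: (ge0_integral_le_exhaustion (E := early T k)).
- move=> N N' NN'; apply/subsetPset => w h j jk; exact: leq_trans (h j jk) NN'.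
- by move=> N; exact: (early_measurable sampling).
- apply/seteqP; split => // w _; exists (\max_(j < k) (T j w).+1)%N => // j jk.
  exact: (leq_bigmax (Ordinal jk)).
- by move=> A; exact: discretely_measurable_EFin.
- by move=> w; rewrite lee_fin.
- move=> N.
  have := run_law M fc psi x0 W eta sampling N (k := k) (t := 0) (J := [::])
    (fun=> setT) (g := fun st _ => g st) (fun st _ => g0 st) isT isT.
  have -> : cylinder T B [::] (fun=> setT) = setT.
    by apply/seteqP; split.
  by rewrite setTI => ->; rewrite /cylinder_weight big_nil mul1r lee_fin; exact: gc.
Qed.

Hypotheses (n_gt0 : (0 < n)%N) (b_gt0 : (0 < b)%N).

Lemma t_zero_gt0 : (0 < t_zero n b)%N.
Proof. by rewrite divn_gt0 // -subn1 addnBA // addnC -addnBA // leq_addr. Qed.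

Let p01 : 0 < p <= 1.
Proof.
have t0 := t_zero_gt0.
by rewrite invr_gt0 ltr0n t0 /= invf_le1 ?ltr0n // ler1n.
Qed.

Lemma expected_length k :
  (\int[P]_omega ((T k omega).+1%:R)%:E <= (t_zero n b)%:R%:E)%E.
Proof.
have /andP[p0 p1] := p01.
have mT := T_measurable sampling k.
have mf A : measurable_fun A (EFin \o ((fun t : nat => t.+1%:R : R) \o T k)).
  exact: discretely_measurable_EFin.
have mE N : measurable (T k @^-1` `I_N) by exact: mT.
apply: (ge0_integral_le_exhaustion (E := fun N => T k @^-1` `I_N)) => //.
- by move=> N N' NN'; apply/subsetPset => w /= h; exact: leq_trans h NN'.
- by apply/seteqP; split => // w _; exists (T k w).+1 => /=.
- move=> N.
  rewrite (ge0_integral_partition (s := iota 0 N) P (mE N) mT) //.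
  + have -> : iota 0 N = index_iota 0 N by rewrite /index_iota subn0.
    rewrite big_mkord.
    rewrite (eq_bigr (fun t : 'I_N => (t.+1%:R * ((1 - p) ^+ t * p))%:E)); last first.
      move=> t _; have -> : T k @^-1` `I_N `&` T k @^-1` [set (t : nat)] = T k @^-1` [set (t : nat)].
        by apply/seteqP; split => w /= => [[]//|e]; split => //; rewrite e.
      transitivity (\int[P]_(omega in T k @^-1` [set (t : nat)]) cst (t.+1%:R%:E) omega)%E.
        by apply: eq_integral => w; rewrite inE /= => ->.
      rewrite integral_cst; last exact: mT.
      by case: sampling => _ hT _ _; rewrite EFinM; congr (_ * _)%E; exact: hT.
    rewrite sumEFin lee_fin.
    have E : p * \sum_(t < N) t.+1%:R * ((1 - p) ^+ t * p) = 1 - (1 - p) ^+ N - N%:R * p * (1 - p) ^+ N.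
      elim: N {mE} => [|N IH]; first by rewrite big_ord0 expr0; ring.
      by rewrite big_ord_recr /= mulrDr IH exprS -(natr1 N); ring.
    have -> : (t_zero n b)%:R = p^-1 by rewrite invrK.
    rewrite -(ler_pM2l p0) E mulfV ?lt0r_neq0 //.
    have q0 : 0 <= (1 - p) ^+ N by rewrite exprn_ge0 // subr_ge0.
    rewrite -addrA -opprD gerBl addr_ge0 // mulr_ge0 // mulr_ge0 //; exact: ltW.
  + exact: iota_uniq.
  + by move=> w /= h; rewrite mem_iota.
Qed.

Lemma expected_cost K (a c : nat) :
  (\int[P]_omega ((a + \sum_(k < K) (T k omega).+1 * c)%N%:R)%:E <=
    (a + K * (c * t_zero n b))%N%:R%:E)%E.
Proof.
have mT k := T_measurable sampling k.
have mf k A : measurable_fun A (EFin \o ((fun t : nat => t.+1%:R : R) \o T k)).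
  exact: discretely_measurable_EFin.
have E omega : ((a + \sum_(k < K) (T k omega).+1 * c)%N%:R)%:E =
   ((a%:R)%:E + \sum_(k < K) (c%:R%:E * ((T k omega).+1%:R)%:E))%E :> \bar R.
  rewrite natrD EFinD; congr (_ + _)%E; rewrite natr_sum -sumEFin.
  by apply: eq_bigr => k _; rewrite natrM EFinM muleC.
under eq_integral do rewrite E.
have mck k : measurable_fun setT (fun omega => (c%:R%:E * ((T k omega).+1%:R)%:E)%E : \bar R).
  apply: (discretely_measurable_EFin (fun t : nat => c%:R * t.+1%:R)).
  exact: mT.
have pos k omega : (0 <= c%:R%:E * ((T k omega).+1%:R)%:E :> \bar R)%E.
  by rewrite mule_ge0 // lee_fin.
rewrite ge0_integralD //; last 2 first.
- by move=> w _; apply: sume_ge0.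
- exact: emeasurable_sum.
rewrite integral_cst // [X in (_ * X + _)%E](_ : _ = 1%E); last exact: probability_setT.
rewrite mule1 natrD EFinD leeD2l //.
rewrite ge0_integral_sum //.
rewrite natrM -[K in leRHS]card_ord -sum1_card natr_sum mulr_suml -sumEFin.
apply: lee_sum => k _; rewrite ge0_integralZl //.
- rewrite mul1r natrM EFinM; apply: lee_wpmul2l; first by rewrite lee_fin.
  exact: expected_length.
- exact: (mf k setT).
Qed.

End Expectations.

(** * Convergence in expectation *)

Section Growth.
Variables (R : realType) (m n d : nat).
Variables (fc : 'I_m -> 'I_n -> 'rV[R]_d -> R) (psi : 'rV[R]_d -> \bar R).

Lemma objective_value x : psi x \is a fin_num ->
  objective fc psi x = (value fc psi x)%:E.
Proof. by move=> h; rewrite /objective /value EFinD fineK. Qed.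

Lemma objective_fin_num x : objective fc psi x \is a fin_num -> psi x \is a fin_num.
Proof. by rewrite /objective fin_numD => /andP[]. Qed.

Lemma minimizer_fin_num (x xstar : 'rV[R]_d) :
  proper_fun psi -> objective fc psi x \is a fin_num ->
  (forall y, (objective fc psi xstar <= objective fc psi y)%E) ->
  psi xstar \is a fin_num.
Proof.
move=> [/(_ xstar) psiN _] /objective_fin_num fx /(_ x).
rewrite (objective_value fx) /objective; move: psiN.
by case: (psi xstar).
Qed.

(** The minimizer is compared with the points [t x + (1 - t) xstar], whose objective is bounded by
    strong convexity; [t] is then divided out. *)
Lemma strong_convexity_growth (sigma : R) (xstar : 'rV[R]_d) :
  strongly_convex sigma (objective fc psi) ->
  (forall x, (objective fc psi xstar <= objective fc psi x)%E) ->
  psi xstar \is a fin_num -> forall x, psi x \is a fin_num ->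
  sigma / 2 * normsq (xstar - x) <= value fc psi x - value fc psi xstar.
Proof.
move=> sc opt fs x fx; rewrite -subr_le0.
apply: (@le0_of_small _ _ (sigma / 2 * normsq (xstar - x))) => t /andP[t0 t1].
have := sc x xstar t; rewrite (ltW t0) t1 => /(_ isT).
rewrite (objective_value fx) (objective_value fs) => /(le_trans (opt _)).
rewrite (objective_value fs) -!EFinM -!EFinD lee_fin normsq_sym => h.
rewrite -(ler_pM2l t0); move: h.
move: (value _ _ x) (value _ _ xstar) (normsq _) => vx vs N h.
nra.
Qed.

End Growth.

Section Convergence.
Variables (R : realType) (m n d b M : nat).
Variables (fc : 'I_m -> 'I_n -> 'rV[R]_d -> R) (psi : 'rV[R]_d -> \bar R).
Variables (W : 'M[R]_m) (L l1 l2 eta rho sigma : R) (x0 xstar : 'rV[R]_d).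
Hypotheses (m_gt0 : (0 < m)%N) (n_gt0 : (0 < n)%N) (b_gt0 : (0 < b)%N).
Hypotheses (fc_diff : forall i j x, differentiable (fc i j) x)
  (fc_smooth : forall i j, two_sided_smooth l1 l2 (fc i j))
  (f_convex : strongly_convex 0 (EFin \o f_global fc))
  (f_smooth : lipschitz_smooth L (f_global fc))
  (psi_proper : proper_fun psi) (psi_convex : strongly_convex 0 psi)
  (prox_exists : forall (c : R) (x : 'rV[R]_d), 0 < c -> exists z, is_prox c psi x z).
Hypotheses (L_ge0 : 0 <= L) (l1_gt0 : 0 < l1) (l1_le_l2 : l1 <= l2).
Hypotheses (eta_gt0 : 0 < eta) (rho_gt0 : 0 < rho) (rho_small : 10 * rho <= 1).
Hypothesis mix_mean : forall x : 'M[R]_(m, d), row_mean (fastmix W M x) = row_mean x.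
Hypothesis mix_dev : forall x : 'M[R]_(m, d), dev (fastmix W M x) <= rho ^+ 2 * dev x.
Hypothesis obj_convex : strongly_convex sigma (objective fc psi).
Hypothesis optimal : forall x, (objective fc psi xstar <= objective fc psi x)%E.
Hypothesis x0_fin : objective fc psi x0 \is a fin_num.
Let p : R := (t_zero n b)%:R^-1.
Hypothesis sigma_gt0 : 0 < sigma.
Hypotheses (eta_L : 4 * (eta * L) <= 1) (eta_sigma : eta * sigma <= 1)
  (eta_l : 48 * (eta ^+ 2 * (l1 * l2)) <= 1).
Hypothesis rate_small :
  1000 * (rate_err l2 eta rho * err_coef l2 eta (p * sigma / 50)) <= p.
Hypothesis b_large : 1 <= p * b%:R.

Variables (disp : measure_display) (Omega : measurableType disp).
Variables (P : probability Omega R) (T : nat -> Omega -> nat)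
  (B : nat -> nat -> 'I_m -> 'I_b -> Omega -> 'I_n).
Hypothesis sampling : pmgt_sampling P T B.

Let p_gt0 : 0 < p. Proof. by rewrite invr_gt0 ltr0n t_zero_gt0. Qed.
Let p_le1 : p <= 1.
Proof. by rewrite invf_le1 ?ltr0n ?t_zero_gt0 // ler1n t_zero_gt0. Qed.

Let psi_x0 : psi x0 \is a fin_num. Proof. exact: objective_fin_num x0_fin. Qed.

Let psi_xstar := minimizer_fin_num psi_proper x0_fin optimal.

Let growth := strong_convexity_growth obj_convex optimal psi_xstar.

Lemma outer_init_inv : outer_inv fc psi (outer_init fc x0).
Proof.
split; rewrite /= -/(consensus m x0); last by rewrite row_mean_consensus.
rewrite -/(consensus m (grad (f_global fc) x0)) row_mean_consensus //.
rewrite row_meanE grad_f_global //; congr (_ *: _); apply: eq_bigr => i _.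
by rewrite rowK row_consensus.
Qed.

(** All agents start at the same point with the same tracker, so the consensus error vanishes and
    the logarithm in the final bounds contains the initial gap alone. *)
Lemma lyapunov_init :
  lyapunov M fc psi W l2 eta sigma p xstar (outer_init fc x0) =
  value fc psi x0 - value fc psi xstar.
Proof.
have c0 v : dev (consensus m v : 'M[R]_(m, d)) = 0 by exact: dev_consensus.
have t0 : dev (tracker M fc W (outer_init fc x0)) = 0.
  apply/eqP; rewrite eq_le dev_ge0 andbT; apply: le_trans (mix_dev _) _.
  by rewrite /= addrK c0 mulr0.
rewrite /lyapunov /track_pot /outer_err t0 [dev _]c0 !mulr0 addr0 !mulr0 addr0.
by rewrite /gap /= -/(consensus m x0) row_mean_consensus.
Qed.

Lemma state_at_inv k omega :
  outer_inv fc psi (state_at M fc psi x0 W eta T B k omega).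
Proof.
elim: k => [|k IH]; first exact: outer_init_inv.
rewrite state_atS; apply: close_epoch_inv => //.
elim: (T k omega).+1 => [|t IHt]; first exact: (inner_start_inv M W IH).
rewrite inner_atS; exact: inner_inv_step.
Qed.

Lemma expected_gap K j k (eps : R) : k.+1 = (K * j)%N ->
  20 * (1 + p / (eta * sigma)) <= K%:R ->
  2^-1 ^+ j * (value fc psi x0 - value fc psi xstar) <= eps ->
  (\int[P]_omega objective fc psi
     (ybar fc psi x0 W eta M (T ^~ omega) (fun k' t i l => B k' t i l omega) k.+1)
   - objective fc psi xstar <= eps%:E)%E.
Proof.
move=> kE KB jeps; set vs := value fc psi xstar.
(* [expected_state_le] asks for a function nonnegative on every state, while the gap is known to be
   so only under the invariant. *)
pose h st := Num.max 0 (gap fc psi xstar st).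
have h0 st : 0 <= h st by rewrite /h le_max lexx.
pose X omega := state_at M fc psi x0 W eta T B k.+1 omega.
have XE omega : objective fc psi (ybar fc psi x0 W eta M (T ^~ omega)
     (fun k' t i l => B k' t i l omega) k.+1) = ((h (X omega))%:E + vs%:E)%E.
  have inv := state_at_inv k.+1 omega.
  have g0 := gap_ge0 sigma_gt0 growth inv.
  rewrite /h max_r // objective_value; last by case: inv.
  by rewrite -EFinD /gap subrK.
have hle : (\int[P]_omega (h (X omega))%:E <= eps%:E)%E.
  apply: expected_state_le => // N.
  apply: (@le_trans _ _ (run_op b M fc psi W eta p N k.+1 (gap fc psi xstar) (outer_init fc x0))).
    apply: run_op_le => //; last exact: outer_init_inv.
    by move=> st inv; rewrite /h max_r //; exact: (gap_ge0 sigma_gt0 growth inv).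
  rewrite kE; apply: le_trans jeps; rewrite -lyapunov_init.
  apply: (run_gap_geometric m_gt0 n_gt0 b_gt0 fc_diff fc_smooth f_convex f_smooth
    psi_proper psi_convex prox_exists L_ge0 l1_gt0 l1_le_l2 eta_gt0 rho_gt0 rho_small
    mix_mean mix_dev p_gt0 p_le1 sigma_gt0 psi_xstar growth eta_L eta_sigma eta_l
    rate_small b_large N j outer_init_inv KB).
have mX : discretely_measurable X.
  exact: (discretely_measurable_comp fst (run_measurable M fc psi x0 W eta sampling k.+1 0)).
(* The optimal value may be negative, so splitting the integral requires integrability rather than
   nonnegativity. *)
have ih : P.-integrable setT (EFin \o (h \o X)).
  apply/integrableP; split; first exact: discretely_measurable_EFin.
  apply: (@le_lt_trans _ _ eps%:E); last exact: ltry.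
  apply: le_trans hle; rewrite le_eqVlt; apply/orP; left; apply/eqP.
  by apply: eq_integral => w _; rewrite /= ger0_norm.
under eq_integral do rewrite XE.
rewrite (integralD measurableT ih (finite_measure_integrable_cst P vs measurableT)).
have -> : (\int[P]_x (EFin \o cst vs) x = vs%:E)%E.
  rewrite (integral_cst P measurableT vs%:E) [X in (_ * X)%E](_ : _ = 1%E) ?mule1 //.
  exact: probability_setT.
rewrite (objective_value fc psi_xstar) addeK //.
Qed.

End Convergence.

(** * Step size, mixing steps and complexity *)

Section Tuning.
Variable R : realType.

(** Keeps [ln Q / g] away from 0, so that rounding up the number of mixing steps only changes the
    constant. *)
Lemma ln_ge_two_thirds (x : R) : 3 <= x -> 2 / 3 <= ln x.
Proof.
move=> x3.
have h : ln (3^-1 : R) <= - (2 / 3).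
  have := @le_ln1Dx R (- (2 / 3)).
  have -> : 1 + - (2 / 3) = 3^-1 :> R by field.
  by apply; lra.
rewrite lnV ?posrE // in h.
apply: (@le_trans _ _ (ln 3)); first by lra.
by rewrite ler_ln ?posrE //; lra.
Qed.

Lemma truncnS_bounds (x : R) : 0 <= x ->
  x <= (Num.truncn x).+1%:R /\ (Num.truncn x).+1%:R <= x + 1.
Proof.
move=> /truncn_itv /andP[h1 h2]; split; first exact: ltW.
by rewrite -natr1 lerD2r.
Qed.

(* Enough for one FastMix call to shrink [dev] by [Q ^- 36], which absorbs the
   powers of [Q] lost in [rate_bound]. *)
Definition mixing_steps (g Q : R) : nat := (Num.truncn (84 * (ln Q / g))).+1.

Lemma mixing_steps_le (g Q : R) : 0 < g <= 1 -> 3 <= Q ->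
  (mixing_steps g Q)%:R <= 86 * (ln Q / g).
Proof.
move=> /andP[g0 g1] Q3; have l := ln_ge_two_thirds Q3.
have h : 2 / 3 <= ln Q / g.
  by rewrite ler_pdivlMr //; apply: le_trans l; rewrite ler_piMr //; lra.
have [] := @truncnS_bounds (84 * (ln Q / g)); first by lra.
by move=> _ h2; apply: le_trans h2 _; lra.
Qed.

(** [exp (- g M)] is [E ^- 4]. Two of the four factors pay for the square of [M.+1], up to a factor
    [Q] from [g ^- 2]. Since [84 / 4 = 21], the other two are at most [Q ^- 42], of which six powers
    of [Q] absorb [128 * Q]. *)
Lemma mixing_steps_decay (g Q h : R) (M := mixing_steps g Q) :
  0 < g <= 1 -> 3 <= Q -> (g ^+ 2)^-1 <= Q -> 0 <= h -> h <= expR (- g) ->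
  8 * M.+1%:R ^+ 2 * h ^+ M <= ((Q ^+ 18)^-1) ^+ 2.
Proof.
move=> /andP[g0 g1] Q3 gQ h0 hg; have l := ln_ge_two_thirds Q3.
have Q0 : 0 < Q by lra.
have [] := @truncnS_bounds (84 * (ln Q / g)).
  by rewrite mulr_ge0 // divr_ge0 //; lra.
rewrite -/(mixing_steps g Q) -/M => M1 _.
pose y := g * M%:R / 4; pose E := expR y.
have E0 : 0 < E := expR_gt0 _.
have gM : g * M.+1%:R <= 4 * E.
  have := expR_ge1Dx y; rewrite -/E /y -(natr1 M); lra.
have EQ : Q ^+ 21 <= E.
  rewrite -[Q]lnK ?posrE // -expRM_natl /E ler_expR /y.
  have : g * (84 * (ln Q / g)) <= g * M%:R by rewrite ler_pM2l.
  have -> : g * (84 * (ln Q / g)) = 84 * ln Q by field; rewrite lt0r_neq0.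
  lra.
have hM : h ^+ M <= (E ^+ 4)^-1.
  apply: (@le_trans _ _ (expR (- g) ^+ M)).
    by rewrite lerXn2r // nnegrE // expR_ge0.
  rewrite -expRM_natl -expRM_natl -expRN ler_expR /y.
  by rewrite le_eqVlt; apply/orP; left; apply/eqP; field.
have M2 : M.+1%:R ^+ 2 <= 16 * E ^+ 2 * Q.
  have h1 : (g * M.+1%:R) ^+ 2 <= (4 * E) ^+ 2.
    by rewrite lerXn2r // nnegrE mulr_ge0 // ltW.
  apply: (@le_trans _ _ ((4 * E) ^+ 2 * (g ^+ 2)^-1)).
    by rewrite ler_pdivlMr ?exprn_gt0 // mulrC -exprMn.
  have -> : 16 * E ^+ 2 * Q = (4 * E) ^+ 2 * Q by ring.
  by rewrite ler_pM2l // exprn_gt0 // mulr_gt0.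
have Q21 : 0 < Q ^+ 21 by rewrite exprn_gt0.
have E2 : (E ^+ 2)^-1 <= (Q ^+ 42)^-1.
  rewrite lef_pV2 ?posrE ?exprn_gt0 // -[42%N]/(21 * 2)%N exprM.
  by rewrite lerXn2r // nnegrE ltW.
have Q5 : 128 <= Q ^+ 5.
  apply: (@le_trans _ _ (3 ^+ 5)); first by rewrite -natrX ler_nat.
  by rewrite lerXn2r // nnegrE ltW.
apply: (@le_trans _ _ (8 * (16 * E ^+ 2 * Q) * (E ^+ 4)^-1)).
  apply: ler_pM => //; first by rewrite exprn_ge0.
  by rewrite ler_pM2l.
have -> : 8 * (16 * E ^+ 2 * Q) * (E ^+ 4)^-1 = 128 * Q * (E ^+ 2)^-1.
  by field; rewrite lt0r_neq0.
apply: (@le_trans _ _ (128 * Q * (Q ^+ 42)^-1)).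
  by rewrite ler_pM2l // mulr_gt0.
apply: (@le_trans _ _ (Q ^+ 5 * Q * (Q ^+ 42)^-1)).
  rewrite ler_pM2r ?invr_gt0 ?exprn_gt0 // ler_pM2r //.
have -> : Q ^+ 5 * Q * (Q ^+ 42)^-1 = ((Q ^+ 18)^-1) ^+ 2.
  by field; rewrite lt0r_neq0.
exact: lexx.
Qed.

Definition batch_size (n : nat) : nat := (Num.truncn (Num.sqrt n%:R : R)).+1.

(** [t_zero <= b] provides the hypothesis [b_large]. The upper bound on [t_zero * b] keeps an epoch
    at a multiple of [n] calls; the lower one makes epochs of length at least [sqrt n / 2]. *)
Lemma batch_size_bounds n : (0 < n)%N ->
  [/\ (batch_size n)%:R <= 2 * Num.sqrt n%:R :> R,
      (t_zero n (batch_size n) <= batch_size n)%N,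
      (t_zero n (batch_size n) * batch_size n <= 2 * n)%N,
      (n <= t_zero n (batch_size n) * batch_size n)%N &
      (batch_size n <= n.+1)%N].
Proof.
move=> n0; set b := batch_size n.
have n1 : 1 <= n%:R :> R by rewrite ler1n.
have s1 : 1 <= Num.sqrt n%:R :> R by rewrite -[leLHS]sqrtr1 ler_sqrt //; lra.
have s2 : Num.sqrt n%:R ^+ 2 = n%:R :> R by rewrite sqr_sqrtr //; lra.
have [h1 h2] := @truncnS_bounds (Num.sqrt n%:R) (sqrtr_ge0 _).
rewrite -/(batch_size n) -/b in h1 h2.
have nb : (n <= b * b)%N.
  rewrite -(ler_nat R) natrM -s2 expr2 ler_pM //; lra.
have bn : (b <= n.+1)%N.
  rewrite -(ler_nat R) -(natr1 n); apply: le_trans h2 _; rewrite lerD2r -[leRHS]s2 expr2.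
  by rewrite ler_peMr //; lra.
have b0 : (0 < b)%N by [].
have tb : (t_zero n b <= b)%N.
  by rewrite /t_zero -ltnS ltn_divLR //; nia.
have tbn : (t_zero n b * b <= n + b.-1)%N by exact: leq_divM.
split => //; first by lra.
  by apply: leq_trans tbn _; lia.
rewrite /t_zero; have := ltn_ceil (n + b.-1) b0; lia.
Qed.

End Tuning.

Section Rates.
Variable R : realType.

(** The exponent 18 is a count: 2 for [rate_err], 3 for [err_coef], [9 + 3] for the constants
    [10 ^ 4] and 12 (as [Q >= 3]), and 1 to reach [Q^-1 <= t^-1]. *)
Lemma rate_bound (Q l2 sigma eta t : R) :
  3 <= Q -> 0 <= l2 -> 0 < sigma -> l2 / sigma <= Q -> 0 < eta ->
  8 * (eta * sigma) <= 1 -> 1 <= t -> t <= Q ->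
  1000 * (rate_err l2 eta (Q ^+ 18)^-1 * err_coef l2 eta (t^-1 * sigma / 50)) <= t^-1.
Proof.
move=> Q3 l0 s0 lQ e0 es t1 tQ.
have Q0 : 0 < Q by lra.
have t0 : 0 < t by lra.
have l2E : l2 = l2 / sigma * sigma by rewrite divfK // lt0r_neq0.
have x0 : 0 <= l2 / sigma by rewrite divr_ge0 // ltW.
have el : 8 * (eta * l2) <= Q.
  rewrite l2E; move: (l2 / sigma) lQ x0 => x lQ x0.
  apply: le_trans lQ; rewrite -[leRHS]mul1r.
  have -> : 8 * (eta * (x * sigma)) = 8 * (eta * sigma) * x by ring.
  exact: ler_wpM2r.
have el0 : 0 <= eta * l2 by rewrite mulr_ge0 // ltW.
have el2 : 64 * (eta * l2) ^+ 2 <= Q ^+ 2.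
  have -> : 64 * (eta * l2) ^+ 2 = (8 * (eta * l2)) ^+ 2 by ring.
  by rewrite lerXn2r // nnegrE ?mulr_ge0 // ltW.
have Q2 : 1 <= Q ^+ 2 by rewrite expr_ge1 //; lra.
have Q23 : Q ^+ 2 <= Q ^+ 3 by rewrite ler_weXn2l //; lra.
have lamE : lam_err l2 eta = 2 * (eta * l2) ^+ 2 by rewrite /lam_err exprMn; ring.
have lamQ : lam_err l2 eta <= Q ^+ 2 by rewrite lamE; have := sqr_ge0 (eta * l2); lra.
have lam0 : 0 <= lam_err l2 eta by rewrite lamE mulr_ge0 ?sqr_ge0.
have c3 : eta * l2 ^+ 2 / (t^-1 * sigma / 50) <= 7 * Q ^+ 3.
  have -> : eta * l2 ^+ 2 / (t^-1 * sigma / 50) = 50 / 8 * (8 * (eta * l2) * (l2 / sigma) * t).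
    by field; rewrite !lt0r_neq0.
  have h : 8 * (eta * l2) * (l2 / sigma) * t <= Q * Q * Q.
    have e8 : 0 <= 8 * (eta * l2) by exact: mulr_ge0.
    apply: ler_pM => //; [exact: mulr_ge0|by lra|].
    exact: ler_pM.
  have Q30 : 0 <= Q ^+ 3 by rewrite exprn_ge0 // ltW.
  have -> : Q ^+ 3 = Q * Q * Q by ring.
  have : 0 <= Q * Q * Q by rewrite !mulr_ge0 // ltW.
  lra.
have ce : err_coef l2 eta (t^-1 * sigma / 50) <= 12 * Q ^+ 3.
  rewrite /err_coef; lra.
have ce0 : 0 <= err_coef l2 eta (t^-1 * sigma / 50).
  rewrite /err_coef; apply: addr_ge0; first by apply: addr_ge0 => //; exact: mulr_ge0.
  apply: divr_ge0; first by apply: mulr_ge0; [exact: ltW|exact: sqr_ge0].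
  apply: divr_ge0 => //; apply: mulr_ge0; last exact: ltW.
  by rewrite invr_ge0 ltW.
have re : rate_err l2 eta (Q ^+ 18)^-1 <= (Q ^+ 18)^-1 * (10 * Q ^+ 2).
  rewrite /rate_err ler_pM2l ?invr_gt0 ?exprn_gt0 //; lra.
have re0 : 0 <= rate_err l2 eta (Q ^+ 18)^-1.
  by rewrite /rate_err mulr_ge0 ?invr_ge0 ?exprn_ge0 ?addr_ge0 ?mulr_ge0 // ltW.
have n1 : 1000 * 10 <= Q ^+ 9.
  apply: (@le_trans _ _ (3 ^+ 9)); last by rewrite lerXn2r // nnegrE ltW.
  have -> : 3 ^+ 9 = 27 * 27 * 27 :> R by ring.
  lra.
have n2 : 12 <= Q ^+ 3.
  apply: (@le_trans _ _ (3 ^+ 3)); last by rewrite lerXn2r // nnegrE ltW.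
  by rewrite -natrX ler_nat.
apply: (@le_trans _ _ (1000 * ((Q ^+ 18)^-1 * (10 * Q ^+ 2) * (12 * Q ^+ 3)))).
  by rewrite ler_pM2l ?ltr0n //; apply: ler_pM.
have -> : 1000 * ((Q ^+ 18)^-1 * (10 * Q ^+ 2) * (12 * Q ^+ 3)) =
   (1000 * 10) * 12 * (Q ^+ 5 * (Q ^+ 18)^-1) by ring.
apply: (@le_trans _ _ (Q ^+ 9 * Q ^+ 3 * (Q ^+ 5 * (Q ^+ 18)^-1))).
  apply: ler_wpM2r; first by rewrite mulr_ge0 ?invr_ge0 ?exprn_ge0 // ltW.
  by apply: ler_pM; [lra|lra|exact: n1|exact: n2].
have -> : Q ^+ 9 * Q ^+ 3 * (Q ^+ 5 * (Q ^+ 18)^-1) = Q^-1.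
  by field; rewrite lt0r_neq0.
by rewrite lef_pV2.
Qed.

(** [341 = 20 * (1 + 16) + 1], the final 1 coming from rounding. *)
Lemma epoch_count_le (kappa x s : R) : 1 <= s -> 0 <= kappa -> 0 <= x ->
  x * s <= 16 * (kappa + 1) ->
  (Num.truncn (20 * (1 + x))).+1%:R <= 341 * (1 + kappa / s).
Proof.
move=> s1 k0 x0 h.
have s0 : 0 < s by lra.
have [] := @truncnS_bounds R (20 * (1 + x)); first by lra.
move=> _ h1; apply: le_trans h1 _.
have h2 : x <= 16 * (kappa / s) + 16 / s.
  rewrite -(ler_pM2r s0); apply: le_trans h _.
  rewrite le_eqVlt; apply/orP; left; apply/eqP; field.
  by rewrite lt0r_neq0.
have h3 : 16 / s <= 16 by rewrite ler_pdivrMr // ler_peMr.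
have h4 : 0 <= kappa / s by rewrite divr_ge0 // ltW.
lra.
Qed.

(** [1/2 <= exp (- 1/2)], so twice the logarithm of halvings suffices. The lower bound 1 built into
    [log_acc] absorbs the rounding. *)
Lemma accuracy_count (Delta eps : R) (j := (Num.truncn (2 * log_acc Delta eps)).+1) :
  0 < eps -> 0 <= Delta ->
  2^-1 ^+ j * Delta <= eps /\ j%:R <= 3 * log_acc Delta eps.
Proof.
move=> e0 D0; set LA := log_acc Delta eps in j *.
have LA1 : 1 <= LA by rewrite /LA /log_acc le_max lexx.
have [h1 h2] := @truncnS_bounds R (2 * LA) (ltac:(lra)).
split; last by apply: le_trans h2 _; lra.
(* The initial point may already be optimal; the logarithm then has a zero argument and [lnK] does
   not apply. *)
have [->|Dn] := eqVneq Delta 0; first by rewrite mulr0 ltW.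
have Dp : 0 < Delta by rewrite lt_def Dn.
have LAl : ln (Delta / eps) <= LA by rewrite /LA /log_acc le_max lexx orbT.
have half : 2^-1 <= expR (- 2^-1) :> R.
  by apply: le_trans (expR_ge1Dx _); lra.
apply: (@le_trans _ _ (expR (- ln (Delta / eps)) * Delta)).
  rewrite ler_pM2r //; apply: (@le_trans _ _ (expR (- 2^-1) ^+ j)).
    by rewrite lerXn2r // nnegrE ?invr_ge0 // expR_ge0.
  rewrite -expRM_natl ler_expR; rewrite -/j in h1; lra.
rewrite expRN lnK ?posrE ?divr_gt0 // invf_div divfK //.
Qed.

End Rates.

Section Complexity.
Variable R : realType.

(** With a sum in place of a maximum, [(eta * sigma)^-1] is exactly [8 * (kappa + 1)]. *)
Definition step_size (L S sigma : R) : R := (8 * (L + S + sigma))^-1.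

Lemma step_size_bounds (L S sigma : R) (eta := step_size L S sigma) :
  0 <= L -> 0 <= S -> 0 < sigma ->
  [/\ 0 < eta, 8 * (eta * L) <= 1, 8 * (eta * S) <= 1, 8 * (eta * sigma) <= 1 &
      (eta * sigma)^-1 = 8 * ((L + S) / sigma + 1)].
Proof.
move=> L0 S0 s0.
have D0 : 0 < L + S + sigma by lra.
have e0 : 0 < eta by rewrite invr_gt0 mulr_gt0.
have part x : x <= L + S + sigma -> 8 * (eta * x) <= 1.
  move=> xD; apply: (@le_trans _ _ (8 * (eta * (L + S + sigma)))).
    by rewrite !ler_pM2l.
  by rewrite le_eqVlt; apply/orP; left; apply/eqP; rewrite /eta /step_size; field; rewrite lt0r_neq0.
split => //; [by apply: part; lra..|].
by rewrite /eta /step_size; field; rewrite !lt0r_neq0.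
Qed.

Lemma step_size_conditions (L l1 l2 sigma : R)
    (eta := step_size L (Num.sqrt (l1 * l2)) sigma) :
  0 <= L -> 0 <= l1 * l2 -> 0 < sigma ->
  [/\ 4 * (eta * L) <= 1, eta * sigma <= 1 & 48 * (eta ^+ 2 * (l1 * l2)) <= 1].
Proof.
move=> L0 l0 s0; have [e0 h1 h2 h3 _] := step_size_bounds L0 (sqrtr_ge0 (l1 * l2)) s0.
rewrite -/eta in e0 h1 h2 h3.
have a1 : 0 <= eta * L by exact: mulr_ge0 (ltW e0) L0.
have a2 : 0 <= eta * Num.sqrt (l1 * l2) by exact: mulr_ge0 (ltW e0) (sqrtr_ge0 _).
have a3 : 0 < eta * sigma by exact: mulr_gt0.
rewrite -(sqr_sqrtr l0) -exprMn.
move: (eta * L) (eta * Num.sqrt _) (eta * sigma) h1 h2 h3 a1 a2 a3 => x y z h1 h2 h3 a1 a2 a3.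
by split; nra.
Qed.

Lemma mixing_contracts (m d : nat) (nbr : rel 'I_m) (W : 'M[R]_m) (Q : R)
    (x : 'M[R]_(m, d)) :
  gossip_matrix nbr W -> (0 < m)%N -> 3 <= Q -> (1 - lambda2 W)^-1 <= Q ->
  dev (fastmix W (mixing_steps (Num.sqrt (1 - lambda2 W)) Q) x) <=
    ((Q ^+ 18)^-1) ^+ 2 * dev x.
Proof.
move=> HW m0 Q3 lQ; have [l0 l1 _] := gossip_lambda2 HW m0.
have g0 : 0 < Num.sqrt (1 - lambda2 W) by rewrite sqrtr_gt0; lra.
have /andP[h0 _] := eta_w_bounds W.
apply: le_trans (dev_fastmix HW m0 _ _) _; rewrite ler_wpM2r ?dev_ge0 //.
apply: mixing_steps_decay => //.
- rewrite g0 -[leRHS](sqrtr1 R) ler_sqrt //; lra.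
- by rewrite sqr_sqrtr //; lra.
- exact: eta_w_le_exp HW m0.
Qed.

Lemma expected_sfo_calls (m n b K : nat) (disp : measure_display)
    (Omega : measurableType disp) (P : probability Omega R)
    (T : nat -> Omega -> nat) (B : nat -> nat -> 'I_m -> 'I_b -> Omega -> 'I_n) :
  pmgt_sampling P T B -> (0 < n)%N -> (0 < b)%N -> (0 < K)%N ->
  (t_zero n b * b <= 2 * n)%N ->
  ('E_P[fun omega => (sfo_calls n b (T ^~ omega) K)%:R] <= (7 * n * K)%N%:R%:E)%E.
Proof.
move=> hs n0 b0 K0 tb; rewrite expectation.unlock.
under eq_integral do rewrite /sfo_calls big_split sum_nat_const card_ord addnA.
apply: le_trans (expected_cost hs n0 b0 _ _ _) _; rewrite lee_fin ler_nat.
have : (K * (2 * b * t_zero n b) <= K * (2 * (2 * n)))%N.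
  by rewrite leq_mul2l -mulnA [(b * _)%N]mulnC leq_mul2l tb !orbT.
nia.
Qed.

Lemma expected_comm_rounds (m n b M K : nat) (disp : measure_display)
    (Omega : measurableType disp) (P : probability Omega R)
    (T : nat -> Omega -> nat) (B : nat -> nat -> 'I_m -> 'I_b -> Omega -> 'I_n) :
  pmgt_sampling P T B -> (0 < n)%N -> (0 < b)%N ->
  ('E_P[fun omega => (comm_rounds M (T ^~ omega) K)%:R] <=
     (3 * K * M * t_zero n b)%N%:R%:E)%E.
Proof.
move=> hs n0 b0; rewrite expectation.unlock.
under eq_integral do rewrite /comm_rounds big_split sum_nat_const card_ord.
apply: le_trans (expected_cost hs n0 b0 _ _ _) _; rewrite lee_fin ler_nat.
have := t_zero_gt0 n0 b0; nia.
Qed.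

Lemma epoch_count_bound (n : nat) (L S sigma : R)
    (t := (t_zero n (batch_size R n))%:R) :
  (0 < n)%N -> 0 <= L -> 0 <= S -> 0 < sigma ->
  (Num.truncn (20 * (1 + t^-1 / (step_size L S sigma * sigma)))).+1%:R <=
    341 * (1 + (L + S) / sigma / Num.sqrt n%:R).
Proof.
move=> n0 L0 S0 s0; have [e0 _ _ _ eE] := step_size_bounds L0 S0 s0.
have [b1 _ _ b4 _] := batch_size_bounds R n0.
have n1 : 1 <= n%:R :> R by rewrite ler1n.
have r1 : 1 <= Num.sqrt n%:R :> R by rewrite -[leLHS]sqrtr1 ler_sqrt //; lra.
have r2 : Num.sqrt n%:R * Num.sqrt n%:R = n%:R :> R by rewrite -expr2 sqr_sqrtr //; lra.
have k0 : 0 <= (L + S) / sigma by rewrite divr_ge0 ?addr_ge0 // ltW.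
have t0 : 0 < t by rewrite ltr0n t_zero_gt0.
apply: epoch_count_le => //.
  by rewrite divr_ge0 ?invr_ge0 ?(ltW t0) // mulr_ge0 // ltW.
have rt : Num.sqrt n%:R <= 2 * t.
  have r0 : 0 < Num.sqrt n%:R :> R by lra.
  rewrite -(ler_pM2l r0) r2.
  apply: (@le_trans _ _ (t * (batch_size R n)%:R)); first by rewrite -natrM ler_nat.
  have -> : Num.sqrt n%:R * (2 * t) = t * (2 * Num.sqrt n%:R) by ring.
  by rewrite ler_pM2l.
rewrite eE; move: (Num.sqrt _) ((L + S) / sigma) rt k0 => r k rt k0.
have -> : t^-1 * (8 * (k + 1)) * r = 8 * (k + 1) * (r / t) by ring.
have -> : 16 * (k + 1) = 8 * (k + 1) * 2 by ring.
rewrite ler_pM2l ?mulr_gt0 //; last lra.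
by rewrite ler_pdivrMr.
Qed.

End Complexity.

Theorem theorem4p1 (R : realType) :
  exists (C1 C2 : R) (q : nat), 0 < C1 /\ 0 < C2 /\
  forall (m n : nat) (nbr : rel 'I_m) (W : 'M[R]_m)
         (L l1 l2 sigma_f sigma_psi : R),
  (0 < m)%N -> (0 < n)%N ->
  gossip_matrix nbr W ->
  0 <= L -> 0 < l1 -> l1 <= l2 ->
  0 <= sigma_f -> 0 <= sigma_psi -> 0 < sigma_f + sigma_psi ->
  let sigma := sigma_f + sigma_psi in
  let kappa := (L + Num.sqrt (l1 * l2)) / sigma in
  exists (eta : R) (b M : nat), [/\ 0 < eta, (0 < b)%N & (0 < M)%N] /\
  forall (d : nat) (fc : 'I_m -> 'I_n -> 'rV[R]_d -> R)
         (psi : 'rV[R]_d -> \bar R) (x0 xstar : 'rV[R]_d),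
  (0 < d)%N ->
  (forall i j x, differentiable (fc i j) x) ->
  (forall i j, two_sided_smooth l1 l2 (fc i j)) ->
  strongly_convex 0 (EFin \o f_global fc) ->
  lipschitz_smooth L (f_global fc) ->
  strongly_convex sigma_f (EFin \o f_global fc) ->
  proper_fun psi ->
  strongly_convex 0 psi ->
  strongly_convex sigma_psi psi ->
  strongly_convex sigma (objective fc psi) ->
  (forall (c : R) (x : 'rV[R]_d), 0 < c -> exists z, is_prox c psi x z) ->
  (forall x, (objective fc psi xstar <= objective fc psi x)%E) ->
  objective fc psi x0 \is a fin_num ->
  let Delta := fine (objective fc psi x0 - objective fc psi xstar)%E in
  forall eps : R, 0 < eps ->
  exists k : nat,
  forall (disp : measure_display) (Omega : measurableType disp)
         (P : probability Omega R)
         (T : nat -> Omega -> nat)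
         (B : nat -> nat -> 'I_m -> 'I_b -> Omega -> 'I_n),
  pmgt_sampling P T B ->
  [/\ (\int[P]_omega
         objective fc psi
           (ybar fc psi x0 W eta M (T ^~ omega)
                 (fun k' t i l => B k' t i l omega) k.+1)
       - objective fc psi xstar <= eps%:E)%E,
      ('E_P[fun omega => (sfo_calls n b (T ^~ omega) k.+1)%:R]
       <= (C1 * (n%:R + kappa * Num.sqrt n%:R) * log_acc Delta eps)%:E)%E &
      ('E_P[fun omega => (comm_rounds M (T ^~ omega) k.+1)%:R]
       <= (C2 * ((Num.sqrt n%:R + kappa) / Num.sqrt (1 - lambda2 W))
             * log_acc Delta eps
             * log_params m n L l1 l2 sigma (lambda2 W) ^+ q)%:E)%E].
Proof.
(* [1023 = 341 * 3] bounds epochs times halvings; 7 counts gradients per epoch in units of [n]; 6 is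
   3 from [expected_comm_rounds] times 2 from [t_zero <= 2 sqrt n]; 86 comes from [mixing_steps_le].
   The exponent 1 is the single [ln Q] in the number of mixing steps. *)
exists (7 * 1023), (6 * 86 * 1023), 1%N.
split; first by rewrite mulr_gt0 ?ltr0n.
split; first by rewrite !mulr_gt0 ?ltr0n.
move=> m n nbr W L l1 l2 sigma_f sigma_psi m0 n0 HW L0 l10 l12 sf0 sp0 s0 sigma kappa.
rewrite -/sigma in s0.
have [lam0 lam1 _] := gossip_lambda2 HW m0.
have l20 : 0 < l2 by exact: lt_le_trans l12.
pose S := Num.sqrt (l1 * l2); have S0 : 0 <= S := sqrtr_ge0 _.
have l120 : 0 <= l1 * l2 by rewrite mulr_ge0 // ltW.
pose g := Num.sqrt (1 - lambda2 W); have g0 : 0 < g by rewrite sqrtr_gt0; lra.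
have g1 : g <= 1 by rewrite -[leRHS](sqrtr1 R) ler_sqrt //; lra.
(* The argument of the logarithm in [log_params]. It dominates every parameter to be beaten by
   mixing, and it is known before the dimension and the functions, as [eta], [b] and [M] must be. *)
pose Q := m%:R + n%:R + L / sigma + l1 / sigma + l2 / sigma + (1 - lambda2 W)^-1.
have [Q3 nQ lQ lamQ] : [/\ 3 <= Q, n%:R + 1 <= Q, l2 / sigma <= Q & (1 - lambda2 W)^-1 <= Q].
  have a1 : 1 <= m%:R :> R by rewrite ler1n.
  have a2 : 1 <= n%:R :> R by rewrite ler1n.
  have a3 : 0 <= L / sigma by rewrite divr_ge0 // ltW.
  have a4 : 0 <= l1 / sigma by rewrite divr_ge0 // ltW.
  have a5 : 0 <= l2 / sigma by rewrite divr_ge0 // ltW.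
  have a6 : 1 <= (1 - lambda2 W)^-1 by rewrite invf_ge1; lra.
  rewrite /Q; move: (L / sigma) (l1 / sigma) (l2 / sigma) (1 - lambda2 W)^-1 a3 a4 a5 a6.
  by move=> *; split; lra.
have Q0 : 0 < Q := lt_le_trans (ltr0n _ 3) Q3.
have Qp : 0 < (Q ^+ 18)^-1 by rewrite invr_gt0 exprn_gt0.
have gg : 0 < g <= 1 by rewrite g0.
pose eta := step_size L S sigma; pose b := batch_size R n; pose M := mixing_steps g Q.
have [e0 eL eS es _] := step_size_bounds L0 S0 s0; rewrite -/eta in e0 eL eS es.
exists eta, b, M; split => // d fc psi x0 xstar d0 fdiff fsm fconv fL _ psip psic _ oc pex opt x0f Delta eps eps0.
have fx0 := objective_fin_num x0f.
have fxs := minimizer_fin_num psip x0f opt.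
have DE : Delta = value fc psi x0 - value fc psi xstar.
  by rewrite /Delta !objective_value.
have D0 : 0 <= Delta.
  by have := opt x0; rewrite !objective_value // lee_fin DE subr_ge0.
have [b1 b2 b3 b4 b5] := batch_size_bounds R n0; rewrite -/b in b1 b2 b3 b4 b5.
have tz0 : (0 < t_zero n b)%N by exact: t_zero_gt0.
pose t : R := (t_zero n b)%:R.
have tz1 : 1 <= t by rewrite ler1n.
have tzQ : t <= Q by apply: le_trans nQ; rewrite natr1 ler_nat; exact: leq_trans b5.
pose K0 := (Num.truncn (20 * (1 + t^-1 / (eta * sigma)))).+1.
pose LA := log_acc Delta eps; pose j := (Num.truncn (2 * LA)).+1.
have [jD jLA] := accuracy_count eps0 D0; rewrite -/LA -/j in jD jLA.
have K0le : K0%:R <= 341 * (1 + kappa / Num.sqrt n%:R) := epoch_count_bound n0 L0 S0 s0.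
have KE : (K0 * j).-1.+1 = (K0 * j)%N by rewrite prednK // muln_gt0.
(* [j] halvings of [K0] epochs each; the predecessor because the statement counts [k.+1] epochs. *)
exists (K0 * j).-1 => disp Omega P T B hs; rewrite KE.
have n1 : 1 <= n%:R :> R by rewrite ler1n.
pose r : R := Num.sqrt n%:R.
have r1 : 1 <= r by rewrite -[leLHS]sqrtr1 ler_sqrt // ler0n.
have r2 : r * r = n%:R by rewrite -expr2 sqr_sqrtr // ler0n.
have r0 : 0 < r := lt_le_trans ltr01 r1.
have LA0 : 0 <= LA by rewrite /LA /log_acc le_max ler01.
have k0 : 0 <= kappa by rewrite divr_ge0 ?addr_ge0 // ltW.
(* Multiplying by [r] turns [1 + kappa / r] into [r + kappa]; both costs below contain a factor [r],
   and the gradient count a second one. *)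
have Kle : (K0 * j)%N%:R * r <= 1023 * (r + kappa) * LA.
  have -> : 1023 * (r + kappa) * LA = 341 * (1 + kappa / r) * (3 * LA) * r.
    by field; rewrite lt0r_neq0.
  by rewrite ler_pM2r // natrM ler_pM.
split.
- rewrite -KE.
  have [c1 c2 c3] := step_size_conditions L0 l120 s0.
  have rho_small : 10 * (Q ^+ 18)^-1 <= 1.
    rewrite ler_pdivrMr ?exprn_gt0 // mul1r; apply: (@le_trans _ _ (3 ^+ 3)).
      by rewrite -natrX ler_nat.
    apply: (@le_trans _ _ (3 ^+ 18)); first by rewrite ler_weXn2l // ler1n.
    by rewrite lerXn2r // nnegrE ltW.
  have rate := rate_bound Q3 (ltW l20) s0 lQ e0 es tz1 tzQ.
  have bl : 1 <= (t_zero n b)%:R^-1 * b%:R :> R.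
    by rewrite mulrC ler_pdivlMr ?ltr0n // mul1r ler_nat.
  have KB : 20 * (1 + t^-1 / (eta * sigma)) <= K0%:R.
    by apply: (truncnS_bounds _).1; rewrite mulr_ge0 // addr_ge0 // divr_ge0 // ?invr_ge0 // mulr_ge0 // ltW.
  apply: (@expected_gap _ _ _ _ b M _ _ _ _ _ _ _ _ _ _ _ m0 n0 isT fdiff fsm fconv fL psip psic pex L0 l10 l12 e0
    Qp rho_small (row_mean_fastmix HW _) (fun x => mixing_contracts x HW m0 Q3 lamQ)
    oc opt x0f s0 c1 c2 c3 rate bl _ _ _ _ _ hs _ _ _ _ KE KB).
  by rewrite -DE.
- apply: le_trans (expected_sfo_calls hs n0 isT _ b3) _; first by rewrite muln_gt0.
  rewrite lee_fin.
  have -> : 7 * 1023 * (n%:R + kappa * r) * LA = 7 * (1023 * (r + kappa) * LA) * r.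
    by rewrite -r2; ring.
  have -> : (7 * n * (K0 * j))%N%:R = 7 * ((K0 * j)%N%:R * r) * r :> R.
    by rewrite 2!natrM -r2; ring.
  by rewrite ler_pM2r // ler_pM2l ?ltr0n.
- apply: le_trans (expected_comm_rounds M (K0 * j) hs n0 isT) _.
  rewrite lee_fin expr1 /log_params -/Q -/g -/r -/LA.
  have Mle := mixing_steps_le gg Q3; rewrite -/M in Mle.
  have tr : t <= 2 * r by apply: le_trans b1; rewrite ler_nat.
  have -> : 6 * 86 * 1023 * ((r + kappa) / g) * LA * ln Q =
    3 * (1023 * (r + kappa) * LA * (86 * (ln Q / g)) * 2) by ring.
  have -> : (3 * (K0 * j) * M * t_zero n b)%N%:R = 3 * ((K0 * j)%N%:R * M%:R * t) :> R.
    by rewrite 3!natrM -!mulrA.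
  rewrite ler_pM2l ?ltr0n //.
  apply: (@le_trans _ _ ((K0 * j)%N%:R * M%:R * (2 * r))).
    by apply: ler_wpM2l => //; exact: mulr_ge0.
  have -> : (K0 * j)%N%:R * M%:R * (2 * r) = (K0 * j)%N%:R * r * M%:R * 2 by ring.
  rewrite ler_pM2r ?ltr0n //; apply: ler_pM => //; exact: mulr_ge0 (ltW r0).
Qed.
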